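(* Let $k$ be a field of characteristic zero, $X$ a geometrically connected variety over $k$, $\overline U<\pi_1(\overline X)$ a closed subgroup normal in $\pi_1(X)$, $\overline A=\pi_1(\overline X)/\overline U$, $(k_i)_{i\in I}$ a family of field extensions of $k$ with restriction maps $\theta_i:\Gamma_i\to\Gamma_k$, and $(s_i:\Gamma_i\to\pi_1^U(X))_{i\in I}$ a tuple of section maps (all as described in the context). Let $(E_U)$ denote the exact sequence $1\to\overline A\to\pi_1^U(X)\to\Gamma_k\to1$. Assume ($\ast\ast$) the union of the conjugates in $\Gamma_k$ of all the images $\theta_i(\Gamma_i)$, $i\in I$, is dense in $\Gamma_k$. Then the following properties are equivalent: (a) For every finite $k$-group scheme $G$ and every $\alpha\in H^1(X,G)$ such that the corresponding element $\bar\alpha\in H^1(\overline X,\overline G)$ has trivial restriction to $\overline U$, the family $(\alpha(s_i))\in\prod_{i\in I}H^1(k_i,G)$ belongs to the diagonal image of $H^1(k,G)$. (a') For every finite constant $k$-group scheme $G$ and every $\alpha\in H^1(X,G)$ such that $\bar\alpha$ has trivial restriction to $\overline U$, the family $(\alpha(s_i))\in\prod_{i\in I}H^1(k_i,G)$ belongs to the diagonal image of $H^1(k,G)$. (b) There exists a continuous homomorphism $s:\Gamma_k\to\pi_1^U(X)$ such that for each $i\in I$ we have $s_i=s\circ\theta_i$ up to conjugation by an element of $\pi_1^U(X)$. (c) There exists a section $s:\Gamma_k\to\pi_1^U(X)$ of $(E_U)$ such that for each $i\in I$ we have $s_i=s\circ\theta_i$ up to conjugation by an element of $\overline A$. (d)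 The sequence $(E_U)$ admits a section and the following property (a'') holds: for every finite $k$-group scheme $G$ and every $\alpha\in H^1(X,G)$ such that $\bar\alpha$ has trivial restriction to $\overline U$ and is surjective (equivalently, the $G$-torsor $Y\to X$ corresponding to $\alpha$ is geometrically connected), the family $(\alpha(s_i))\in\prod_{i\in I}H^1(k_i,G)$ belongs to the diagonal image of $H^1(k,G)$.
   Context: Let $k$ be a field of characteristic zero with algebraic closure $\bar k$, $\Gamma_k=\mathrm{Gal}(\bar k/k)$, and $X$ a geometrically connected variety over $k$ with a fixed geometric point $\bar x\in X(\bar k)$; $\overline X=X\times_k\bar k$. Étale fundamental groups $\pi_1(X)=\pi_1(X,\bar x)$, $\pi_1(\overline X)=\pi_1(\overline X,\bar x)$ sit in the fundamental exact sequence $1\to\pi_1(\overline X)\to\pi_1(X)\to\Gamma_k\to1$. Let $\overline U<\pi_1(\overline X)$ be a closed subgroup normal in $\pi_1(X)$, $\overline A=\pi_1(\overline X)/\overline U$, $\pi_1^U(X)=\pi_1(X)/\overline U$; there is an exact sequence $1\to\overline A\to\pi_1^U(X)\to\Gamma_k\to1$. All homomorphisms and sections are continuous. Let $(k_i)_{i\in I}$ be a family of field extensions of $k$; fix algebraic closures $\bar k_i$ and embeddings $\bar k\to\bar k_i$ over $k\subset k_i$, and let $\Gamma_i=\mathrm{Gal}(\bar k_i/k_i)$ with restriction maps $\theta_i:\Gamma_i\to\Gamma_k$. Put $X_i=X\times_kk_i$ with the induced geometric point $\bar x_i$ above $\bar x$. For each $i$ let $\sigma_i:\Gamma_i\to\pi_1(X_i,\bar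 x_i)$ be a section of the fundamental exact sequence of $X_i$; the associated section map is the composite $s_i:\Gamma_i\xrightarrow{\sigma_i}\pi_1(X_i)\to\pi_1(X)\to\pi_1^U(X)$. For a finite $k$-group scheme $G$, $H^1(X,G)=H^1(\pi_1(X),G(\bar k))$ with $\pi_1(X)$ acting through $\Gamma_k$, and $H^1(\overline X,\overline G)$ ($\overline G=G\times_k\bar k$) is the set of continuous homomorphisms $\pi_1(\overline X)\to G(\bar k)$ up to conjugation in $G(\bar k)$; $\bar\alpha$ is called surjective if such a homomorphism representing it is surjective. If $\alpha\in H^1(X,G)$ has image $\bar\alpha\in H^1(\overline X,\overline G)$ with trivial restriction to $\overline U$, then $\alpha$ comes from a unique class in $H^1(\pi_1^U(X),G(\bar k))$, and $\alpha(s_i):=s_i^*(\alpha)\in H^1(\Gamma_i,G(\bar k))=H^1(k_i,G)$, where $\Gamma_i$ acts on $G(\bar k)$ via $\theta_i$. *)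

(* Defs.v *)
From HB Require Import structures.
From mathcomp Require Import all_boot all_order all_algebra all_fingroup.
From Stdlib Require Import ClassicalEpsilon FunctionalExtensionality.
From Stdlib Require Import PropExtensionality ProofIrrelevance.
Set Implicit Arguments. Unset Strict Implicit. Unset Printing Implicit Defensive.
Import GRing.Theory.
Local Open Scope ring_scope.

(* Groups with a topology.  An etale fundamental group consists of functions
   on the (large) category of finite etale covers, so it does not fit in the
   universe of the library's groupType and topologicalType; all groups below
   are therefore instances of the following record. *)

Record tgroup := TGroup {
  tsort :> Type;
  tmul : tsort -> tsort -> tsort;
  tone : tsort;
  tinv : tsort -> tsort;
  tmulA : forall x y z, tmul x (tmul y z) = tmul (tmul x y) z;
  tmul1l : forall x, tmul tone x = x;
  tmulVl : forall x, tmul (tinv x) x = tone;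
  topen : (tsort -> Prop) -> Prop;
  topenT : topen (fun=> True);
  topenI : forall A B, topen A -> topen B -> topen (fun x => A x /\ B x);
  topenU : forall F : (tsort -> Prop) -> Prop, (forall A, F A -> topen A) ->
    topen (fun x => exists2 A, F A & A x) }.

Arguments tone {t}.

Declare Scope tgroup_scope.
Delimit Scope tgroup_scope with tg.
Bind Scope tgroup_scope with tsort.
Notation "x * y" := (tmul x y) : tgroup_scope.
Notation "x ^-1" := (tinv x) : tgroup_scope.
Notation "1" := (@tone _) : tgroup_scope.

Definition is_hom (P Q : tgroup) (f : P -> Q) : Prop :=
  forall x y, f (x * y)%tg = (f x * f y)%tg.

Definition tcontinuous (P Q : tgroup) (f : P -> Q) : Prop :=
  forall A, topen A -> topen (fun x => A (f x)).

Definition tclosed (P : tgroup) (A : P -> Prop) : Prop :=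
  topen (fun x => ~ A x).

Definition tdense (P : tgroup) (A : P -> Prop) : Prop :=
  forall B, topen B -> (exists x, B x) -> exists2 x, A x & B x.

Definition is_subgroup (P : tgroup) (A : P -> Prop) : Prop :=
  [/\ A 1%tg, forall x y, A x -> A y -> A (x * y)%tg
    & forall x, A x -> A (x^-1)%tg].

Record normal_subgroup (P : tgroup) := NormalSubgroup {
  nset :> P -> Prop;
  nset_subgroup : is_subgroup nset;
  nset_normal : forall x y, nset x -> nset (y * x * y^-1)%tg }.

Section Quotient.
Variables (P : tgroup) (N : normal_subgroup P).

Lemma tmulVr (x : P) : (x * x^-1 = 1)%tg.
Proof.
rewrite -[LHS](tmul1l) -{1}(tmulVl (tinv x)) -tmulA.
by rewrite (tmulA (tinv x)) tmulVl tmul1l tmulVl.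
Qed.

Lemma tmul1r (x : P) : (x * 1 = x)%tg.
Proof. by rewrite -(tmulVl x) tmulA tmulVr tmul1l. Qed.

Lemma tinv_uniq (x y : P) : (x * y = 1)%tg -> y = (x^-1)%tg.
Proof. by move=> e; rewrite -(tmul1l y) -(tmulVl x) -tmulA e tmul1r. Qed.

Lemma tinvM (x y : P) : ((x * y)^-1 = y^-1 * x^-1)%tg.
Proof.
apply/esym/tinv_uniq.
by rewrite -tmulA (tmulA y) tmulVr tmul1l tmulVr.
Qed.

Lemma tinvK (x : P) : ((x^-1)^-1 = x)%tg.
Proof. by apply/esym/tinv_uniq; rewrite tmulVl. Qed.

Definition tcoset (x : P) : P -> Prop := fun y => N (x^-1 * y)%tg.

Record quo_sort := Quo {
  quo_set : P -> Prop;
  quo_ex : exists x, quo_set = tcoset x }.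

Definition quo_cls (x : P) : quo_sort := Quo (ex_intro _ x erefl).

Definition quo_repr (C : quo_sort) : P :=
  proj1_sig (constructive_indefinite_description _ (quo_ex C)).

Lemma quo_reprK (C : quo_sort) : quo_cls (quo_repr C) = C.
Proof.
rewrite /quo_repr; case: constructive_indefinite_description => x /=.
case: C => C hC /= e; subst C.
by rewrite /quo_cls; congr Quo; apply: proof_irrelevance.
Qed.

Lemma quo_clsP (x y : P) : quo_cls x = quo_cls y <-> N (x^-1 * y)%tg.
Proof.
case: (nset_subgroup N) => N1 NM NV; split=> [|Nxy].
  move/(congr1 (fun C => quo_set C y)) => /= e.
  by rewrite /tcoset in e; rewrite e tmulVl.
have e : tcoset x = tcoset y.
  apply: functional_extensionality => z.
  apply: propositional_extensionality; rewrite /tcoset; split=> h.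
    have -> : (y^-1 * z = (x^-1 * y)^-1 * (x^-1 * z))%tg.
      by rewrite tinvM tinvK -tmulA (tmulA x) tmulVr tmul1l.
    by apply: NM => //; apply: NV.
  have -> : (x^-1 * z = (x^-1 * y) * (y^-1 * z))%tg.
    by rewrite -tmulA (tmulA y) tmulVr tmul1l.
  exact: NM.
by rewrite /quo_cls; move: (ex_intro _ x _); rewrite e => h; congr Quo;
  apply: proof_irrelevance.
Qed.

Definition quo_mul (C D : quo_sort) := quo_cls (quo_repr C * quo_repr D)%tg.
Definition quo_inv (C : quo_sort) := quo_cls (quo_repr C)^-1%tg.
Definition quo_open (A : quo_sort -> Prop) := topen (fun x => A (quo_cls x)).

Lemma quo_reprP (x : P) : N (x^-1 * quo_repr (quo_cls x))%tg.
Proof. by apply/quo_clsP; rewrite quo_reprK. Qed.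

Lemma quo_mul_pi (x y : P) :
  quo_mul (quo_cls x) (quo_cls y) = quo_cls (x * y)%tg.
Proof.
case: (nset_subgroup N) => N1 NM NV.
apply/esym/quo_clsP; set x' := quo_repr _; set y' := quo_repr _.
have hx : N (x^-1 * x')%tg := quo_reprP x.
have hy : N (y^-1 * y')%tg := quo_reprP y.
have -> : ((x * y)^-1 * (x' * y') =
  (y^-1 * (x^-1 * x') * (y^-1)^-1) * (y^-1 * y'))%tg.
  by rewrite tinvM tinvK -!tmulA (tmulA y) tmulVr tmul1l.
by apply: NM => //; apply: nset_normal.
Qed.

Lemma quo_mulA C D F : quo_mul C (quo_mul D F) = quo_mul (quo_mul C D) F.
Proof.
rewrite -(quo_reprK C) -(quo_reprK D) -(quo_reprK F).
by rewrite !quo_mul_pi tmulA.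
Qed.

Lemma quo_mul1l C : quo_mul (quo_cls 1%tg) C = C.
Proof. by rewrite -(quo_reprK C) quo_mul_pi tmul1l. Qed.

Lemma quo_mulVl C : quo_mul (quo_inv C) C = quo_cls 1%tg.
Proof. by rewrite -{2}(quo_reprK C) /quo_inv quo_mul_pi tmulVl. Qed.

Lemma quo_openU (F : (quo_sort -> Prop) -> Prop) :
  (forall A, F A -> quo_open A) -> quo_open (fun x => exists2 A, F A & A x).
Proof.
move=> hF; rewrite /quo_open.
have := @topenU P (fun B => exists2 A, F A & B = fun x => A (quo_cls x)).
have -> : (fun x => exists2 B, (exists2 A, F A & B = fun x => A (quo_cls x))
    & B x) = (fun x => exists2 A, F A & A (quo_cls x)).
  apply: functional_extensionality => x; apply: propositional_extensionality.
  split=> [[_ [A FA ->] Ax]|[A FA Ax]]; first by exists A.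
  by exists (fun x => A (quo_cls x)) => //; exists A.
by apply=> _ [A FA ->]; apply: hF.
Qed.

Definition quo : tgroup := {|
  tmulA := quo_mulA; tmul1l := quo_mul1l; tmulVl := quo_mulVl;
  topen := quo_open; topenT := @topenT P;
  topenI := fun A B => @topenI P _ _; topenU := quo_openU |}.

Definition quo_pi (x : P) : quo := quo_cls x.

End Quotient.

Lemma rmorphism_ext (A B : pzSemiRingType) (f g : {rmorphism A -> B}) :
  f =1 g -> f = g.
Proof.
case: f g => [f cf] [g cg] /= /functional_extensionality e; subst g.
congr GRing.RMorphism.Pack.
case: cf cg => [[a] [b]] [[a'] [b']].
by rewrite (proof_irrelevance _ a a') (proof_irrelevance _ b b').
Qed.

Section Algebras.
Variables (R B : comPzRingType) (s : {rmorphism R -> B}).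

Definition module_finite : Prop :=
  exists n (x : 'I_n -> B), forall b, exists c : 'I_n -> R,
    b = \sum_i s (c i) * x i.

Definition finite_type : Prop :=
  exists gen : seq B, forall P : B -> Prop,
    (forall r, P (s r)) -> (forall x, x \in gen -> P x) ->
    (forall x y, P x -> P y -> P (x - y)) ->
    (forall x y, P x -> P y -> P (x * y)) -> forall b, P b.

Definition linear_form (l : B -> R) : Prop :=
  forall r b c, l (s r * b + c) = r * l b + l c.

(* B is finitely generated projective over R, with dual basis (x, l), and the
   trace form (b, c) |-> Tr(b c) = \sum_i l_i (b c x_i) is perfect. *)
Definition finite_etale : Prop :=
  exists n (x : 'I_n -> B) (l : 'I_n -> B -> R),
    [/\ forall i, linear_form (l i),
        forall b, b = \sum_i s (l i b) * x i
      & forall f, linear_form f ->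
          exists! b, forall c, f c = \sum_i l i (b * c * x i)].

(* Spec B -> Spec R is an open immersion, with image covered by the basic
   open subsets D(g_i). *)
Definition open_immersion : Prop :=
  exists n (g : 'I_n -> R),
    (exists c : 'I_n -> B, \sum_i c i * s (g i) = 1) /\
    forall i,
      (forall r, s r = 0 -> exists m, g i ^+ m * r = 0) /\
      (forall b, exists m r, s (g i) ^+ m * b = s r).

End Algebras.

Definition is_pushout (R R' B B' : comPzRingType) (u : {rmorphism R -> R'})
    (s : {rmorphism R -> B}) (s' : {rmorphism R' -> B'})
    (v : {rmorphism B -> B'}) : Prop :=
  (forall r, v (s r) = s' (u r)) /\
  forall (C : comPzRingType) (f : {rmorphism R' -> C}) (g : {rmorphism B -> C}),
    (forall r, f (u r) = g (s r)) ->
    exists! h : {rmorphism B' -> C}, h \o s' =1 f /\ h \o v =1 g.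

Definition is_algebraic_closure (k : fieldType) (kb : closedFieldType)
    (iota : {rmorphism k -> kb}) : Prop :=
  forall x, exists2 p : {poly k}, p != 0 & root (map_poly iota p) x.

(* A separated scheme of finite type over k, given by the coordinate rings
   O(U_S) of the intersections U_S of a finite affine open cover (U_i), for
   nonempty S; the value at the empty set is irrelevant. *)
Record variety (k : fieldType) := Variety {
  nchart : nat;
  chart : {set 'I_nchart} -> comPzRingType;
  scal : forall S, {rmorphism k -> chart S};
  res : forall S T : {set 'I_nchart},
    S \subset T -> {rmorphism chart S -> chart T};
  res_id : forall (S : {set 'I_nchart}) (h : S \subset S) a, res h a = a;
  res_comp : forall (S T W : {set 'I_nchart}) (h : S \subset T)
    (h' : T \subset W) (h'' : S \subset W) a, res h'' a = res h' (res h a);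
  res_scal : forall (S T : {set 'I_nchart}) (h : S \subset T) c,
    res h (scal S c) = scal T c;
  chart_ft : forall S, S != set0 -> finite_type (scal S);
  chart_open : forall (S T : {set 'I_nchart}) (h : S \subset T), S != set0 ->
    open_immersion (res h);
  chart_cap : forall S T, S :&: T != set0 ->
    is_pushout (res (subsetIl S T)) (res (subsetIr S T))
               (res (subsetUl S T)) (res (subsetUr S T));
  chart_sep : forall S T, S != set0 -> T != set0 ->
    forall c : chart (S :|: T), exists n (a : 'I_n -> chart S)
      (b : 'I_n -> chart T),
      c = \sum_i res (subsetUl S T) (a i) * res (subsetUr S T) (b i) }.

Arguments chart {k} v S.
Arguments scal {k} v S.
Arguments res {k v S T} h.

(* The category of affine K-schemes over a K-scheme Y: the pairs of a
   K-algebra e : K -> R and a point x in Y(R).  The relation [sto u x x'] says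
   that u : R -> R' carries x to x'. *)
Record site (K : fieldType) := Site {
  spt : forall R : comPzRingType, {rmorphism K -> R} -> Type;
  sto : forall (R R' : comPzRingType) (e : {rmorphism K -> R})
    (e' : {rmorphism K -> R'}), {rmorphism R -> R'} ->
    spt e -> spt e' -> Prop }.

Arguments spt {K} s {R} e.
Arguments sto {K s R R' e e'} u x x'.

Definition Spec (K : fieldType) : site K :=
  @Site K (fun _ _ => unit) (fun _ _ _ _ _ _ _ => True).

(* The K-scheme X_K = X x_k K.  Only points lying in a chart are considered,
   and u carries x in U_S(R) to x' in U_T(R') if S is contained in T and x' is
   the image of x in U_S(R'); a quasi-coherent object on this category amounts
   to one on each U_S, with compatible gluing isomorphisms. *)
Section BaseChange.
Variables (k : fieldType) (X : variety k).
Variables (K : fieldType) (j : {rmorphism k -> K}).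

Record bc_pt (R : comPzRingType) (e : {rmorphism K -> R}) := BcPt {
  bset : {set 'I_(nchart X)};
  bset_neq0 : bset != set0;
  bval : {rmorphism chart X bset -> R};
  bvalk : forall c, bval (scal X bset c) = e (j c) }.

Definition bc_to (R R' : comPzRingType) (e : {rmorphism K -> R})
    (e' : {rmorphism K -> R'}) (u : {rmorphism R -> R'})
    (x : bc_pt e) (x' : bc_pt e') : Prop :=
  exists h : bset x \subset bset x',
    forall a, u (bval x a) = bval x' (res h a).

Definition base_change : site K := Site bc_to.

End BaseChange.

Section Covers.
Variables (K : fieldType) (Y : site K).

Definition arrow (R R' : comPzRingType) (e : {rmorphism K -> R})
    (e' : {rmorphism K -> R'}) (u : {rmorphism R -> R'})
    (x : spt Y e) (x' : spt Y e') : Prop :=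
  (forall c, u (e c) = e' c) /\ sto u x x'.

(* Open subsets of the underlying space of Y, as sets of field-valued points:
   on an affine scheme Spec R over Y, the trace of V is the union of the D(f)
   for f in some subset of R. *)
Definition open_subset
    (V : forall (F : fieldType) (e : {rmorphism K -> F}), spt Y e -> Prop) :
    Prop :=
  forall (R : comPzRingType) (e : {rmorphism K -> R}) (x : spt Y e),
  exists D : R -> Prop,
    forall (F : fieldType) (e' : {rmorphism K -> F}) (x' : spt Y e')
      (u : {rmorphism R -> F}), arrow u x x' ->
      V F e' x' <-> exists2 f, D f & u f <> 0.

Definition connected : Prop :=
  (exists (F : fieldType) (e : {rmorphism K -> F}), inhabited (spt Y e)) /\
  forall V V', open_subset V -> open_subset V' ->
    (forall F e x, V F e x \/ V' F e x) ->
    (forall F e x, ~ (V F e x /\ V' F e x)) ->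
    (forall F e x, V F e x) \/ (forall F e x, V' F e x).

Record etale_cover := EtaleCover {
  calg : forall (R : comPzRingType) (e : {rmorphism K -> R}),
    spt Y e -> comPzRingType;
  cstr : forall (R : comPzRingType) (e : {rmorphism K -> R}) (x : spt Y e),
    {rmorphism R -> calg x};
  cet : forall (R : comPzRingType) (e : {rmorphism K -> R}) (x : spt Y e),
    finite_etale (cstr x);
  cmap : forall (R R' : comPzRingType) (e : {rmorphism K -> R})
    (e' : {rmorphism K -> R'}) (u : {rmorphism R -> R'}) (x : spt Y e)
    (x' : spt Y e'), arrow u x x' -> {rmorphism calg x -> calg x'};
  cmap_id : forall (R : comPzRingType) (e : {rmorphism K -> R})
    (u : {rmorphism R -> R}) (x : spt Y e) (a : arrow u x x),
    u =1 id -> cmap a =1 id;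
  cmap_comp : forall (R R' R'' : comPzRingType) (e : {rmorphism K -> R})
    (e' : {rmorphism K -> R'}) (e'' : {rmorphism K -> R''})
    (u : {rmorphism R -> R'}) (u' : {rmorphism R' -> R''})
    (u'' : {rmorphism R -> R''}) (x : spt Y e) (x' : spt Y e')
    (x'' : spt Y e'') (a : arrow u x x') (a' : arrow u' x' x'')
    (a'' : arrow u'' x x''),
    u'' =1 u' \o u -> cmap a'' =1 cmap a' \o cmap a;
  cmap_push : forall (R R' : comPzRingType) (e : {rmorphism K -> R})
    (e' : {rmorphism K -> R'}) (u : {rmorphism R -> R'}) (x : spt Y e)
    (x' : spt Y e') (a : arrow u x x'),
    is_pushout u (cstr x) (cstr x') (cmap a) }.

(* A morphism of the algebras, i.e. a morphism of covers in the opposite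
   direction. *)
Record cover_map (E F : etale_cover) := CoverMap {
  cm : forall (R : comPzRingType) (e : {rmorphism K -> R}) (x : spt Y e),
    {rmorphism calg E x -> calg F x};
  cm_str : forall (R : comPzRingType) (e : {rmorphism K -> R}) (x : spt Y e) r,
    cm x (cstr E x r) = cstr F x r;
  cm_map : forall (R R' : comPzRingType) (e : {rmorphism K -> R})
    (e' : {rmorphism K -> R'}) (u : {rmorphism R -> R'}) (x : spt Y e)
    (x' : spt Y e') (a : arrow u x x') b,
    cm x' (cmap E a b) = cmap F a (cm x b) }.

Section Pi1.
Variables (W : comPzRingType) (w : {rmorphism K -> W}) (y : spt Y w).

Record fiber (E : etale_cover) := Fiber {
  fib :> {rmorphism calg E y -> W};
  fibP : forall r, fib (cstr E y r) = r }.

Lemma fiber_ext E (h h' : fiber E) : h =1 h' -> h = h'.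
Proof.
case: h h' => [h p] [h' p'] /= /rmorphism_ext e; subst h'.
by congr Fiber; apply: proof_irrelevance.
Qed.

Lemma fiber_map_subproof E F (f : cover_map E F) (h : fiber F) r :
  (h \o cm f y) (cstr E y r) = r.
Proof. by rewrite /= cm_str fibP. Qed.

Definition fiber_map E F (f : cover_map E F) (h : fiber F) : fiber E :=
  @Fiber E (h \o cm f y) (fiber_map_subproof f h).

Record aut := Aut {
  aut_act : forall E, fiber E -> fiber E;
  aut_actV : forall E, fiber E -> fiber E;
  aut_actK : forall E, cancel (@aut_act E) (@aut_actV E);
  aut_actVK : forall E, cancel (@aut_actV E) (@aut_act E);
  aut_act_nat : forall E F (f : cover_map E F) (h : fiber F),
    aut_act (fiber_map f h) = fiber_map f (aut_act h) }.

Lemma aut_ext (g g' : aut) :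
  (forall E, aut_act g (E := E) =1 aut_act g' (E := E)) -> g = g'.
Proof.
case: g g' => [a b c d n] [a' b' c' d' n'] /= e.
have ea : a = a'.
  apply: functional_extensionality_dep => E.
  by apply: functional_extensionality => h; apply: e.
subst a'.
have eb : b = b'.
  apply: functional_extensionality_dep => E.
  by apply: functional_extensionality => h; rewrite -{1}(d' E h) c.
subst b'.
by congr Aut; apply: proof_irrelevance.
Qed.

Lemma aut_mul_nat (g g' : aut) E F (f : cover_map E F) (h : fiber F) :
  aut_act g (aut_act g' (fiber_map f h)) =
  fiber_map f (aut_act g (aut_act g' h)).
Proof. by rewrite !aut_act_nat. Qed.

Definition aut_mul (g g' : aut) : aut :=
  @Aut (fun E => aut_act g (E := E) \o aut_act g' (E := E))
    (fun E => aut_actV g' (E := E) \o aut_actV g (E := E))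
    (fun E => can_comp (aut_actK g (E := E)) (aut_actK g' (E := E)))
    (fun E => can_comp (aut_actVK g' (E := E)) (aut_actVK g (E := E)))
    (@aut_mul_nat g g').

Definition aut_one : aut :=
  @Aut (fun E h => h) (fun E h => h) (fun E => frefl _) (fun E => frefl _)
    (fun E F f h => erefl).

Lemma aut_inv_nat (g : aut) E F (f : cover_map E F) (h : fiber F) :
  aut_actV g (fiber_map f h) = fiber_map f (aut_actV g h).
Proof. by rewrite -{1}(aut_actVK g h) -aut_act_nat aut_actK. Qed.

Definition aut_inv (g : aut) : aut :=
  Aut (aut_actVK g) (aut_actK g) (@aut_inv_nat g).

Lemma aut_mulA a b c : aut_mul a (aut_mul b c) = aut_mul (aut_mul a b) c.
Proof. exact: aut_ext. Qed.
Lemma aut_mul1l a : aut_mul aut_one a = a.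
Proof. exact: aut_ext. Qed.
Lemma aut_mulVl a : aut_mul (aut_inv a) a = aut_one.
Proof. by apply: aut_ext => E h /=; rewrite aut_actK. Qed.

Definition aut_open (A : aut -> Prop) : Prop := forall g, A g ->
  exists n (E : 'I_n -> etale_cover), forall g',
    (forall i, aut_act g' (E := E i) =1 aut_act g (E := E i)) -> A g'.

Lemma aut_openT : aut_open (fun=> True).
Proof. by move=> g _; exists 0, (fun i : 'I_0 => match i with Ordinal _ h =>
  match notF h with end end). Qed.

Lemma aut_openI A B : aut_open A -> aut_open B ->
  aut_open (fun x => A x /\ B x).
Proof.
move=> hA hB g [/hA [n [E hE]] /hB [m [F hF]]].
exists (n + m), (fun i => match split i with inl a => E a | inr b => F b end).
move=> g' e; split; [apply: hE|apply: hF] => i h.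
  by have := e (lshift m i); case: split (unsplitK (inl i : _ + 'I_m)%type) =>
    //= i' [->].
by have := e (rshift n i); case: split (unsplitK (inr i : 'I_n + _)%type) =>
  //= i' [->].
Qed.

Lemma aut_openU (F : (aut -> Prop) -> Prop) : (forall A, F A -> aut_open A) ->
  aut_open (fun x => exists2 A, F A & A x).
Proof.
move=> hF g [A FA /(hF A FA) [n [E hE]]].
by exists n, E => g' /hE; exists A.
Qed.

(* The etale fundamental group of Y at y : Spec W -> Y. *)
Definition pi1 : tgroup := {|
  tmulA := aut_mulA; tmul1l := aut_mul1l; tmulVl := aut_mulVl;
  topenT := aut_openT; topenI := aut_openI; topenU := aut_openU |}.

End Pi1.
End Covers.

Arguments pi1 {K Y W w} y.

Section Galois.
Variables (K W : fieldType) (w : {rmorphism K -> W}).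

Record galois_aut := GaloisAut {
  gfun :> {rmorphism W -> W};
  gfunV : {rmorphism W -> W};
  gfunK : cancel gfun gfunV;
  gfunVK : cancel gfunV gfun;
  gfun_id : forall c, gfun (w c) = w c }.

Lemma galois_ext (g g' : galois_aut) : g =1 g' -> g = g'.
Proof.
case: g g' => [a b c d n] [a' b' c' d' n'] /= e.
have ea := rmorphism_ext e; subst a'.
have eb : b = b' by apply: rmorphism_ext => x; rewrite -{1}(d' x) c.
by subst b'; congr GaloisAut; apply: proof_irrelevance.
Qed.

Lemma galois_mul_id (g g' : galois_aut) c : (g \o g') (w c) = w c.
Proof. by rewrite /= !gfun_id. Qed.

Definition galois_mul (g g' : galois_aut) : galois_aut :=
  @GaloisAut (g \o g') (gfunV g' \o gfunV g)
    (can_comp (gfunK g) (gfunK g')) (can_comp (gfunVK g') (gfunVK g))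
    (galois_mul_id g g').

Definition galois_one : galois_aut :=
  @GaloisAut idfun idfun (frefl _) (frefl _) (frefl _).

Lemma galois_inv_id (g : galois_aut) c : gfunV g (w c) = w c.
Proof. by rewrite -{1}(gfun_id g c) gfunK. Qed.

Definition galois_inv (g : galois_aut) : galois_aut :=
  GaloisAut (gfunVK g) (gfunK g) (galois_inv_id g).

Lemma galois_mulA a b c :
  galois_mul a (galois_mul b c) = galois_mul (galois_mul a b) c.
Proof. exact: galois_ext. Qed.
Lemma galois_mul1l a : galois_mul galois_one a = a.
Proof. exact: galois_ext. Qed.
Lemma galois_mulVl a : galois_mul (galois_inv a) a = galois_one.
Proof. by apply: galois_ext => x /=; rewrite gfunK. Qed.

Definition krull_open (A : galois_aut -> Prop) : Prop := forall g, A g ->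
  exists s : seq W, forall g' : galois_aut, {in s, g' =1 g} -> A g'.

Lemma krull_openT : krull_open (fun=> True).
Proof. by move=> g _; exists [::]. Qed.

Lemma krull_openI A B : krull_open A -> krull_open B ->
  krull_open (fun x => A x /\ B x).
Proof.
move=> hA hB g [/hA [s hs] /hB [t ht]].
exists (s ++ t) => g' e.
by split; [apply: hs|apply: ht] => x xs; apply: e; rewrite mem_cat xs ?orbT.
Qed.

Lemma krull_openU (F : (galois_aut -> Prop) -> Prop) :
  (forall A, F A -> krull_open A) -> krull_open (fun x => exists2 A, F A & A x).
Proof.
move=> hF g [A FA /(hF A FA) [s hs]].
by exists s => g' /hs; exists A.
Qed.

(* Gal(W/K), with the Krull topology. *)
Definition gal_group : tgroup := {|
  tmulA := galois_mulA; tmul1l := galois_mul1l; tmulVl := galois_mulVl;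
  topenT := krull_openT; topenI := krull_openI; topenU := krull_openU |}.

End Galois.

(* A morphism Y' -> Y over Spec K' -> Spec K. *)
Section Functoriality.
Variables (K K' : fieldType) (j : {rmorphism K -> K'}).

Record site_map (Y' : site K') (Y : site K) := SiteMap {
  sm : forall (R : comPzRingType) (e : {rmorphism K' -> R}),
    spt Y' e -> spt Y (e \o j);
  sm_to : forall (R R' : comPzRingType) (e : {rmorphism K' -> R})
    (e' : {rmorphism K' -> R'}) (u : {rmorphism R -> R'})
    (x : spt Y' e) (x' : spt Y' e'), sto u x x' -> sto u (sm x) (sm x') }.

Variables (Y' : site K') (Y : site K) (f : site_map Y' Y).

Lemma sm_arrow (R R' : comPzRingType) (e : {rmorphism K' -> R})
    (e' : {rmorphism K' -> R'}) (u : {rmorphism R -> R'})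
    (x : spt Y' e) (x' : spt Y' e') :
  arrow u x x' -> arrow u (sm f x) (sm f x').
Proof. by case=> ue /sm_to h; split=> // c; apply: ue. Qed.

Definition pullback (E : etale_cover Y) : etale_cover Y' :=
  @EtaleCover K' Y' (fun R e x => calg E (sm f x))
    (fun R e x => cstr E (sm f x))
    (fun R e x => cet E (sm f x))
    (fun R R' e e' u x x' a => cmap E (sm_arrow a))
    (fun R e u x a => cmap_id (sm_arrow a))
    (fun R R' R'' e e' e'' u u' u'' x x' x'' a a' a'' =>
       cmap_comp (sm_arrow a) (sm_arrow a') (sm_arrow a''))
    (fun R R' e e' u x x' a => cmap_push E (sm_arrow a)).

(* The homomorphism pi1(Y', y') -> pi1(Y, y) for y' above y: here W and W' are
   algebraically closed, b : W -> W' maps y to the image of y', and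
   h |-> b h identifies the fiber of a cover of Y at y with the fiber of its
   pullback at y'.  The image of g is the automorphism of the fiber functor at
   y corresponding to g under this bijection. *)
Definition pi1_map (W W' : comPzRingType) (w : {rmorphism K -> W})
    (w' : {rmorphism K' -> W'}) (y : spt Y w) (y' : spt Y' w')
    (b : {rmorphism W -> W'}) (hb : arrow b y (sm f y'))
    (g' : pi1 y') : pi1 y :=
  epsilon (inhabits 1%tg) (fun g : pi1 y =>
    forall (E : etale_cover Y) (h : fiber y E) (h' : fiber y' (pullback E)),
      (forall a, h' (cmap E hb a) = b (h a)) ->
      forall a, aut_act g' h' (cmap E hb a) = b (aut_act g h a)).

End Functoriality.

Arguments sm {K K' j Y' Y} s {R e} x.

Section Augmentation.
Variables (K : fieldType) (Y : site K).

Definition to_Spec : site_map idfun Y (Spec K) :=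
  @SiteMap K K idfun Y (Spec K) (fun _ _ _ => tt)
    (fun _ _ _ _ _ _ _ _ => I).

Variables (W : fieldType) (w : {rmorphism K -> W}) (y : spt Y w).

Lemma galois_arrow (g : gal_group w) :
  arrow (gfun g) (sm to_Spec y) (sm to_Spec y).
Proof. by split=> // c; apply: gfun_id. Qed.

(* The homomorphism pi1(Y, y) -> pi1(Spec K, w) = Gal(W/K), for W an algebraic
   closure of K.  An element s of Gal(W/K) acts on the fiber Hom_W(E(W), W) of
   a cover E of Spec K by h |-> s h E(s)^-1, and this identifies Gal(W/K) with
   the automorphism group of the fiber functor. *)
Definition pi1_galois (g : pi1 y) : gal_group w :=
  epsilon (inhabits 1%tg) (fun s : gal_group w =>
    forall (E : etale_cover (Spec K)) (h : fiber y (pullback to_Spec E)) a,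
      aut_act g h (cmap E (galois_arrow s) a) = s (h a)).

End Augmentation.

(* Restriction Gal(W'/K') -> Gal(W/K) along b : W -> W' above K -> K', for W an
   algebraic closure of K: the unique s with b s = s' b. *)
Definition galois_res (K K' W W' : fieldType) (w : {rmorphism K -> W})
    (w' : {rmorphism K' -> W'}) (b : {rmorphism W -> W'}) (s' : gal_group w') :
    gal_group w :=
  epsilon (inhabits 1%tg) (fun s : gal_group w => forall a, b (s a) = s' (b a)).

(* The etale fundamental group of X_K at a point x, and its map to Gal(W/K). *)
Definition etale_pi1 (k : fieldType) (X : variety k) (K : fieldType)
    (j : {rmorphism k -> K}) (W : comPzRingType) (w : {rmorphism K -> W})
    (x : bc_pt X j w) : tgroup :=
  @pi1 K (base_change X j) W w x.

Definition pi1_proj (k : fieldType) (X : variety k) (K : fieldType)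
    (j : {rmorphism k -> K}) (W : fieldType) (w : {rmorphism K -> W})
    (x : bc_pt X j w) (g : etale_pi1 x) : gal_group w :=
  @pi1_galois K (base_change X j) W w x g.

Arguments pi1_proj {k X K j W w} x g.

Section BaseChangeMap.
Variables (k : fieldType) (X : variety k) (K : fieldType).
Variables (j : {rmorphism k -> K}).

Definition bc_proj : site_map j (base_change X j) (base_change X idfun) :=
  @SiteMap k K j (base_change X j) (base_change X idfun)
    (fun R e (x : bc_pt X j e) =>
       @BcPt k X k idfun R (e \o j) _ (bset_neq0 x) (bval x) (bvalk x))
    (fun R R' e e' u x x' h => h).

Variables (W W' : fieldType) (w : {rmorphism k -> W}).
Variables (w' : {rmorphism K -> W'}) (b : {rmorphism W -> W'}).
Hypothesis hb : b \o w =1 w' \o j.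
Variable x : bc_pt X idfun w.

Lemma geom_pt_subproof c : (b \o bval x) (scal X (bset x) c) = w' (j c).
Proof. by rewrite /= bvalk; apply: hb. Qed.

(* The geometric point of X_K induced by the geometric point x of X. *)
Definition geom_pt : bc_pt X j w' :=
  @BcPt k X K j W' w' _ (bset_neq0 x) (b \o bval x) geom_pt_subproof.

Lemma geom_arrow :
  @arrow _ (base_change X idfun) _ _ w _ b x (sm bc_proj geom_pt).
Proof.
split; first exact: hb.
by exists (subxx _) => a; rewrite /= res_id.
Qed.

(* The homomorphism pi1(X_K) -> pi1(X). *)
Definition pi1_bc : etale_pi1 geom_pt -> etale_pi1 x := pi1_map geom_arrow.

End BaseChangeMap.

Section GroupSchemes.
Variable k : fieldType.

Section Points.
Variables (A : comPzRingType) (s : {rmorphism k -> A}).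

Record points (R : comPzRingType) (e : {rmorphism k -> R}) := Pts {
  pt :> {rmorphism A -> R};
  ptP : forall c, pt (s c) = e c }.

Variables (R R' : comPzRingType) (e : {rmorphism k -> R}).
Variables (e' : {rmorphism k -> R'}) (u : {rmorphism R -> R'}).
Hypothesis hu : u \o e =1 e'.

Lemma pts_map_subproof (x : points e) c : (u \o x) (s c) = e' c.
Proof. by rewrite /= ptP; apply: hu. Qed.

Definition pts_map (x : points e) : points e' :=
  @Pts R' e' (u \o x) (pts_map_subproof x).

End Points.

(* A finite k-group scheme Spec A, as a group structure on its functor of
   points; compatibility with the units and inverses follows from [gnat]. *)
Record group_scheme := GroupScheme {
  gring : comPzRingType;
  gstr : {rmorphism k -> gring};
  gfin : module_finite gstr;
  gmul : forall (R : comPzRingType) (e : {rmorphism k -> R}),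
    points gstr e -> points gstr e -> points gstr e;
  gone : forall (R : comPzRingType) (e : {rmorphism k -> R}), points gstr e;
  ginv : forall (R : comPzRingType) (e : {rmorphism k -> R}),
    points gstr e -> points gstr e;
  gmulA : forall R e, associative (@gmul R e);
  gmul1 : forall R e, left_id (@gone R e) (@gmul R e);
  gmulV : forall R e, left_inverse (@gone R e) (@ginv R e) (@gmul R e);
  gnat : forall (R R' : comPzRingType) (e : {rmorphism k -> R})
    (e' : {rmorphism k -> R'}) (u : {rmorphism R -> R'}) (hu : u \o e =1 e')
    (x y : points gstr e),
    pts_map hu (gmul x y) = gmul (pts_map hu x) (pts_map hu y) }.

(* The constant group scheme attached to a finite group H is the spectrum of
   the algebra of functions H -> k, with the group law for which the evaluation
   maps H -> G(k) form a homomorphism. *)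
Definition is_constant (G : group_scheme) : Prop :=
  exists (H : finGroupType)
    (ev : H -> points (gstr G) (idfun : {rmorphism k -> k})),
    (forall x y, ev (x * y)%g = gmul (ev x) (ev y)) /\
    bijective (fun a : gring G => [ffun x => ev x a]).

End GroupSchemes.

Section Cohomology.
Variables (k : fieldType) (kb : fieldType) (iota : {rmorphism k -> kb}).
Variable G : group_scheme k.

Local Notation M := (points (gstr G) iota).

Definition galois_act (s : gal_group iota) : M -> M := pts_map (gfun_id s).

(* P acts on G(kb) through q : P -> Gal(kb/k), and G(kb) is discrete. *)
Variables (P : tgroup) (q : P -> gal_group iota).

Definition cocycle (c : P -> M) : Prop :=
  (forall m, topen (fun g => c g = m)) /\
  forall g h, c (g * h)%tg = gmul (c g) (galois_act (q g) (c h)).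

Definition cohomologous (c c' : P -> M) : Prop :=
  exists m, forall g,
    c' g = gmul (gmul (ginv m) (c g)) (galois_act (q g) m).

End Cohomology.

Section Setting.
Variables (k : fieldType) (kb : fieldType) (iota : {rmorphism k -> kb}).
Variables (X : variety k) (x : bc_pt X idfun iota).

Definition geom_pt_bar : bc_pt X iota (idfun : {rmorphism kb -> kb}) :=
  @geom_pt k X kb iota kb kb iota idfun idfun (frefl _) x.

Definition pi1_bar : etale_pi1 geom_pt_bar -> etale_pi1 x :=
  @pi1_bc k X kb iota kb kb iota idfun idfun (frefl _) x.

Variable N : normal_subgroup (etale_pi1 x).

(* pi1^U(X) = pi1(X) / U is [quo N], for N the image of U in pi1(X); this is
   its map to Gal(kb/k), well defined as U is contained in pi1 of X_kb. *)
Definition quo_proj (C : quo N) : gal_group iota := pi1_proj x (quo_repr C).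

Definition is_section (t : gal_group iota -> quo N) : Prop :=
  [/\ is_hom t, tcontinuous t & forall g, quo_proj (t g) = g].

Variable G : group_scheme k.
Implicit Type c : etale_pi1 x -> points (gstr G) iota.

(* The class of c in H^1(X_kb, G) has trivial restriction to U. *)
Definition trivial_on (U : etale_pi1 geom_pt_bar -> Prop) c : Prop :=
  forall u, U u -> c (pi1_bar u) = gone G iota.

Definition geom_surjective c : Prop :=
  forall m, exists u, c (pi1_bar u) = m.

Variables (I : Type) (Gam : I -> tgroup).
Variables (theta : forall i, Gam i -> gal_group iota).
Variable s : forall i, Gam i -> quo N.

(* The family alpha(s_i), for alpha the class of c, comes from H^1(k, G).  Here
   c' is a cocycle on pi1^U(X) inducing alpha, whose class is unique. *)
Definition descends c : Prop :=
  forall c' : quo N -> points (gstr G) iota,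
    cocycle quo_proj c' -> cohomologous (pi1_proj x)
      (fun g => c' (quo_pi N g)) c ->
    exists2 d : gal_group iota -> points (gstr G) iota,
      cocycle id d &
      forall i, cohomologous (@theta i) (fun g => d (theta g))
                                        (fun g => c' (s g)).

End Setting.

(* Main.v *)
From HB Require Import structures.
From mathcomp Require Import all_boot all_fingroup all_order all_algebra.
From mathcomp Require Import qpoly separable ring boolp.
From Stdlib Require Import ClassicalEpsilon FunctionalExtensionality.
From Stdlib Require Import PropExtensionality ProofIrrelevance.
Require Import Defs.
Set Implicit Arguments. Unset Strict Implicit. Unset Printing Implicit Defensive.

                                                                              
                                                                            
                                                                           
                                                                            
                                                                              
                                                                       
                                                                               
                                                                             
                                                                              
                                                                           
                                                                        
                                                                         
                                                                              
              

                     

                                                                             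
                       
(** Write P for the group pi1^U(X), that is [quo N], p for its map to the Galois group Gam of k, and
    V for an open normal subgroup of P. The implications (a) => (a') and (c) => (a) are formal:
    composing a cocycle on P with a section t as in (c) gives a cocycle on Gam, and conjugation by
    an element of the kernel of p changes it by a coboundary only ([descends_of_section]).

    For (a') => (b), the projection P -> P/V is a cocycle with values in a finite constant group
    scheme; a class over k that descends it is a homomorphism Gam -> P/V which agrees with every s_i
    modulo V, up to conjugacy. For (d) => (b), a section t0 makes P a semidirect product of A = ker
    p and Gam; the group A/(A cap V), with Gam acting by conjugation through t0, is the group of
    points of a finite group scheme, and g |-> g t0(p g)^-1 is a cocycle with values in it that is
    surjective on A. Twisting t0 by a descended cocycle again solves the problem modulo V. Both
    cases are [interpolates_of_descends]. The solutions modulo all V are then assembled by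
    compactness in [interpolation]. Density enters here: it shows that the kernel of a solution
    modulo V depends on V only ([interpolates_ker]), so that limits of solutions stay continuous.

    For (b) => (c) ([section_of_interpolation]), the endomorphism p o t of Gam sends each theta_i(h)
    to a conjugate of itself. By density it preserves and reflects membership in every open normal
    subgroup, so it is an automorphism, and t composed with its inverse is a section.

    Two facts feed this argument. The kernel of pi1(X) -> Gam is the image of pi1 of X over kb
    ([pi1_exact]): an idempotent on the pullback of a cover E to X_kb is defined over some k(z),
    hence lives on the product of E with a cover defined by a polynomial; so an automorphism g
    acting trivially on kb respects the connected components of that pullback, and such a g lifts
    ([lift_aut]). And every finite group with a continuous action of Gam is the group of points of a
    finite k-group scheme ([group_scheme_ex]): it embeds equivariantly in kb ([embedding_ex]) as the
    root set of a polynomial over k, and Lagrange interpolation provides the group law. *)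

(** * Zorn's lemma, ultrafilters and limits along them *)

Section Zorn.
Variable T : Type.
Implicit Types (A B : T -> Prop) (C : (T -> Prop) -> Prop).

Definition subs A B := forall x, A x -> B x.
Definition chain_union C : T -> Prop := fun x => exists2 A, C A & A x.
Definition add1 A y : T -> Prop := fun x => A x \/ x = y.

Lemma subs_anti A B : subs A B -> subs B A -> A = B.
Proof.
move=> AB BA; apply: functional_extensionality => x.
by apply: propositional_extensionality; split; [apply: AB|apply: BA].
Qed.

Variable good : (T -> Prop) -> Prop.
Hypothesis goodU : forall C, (exists A, C A) -> (forall A, C A -> good A) ->
  (forall A B, C A -> C B -> subs A B \/ subs B A) -> good (chain_union C).

(** One element is added whenever this keeps the set good; hence a good set fixed by [step] is
    maximal for adding elements. *)
Definition step A : T -> Prop :=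
  match excluded_middle_informative (exists y, ~ A y /\ good (add1 A y)) with
  | left h => add1 A (proj1_sig (constructive_indefinite_description _ h))
  | right _ => A
  end.

Lemma step_sub A : subs A (step A).
Proof.
move=> x Ax; rewrite /step; destruct (excluded_middle_informative _) => //.
by left.
Qed.

Lemma step_good A : good A -> good (step A).
Proof.
rewrite /step; case: (excluded_middle_informative _) => // h _.
by case: (constructive_indefinite_description _ _) => y /= [].
Qed.

Lemma step_between A B : subs A B -> subs B (step A) -> B = A \/ B = step A.
Proof.
move=> AB BA; case: (excluded_middle_informative (subs B A)) => h.
  by left; apply: subs_anti.
right; apply: subs_anti => //.
have [y By nAy] : exists2 y, B y & ~ A y.
  apply: NNPP => k; apply: h => y By; apply: NNPP => nAy; apply: k.
  by exists y.
move: (BA y By); rewrite /step.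
case: (excluded_middle_informative _) => // k.
by case: (constructive_indefinite_description _ _) => z /= _ [//|<-] x [/AB|->].
Qed.

Variable A0 : T -> Prop.

(** Replaces the transfinite iteration of [step] from A0. It turns out to be a chain, so its union
    is a member and is fixed by [step]. *)
Inductive tower : (T -> Prop) -> Prop :=
| tower0 : tower A0
| towerS A : tower A -> tower (step A)
| towerU C : (exists A, C A) -> (forall A, C A -> tower A) -> tower (chain_union C).

Lemma tower_ge A : tower A -> subs A0 A.
Proof.
elim=> [//|B _ IH x /IH /step_sub //|C [B CB] _ IH x A0x].
by exists B => //; apply: IH.
Qed.

Lemma tower_union A C :
  (forall B, C B -> subs (step A) B \/ subs B A) ->
  subs (step A) (chain_union C) \/ subs (chain_union C) A.
Proof.
move=> h; case: (classic (exists2 B, C B & subs (step A) B)) => [[B CB sB]|k].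
  by left=> x /sB Bx; exists B.
right=> x [B CB Bx]; case: (h B CB) => [sB|sB]; last exact: sB.
by case: k; exists B.
Qed.

(** Double induction, as in the Bourbaki-Witt theorem; when both sets are successors, [step_between]
    excludes anything strictly between a set and its successor. *)
Lemma tower_linear A B : tower A -> tower B -> subs (step A) B \/ subs B A.
Proof.
move=> tA; elim: tA B => [|A' tA' IHA|C [c0 Cc0] tC IHA] B tB.
- elim: tB => [|B' tB' [h|h]|D _ _ IH]; first by right.
  + by left=> x /h /step_sub.
  + by left; rewrite (subs_anti h (tower_ge tB')).
  exact: tower_union.
- elim: tB => [|B' tB' [h|h]|D _ _ IH].
  + by right; apply: tower_ge; apply: towerS.
  + by left=> x /h /step_sub.
  + case: (IHA B' tB') => k; first by left; rewrite (subs_anti h k).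
    case: (IHA (step B') (towerS tB')) => l; last by right=> x /l /step_sub.
    have l' : subs A' (step B') by move=> x /step_sub /l.
    case: (step_between k l') => ->; right=> //.
    exact: step_sub.
  exact: tower_union.
elim: tB => [|B' tB' [h|h]|D _ _ IH].
- by right; apply: tower_ge; apply: towerU => //; exists c0.
- by left=> x /h /step_sub.
- case: (classic (exists2 c, C c & subs (step B') c)) => [[c Cc k]|k].
    by right=> x /k cx; exists c.
  case: (classic (subs (chain_union C) B')) => [l|l].
    by left; rewrite (subs_anti h l).
  have [c Cc nc] : exists2 c, C c & ~ subs c B'.
    apply: NNPP => n; apply: l => x [c Cc cx]; apply: NNPP => nx; apply: n.
    by exists c => // /(_ x cx).
  case: (IHA c Cc B' tB') => m.
    by case: nc => x /step_sub /m.
  case: (IHA c Cc (step B') (towerS tB')) => n; last by case: k; exists c.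
  have n' : subs c (step B') by move=> x /step_sub /n.
  case: (step_between m n') => e; first by case: nc; rewrite e.
  by case: k; exists c => //; rewrite -e.
exact: tower_union.
Qed.

Lemma zorn_sets : good A0 ->
  exists A, [/\ subs A0 A, good A & forall x, good (add1 A x) -> A x].
Proof.
move=> good0.
have gt A : tower A -> good A.
  elim=> [//|B _ /step_good //|C C0 tC IH]; apply: goodU => // A' B CA CB.
  case: (tower_linear (tC _ CA) (tC _ CB)) => h; last by right.
  by left=> x /step_sub /h.
pose M := chain_union tower.
have tM : tower M by apply: towerU => //; exists A0; apply: tower0.
exists M; split=> [||x gx]; [exact: tower_ge|exact: gt|].
have : subs (step M) M by move=> y Sy; exists (step M) => //; apply: towerS.
move=> sM; apply: NNPP => nx; move: sM; rewrite /step.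
case: (excluded_middle_informative _) => [h|[]]; last by exists x.
case: (constructive_indefinite_description _ _) => y /= [ny _] /(_ y) k.
by apply: ny; apply: k; right.
Qed.

End Zorn.

Section Ultrafilters.
Variable T : Type.
Implicit Types (A B : T -> Prop) (F : (T -> Prop) -> Prop).

Inductive meet_of F : (T -> Prop) -> Prop :=
| meet0 : meet_of F (fun=> True)
| meet1 A B : F A -> meet_of F B -> meet_of F (fun x => A x /\ B x).

Definition fip F := forall A, meet_of F A -> exists x, A x.

Record ultrafilter F : Prop := Ultrafilter {
  ultraS : forall A B, (forall x, A x -> B x) -> F A -> F B;
  ultraI : forall A B, F A -> F B -> F (fun x => A x /\ B x);
  ultra_ex : forall A, F A -> exists x, A x;
  ultraC : forall A, F A \/ F (fun x => ~ A x) }.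

Lemma meet_of_chain (C : ((T -> Prop) -> Prop) -> Prop) A :
  (exists F, C F) -> (forall F G, C F -> C G -> subs F G \/ subs G F) ->
  meet_of (chain_union C) A -> exists2 F, C F & meet_of F A.
Proof.
move=> [F0 CF0] tot; elim=> [|B D [G CG GB] _ [F CF FD]].
  by exists F0 => //; apply: meet0.
have mono (F1 F2 : (T -> Prop) -> Prop) E :
    subs F1 F2 -> meet_of F1 E -> meet_of F2 E.
  by move=> s; elim=> [|? ? /s ? _ ?]; [apply: meet0|apply: meet1].
case: (tot F G CF CG) => s.
  by exists G => //; apply: meet1 => //; apply: mono FD.
by exists F => //; apply: meet1 => //; apply: s.
Qed.

(** A family maximal for the finite intersection property is an ultrafilter. The dichotomy [dis] is
    the key: A can be added unless it is disjoint from some finite meet of members. *)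
Lemma ultra_exists F : fip F -> exists2 G, ultrafilter G & subs F G.
Proof.
move=> fF; have [|G [FG fG mG]] := @zorn_sets _ fip _ F fF.
  move=> C C0 hC tot A /(meet_of_chain C0 tot) [H CH].
  exact: hC.
have dis A : fip (add1 G A) \/ exists2 B, meet_of G B & forall x, B x -> ~ A x.
  case: (classic (fip (add1 G A))) => h; [by left|right].
  apply: NNPP => k; apply: h => B mB.
  have [D mD sD] : exists2 D, meet_of G D & forall x, D x /\ A x -> B x.
    elim: mB => [|B1 B2 [GB|->] _ [D mD sD]].
    - by exists (fun=> True) => //; apply: meet0.
    - exists (fun x => B1 x /\ D x); first exact: meet1.
      by move=> x [[? ?] ?]; split=> //; apply: sD.
    - by exists D => // x [Dx Ax]; split=> //; apply: sD.
  apply: NNPP => n; apply: k; exists D => // x Dx Ax.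
  by apply: n; exists x; apply: sD.
have mGG B : meet_of G B -> G B.
  move=> mB; apply: mG; case: (dis B) => // -[D mD DB].
  have [x [Bx Dx]] : exists x, B x /\ D x.
    apply: fG; elim: mB {DB} => [|B1 B2 G1 _ IH].
      by apply: eq_ind mD _ _; apply: functional_extensionality => x;
        apply: propositional_extensionality; split=> [|[]].
    have -> : (fun x => (B1 x /\ B2 x) /\ D x) =
        (fun x => B1 x /\ (B2 x /\ D x)).
      by apply: functional_extensionality => x;
        apply: propositional_extensionality; tauto.
    exact: meet1.
  by case: (DB x).
have up A B : (forall x, A x -> B x) -> G A -> G B.
  move=> AB GA; apply: mG; case: (dis B) => // -[D mD DB].
  have [x [Ax Dx]] := fG _ (meet1 GA mD).
  by case: (DB x) => //; apply: AB.
exists G => //; split=> //.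
- move=> A B GA GB.
  by apply: (up _ _ _ (mGG _ (meet1 GA (meet1 GB (meet0 G))))) => x [? []].
- move=> A GA; have [x []] := fG _ (meet1 GA (meet0 G)); by exists x.
- move=> A; case: (dis A) => [/mG|[B /mGG GB BA]]; first by left.
  by right; apply: up GB.
Qed.

End Ultrafilters.

                         

Section UltraLimits.
Variables (T : Type) (F : (T -> Prop) -> Prop).
Hypothesis uF : ultrafilter F.

Lemma ultraT : F (fun=> True).
Proof. by case: (ultraC uF (fun=> True)) => //; apply: (ultraS uF). Qed.

Lemma ultra_all n (A : 'I_n -> T -> Prop) :
  (forall i, F (A i)) -> F (fun x => forall i, A i x).
Proof.
elim: n A => [|n IH] A h.
  by apply: (ultraS uF _ ultraT) => x _ [].
apply: (ultraS uF _ (ultraI uF (h ord0) (IH _ (fun i => h (lift ord0 i))))).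
by move=> x [A0 AS] i; case: (unliftP ord0 i) => [j|] ->.
Qed.

(** Limits in finite sets; fibres of covers and sets of conjugate algebraic elements are handled
    this way. *)
Lemma ultra_fin V (f : T -> V) n (e : 'I_n -> V) :
  F (fun x => exists i, e i = f x) -> exists v, F (fun x => f x = v).
Proof.
elim: n e => [|n IH] e h; first by have [x [[]]] := ultra_ex uF h.
case: (ultraC uF (fun x => f x = e ord0)) => k; first by exists (e ord0).
apply: (IH (fun i => e (lift ord0 i))).
apply: (ultraS uF _ (ultraI uF h k)) => x [[i <-] ne].
by case: (unliftP ord0 i) ne => [j ->|-> //]; exists j.
Qed.

Lemma ultra_map V (f : T -> V) : ultrafilter (fun B => F (fun x => B (f x))).
Proof.
split=> [A B AB|A B|A|A].
- by apply: (ultraS uF) => x; apply: AB.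
- exact: ultraI.
- by move/(ultra_ex uF) => [x Ax]; exists (f x).
- exact: ultraC.
Qed.

End UltraLimits.

(** * Congruences modulo normal subgroups, profinite groups *)

Section GroupTheory.
Variable P : tgroup.
Implicit Types x y z : P.

Lemma tmulAr x y z : (x * y * z = x * (y * z))%tg.
Proof. by rewrite tmulA. Qed.
Lemma tmulVK x y : (x^-1 * (x * y) = y)%tg.
Proof. by rewrite tmulA tmulVl tmul1l. Qed.
Lemma tmulKV x y : (x * (x^-1 * y) = y)%tg.
Proof. by rewrite tmulA tmulVr tmul1l. Qed.
Lemma tinv1 : (1^-1 = 1 :> P)%tg.
Proof. by rewrite -[LHS]tmul1l tmulVr. Qed.

Definition tgE := (@tmulAr, @tinvM P, @tinvK P, @tmulVK, @tmulKV,
  @tmul1l P, @tmul1r P, @tmulVl P, @tmulVr P, @tinv1).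

Lemma tmul_injl x y z : (x * y = x * z -> y = z)%tg.
Proof. by move/(congr1 (tmul (tinv x))); rewrite !tgE. Qed.

Definition eqm (V : P -> Prop) x y := V (x^-1 * y)%tg.

Variable V : normal_subgroup P.

Lemma nset1 : V 1%tg. Proof. by case: (nset_subgroup V). Qed.
Lemma nsetM x y : V x -> V y -> V (x * y)%tg.
Proof. by case: (nset_subgroup V) => ? + _; apply. Qed.
Lemma nsetV x : V x -> V (x^-1)%tg.
Proof. by case: (nset_subgroup V) => ? _; apply. Qed.
Lemma nsetJ x y : V x -> V (y^-1 * x * y)%tg.
Proof. by rewrite -{2}(tinvK y); apply: nset_normal. Qed.
Lemma nsetJE x y : V (y * x * y^-1)%tg <-> V x.
Proof.
split; last exact: nset_normal.
by move/(nsetJ y); rewrite !tgE.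
Qed.

Lemma eqm_refl x : eqm V x x.
Proof. by rewrite /eqm tmulVl; apply: nset1. Qed.
Lemma eqm_sym x y : eqm V x y -> eqm V y x.
Proof. by move/nsetV; rewrite /eqm !tgE. Qed.
Lemma eqm_trans y x z : eqm V x y -> eqm V y z -> eqm V x z.
Proof. by move=> a b; have := nsetM a b; rewrite /eqm !tgE. Qed.
Lemma eqmM x x' y y' : eqm V x x' -> eqm V y y' -> eqm V (x * y)%tg (x' * y')%tg.
Proof.
rewrite /eqm => a b; have := nsetM (nsetJ y a) b; by rewrite !tgE.
Qed.
Lemma eqmV x x' : eqm V x x' -> eqm V (x^-1)%tg (x'^-1)%tg.
Proof. by rewrite /eqm => /eqm_sym /(nset_normal x); rewrite !tgE. Qed.
Lemma eqm_mem x y : eqm V x y -> V x <-> V y.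
Proof.
move=> e; split=> h; first by have := nsetM h e; rewrite !tgE.
by have := nsetM h (nsetV e); rewrite !tgE.
Qed.
Lemma eqm1 x : eqm V 1%tg x <-> V x.
Proof. by rewrite /eqm !tgE. Qed.

End GroupTheory.

Lemma hom1 (P Q : tgroup) (f : P -> Q) : is_hom f -> f 1%tg = 1%tg.
Proof. by move=> h; apply: (tmul_injl (x := f 1%tg)); rewrite -h !tgE. Qed.
Lemma homV (P Q : tgroup) (f : P -> Q) x : is_hom f -> f (x^-1)%tg = ((f x)^-1)%tg.
Proof. by move=> h; apply: tinv_uniq; rewrite -h tmulVr hom1. Qed.

Section NormalSubgroups.
Variable P : tgroup.

Definition nsetI_def (V W : normal_subgroup P) x := V x /\ W x.

Lemma nsetI_subgroup V W : is_subgroup (nsetI_def V W).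
Proof.
split=> [|x y [? ?] [? ?]|x [? ?]]; split;
  by [apply: nset1|apply: nsetM|apply: nsetV].
Qed.

Lemma nsetI_normal V W x y : nsetI_def V W x -> nsetI_def V W (y * x * y^-1)%tg.
Proof. by case=> ? ?; split; apply: nset_normal. Qed.

Definition nsetI V W :=
  NormalSubgroup (nsetI_subgroup V W) (@nsetI_normal V W).

Lemma nsetT_subgroup : @is_subgroup P (fun=> True).
Proof. by split. Qed.

Definition nsetT := @NormalSubgroup P (fun=> True) nsetT_subgroup
  (fun _ _ => id).

Variables (Q : tgroup) (f : P -> Q) (V : normal_subgroup Q).
Hypothesis hf : forall x y, eqm V (f (x * y)%tg) (f x * f y)%tg.

Lemma preimN1 : V (f 1%tg).
Proof.
have := eqm_sym (hf 1%tg 1%tg); rewrite tmul1l /eqm !tgE.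
by move/nsetV; rewrite tinvK.
Qed.

Lemma preimN_mulV x : eqm V (f (x^-1)%tg) ((f x)^-1)%tg.
Proof.
have := hf (x^-1)%tg x; rewrite tmulVl => h.
have /eqm_sym k := eqm_trans (proj2 (eqm1 V _) preimN1) h.
have := eqmM k (eqm_refl V ((f x)^-1)%tg); rewrite !tgE.
by [].
Qed.

Lemma preimN_subgroup : is_subgroup (fun x => V (f x)).
Proof.
split=> [|x y hx hy|x hx]; first exact: preimN1.
  by apply/(eqm_mem (hf x y)); apply: nsetM.
by apply/(eqm_mem (preimN_mulV x)); apply: nsetV.
Qed.

Lemma preimN_normal x y : V (f x) -> V (f (y * x * y^-1)%tg).
Proof.
move=> hx.
have e : eqm V (f (y * x * y^-1)%tg) (f y * f x * (f y)^-1)%tg.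
  apply: eqm_trans (hf _ _) _; apply: eqmM (hf _ _) _.
  exact: preimN_mulV.
by apply/(eqm_mem e); apply: nset_normal.
Qed.

Definition preimN := NormalSubgroup preimN_subgroup preimN_normal.

End NormalSubgroups.

Section Profinite.

(** Compactness as convergence of ultrafilters. *)
Definition compact (P : tgroup) := forall F, @ultrafilter P F ->
  exists p : P, forall A, topen A -> A p -> F A.

Record profinite (P : tgroup) : Prop := Profinite {
  pf_compact : compact P;
  pf_basis : forall (A : P -> Prop) g, topen A -> A g ->
    exists2 V : normal_subgroup P, topen V & forall v, eqm V g v -> A v;
  pf_coset : forall (V : normal_subgroup P) g, topen V -> topen (eqm V g);
  pf_sep : forall x y : P,
    (forall V : normal_subgroup P, topen V -> eqm V x y) -> x = y }.

Lemma topen_cosets (P : tgroup) (A : P -> Prop) : profinite P ->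
  (forall g, A g ->
    exists2 V : normal_subgroup P, topen V & forall v, eqm V g v -> A v) ->
  topen A.
Proof.
move=> pP h.
have := @topenU P (fun B => topen B /\ subs B A) (fun B => @proj1 _ _).
have -> : (fun x => exists2 B : P -> Prop, topen B /\ subs B A & B x) = A.
  apply: subs_anti => x; first by case=> B [_ BA] /BA.
  move=> Ax; have [V oV VA] := h x Ax.
  by exists (eqm V x); [split=> //; apply: pf_coset|apply: eqm_refl].
by [].
Qed.

Lemma topen_coset (P : tgroup) (V : normal_subgroup P) : profinite P ->
  forall A : P -> Prop, topen V -> (forall g v, eqm V g v -> A g -> A v) ->
  topen A.
Proof.
move=> pP A oV h; apply: topen_cosets => // g Ag.
by exists V => // v /h; apply.
Qed.

(** If no finitely many cosets of V covered P, the complements of the cosets would lie in an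
    ultrafilter, which could not converge. *)
Lemma finite_index (P : tgroup) (V : normal_subgroup P) : profinite P ->
  topen V -> exists n (r : 'I_n -> P), forall g, exists i, eqm V (r i) g.
Proof.
move=> pP oV; apply: NNPP => k.
have fF : fip (fun A => exists g, A = fun x => ~ eqm V g x).
  move=> A mA; suff [n [r hr]] : exists n (r : 'I_n -> P),
      forall x, (forall i, ~ eqm V (r i) x) -> A x.
    apply: NNPP => nA; apply: k; exists n, r => g; apply: NNPP => h.
    by apply: nA; exists g; apply: hr => i e; apply: h; exists i.
  elim: mA => [|B C [g ->] _ [n [r hr]]].
    by exists 0, (fun=> 1%tg).
  exists n.+1, (fun i => if unlift ord0 i is Some j then r j else g) => x h.
  split; first by have := h ord0; rewrite unlift_none.
  by apply: hr => i; have := h (lift ord0 i); rewrite liftK.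
have [G uG FG] := ultra_exists fF.
have [p hp] := pf_compact pP uG.
have Gp := hp _ (pf_coset pP p oV) (eqm_refl V p).
have Gn : G (fun x => ~ eqm V p x) by apply: FG; exists p.
by have [x []] := ultra_ex uG (ultraI uG Gp Gn).
Qed.

Lemma open_preimN (P Q : tgroup) (f : P -> Q) (V : normal_subgroup Q)
    (hf : forall x y, eqm V (f (x * y)%tg) (f x * f y)%tg) :
  tcontinuous f -> topen V -> topen (preimN hf).
Proof. by move=> cf oV; apply: (cf V oV). Qed.

(** If every coset qV meets the image, the traces on U of the preimages of these cosets have the
    finite intersection property; a limit of an ultrafilter containing them lies in U and maps to
    q. *)
Lemma closed_image (P Q : tgroup) (f : P -> Q) (U : P -> Prop) :
  compact P -> profinite Q -> tcontinuous f -> tclosed U ->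
  tclosed (fun y => exists2 x, U x & y = f x).
Proof.
move=> cP pQ cf cU; apply: topen_cosets => // q nq; apply: NNPP => k.
have h (V : normal_subgroup Q) : topen V -> exists2 u, U u & eqm V q (f u).
  move=> oV; apply: NNPP => n; apply: k; exists V => // v qv [u Uu e].
  by apply: n; exists u => //; rewrite -e.
have fF : fip (fun A => exists2 V : normal_subgroup Q, topen V &
    A = fun u => U u /\ eqm V q (f u)).
  move=> A mA; suff [V oV hV] : exists2 V : normal_subgroup Q, topen V &
      forall u, U u -> eqm V q (f u) -> A u.
    by have [u Uu /(hV u Uu)] := h V oV; exists u.
  elim: mA => [|B C [V oV ->] _ [W oW hW]].
    by exists (nsetT Q) => //; apply: topenT.
  exists (nsetI V W); first exact: topenI.
  by move=> u Uu [Vu Wu]; split=> //; apply: hW.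
have [G uG FG] := ultra_exists fF.
have [p hp] := cP _ uG.
have Up : U p.
  apply: NNPP => /(hp _ cU) Gn.
  have G1 : G (fun u => U u /\ eqm (nsetT Q) q (f u)).
    by apply: FG; exists (nsetT Q) => //; apply: topenT.
  by have [x [? []]] := ultra_ex uG (ultraI uG Gn G1).
apply: nq; exists p => //; apply: (pf_sep pQ) => V oV.
have Gp := hp _ (cf _ (pf_coset pQ (f p) oV)) (eqm_refl V (f p)).
have G1 : G (fun u => U u /\ eqm V q (f u)) by apply: FG; exists V.
have [x [px [Ux qx]]] := ultra_ex uG (ultraI uG Gp G1).
exact: (eqm_trans qx (eqm_sym px)).
Qed.

(** The images of the open normal subgroups V of P are a basis at 1 ([imN]), and N being closed
    means that it is the intersection of the VN, which separates points. *)
Lemma profinite_quo (P : tgroup) (N : normal_subgroup P) :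
  profinite P -> tclosed N -> profinite (quo N).
Proof.
move=> pP cN.
have piM x y : quo_pi N (x * y)%tg = (quo_pi N x * quo_pi N y)%tg.
  exact: esym (quo_mul_pi N x y).
have piV x : quo_pi N (x^-1)%tg = ((quo_pi N x)^-1)%tg.
  by apply: homV => ? ?; apply: piM.
have piP (C : quo N) : exists x, C = quo_pi N x.
  by exists (quo_repr C); rewrite -[LHS](quo_reprK C).
have pi0 x : quo_pi N x = 1%tg <-> N x.
  rewrite -[1%tg](hom1 (f := quo_pi N)); last by move=> ? ?; apply: piM.
  split=> [/esym /quo_clsP|]; first by rewrite !tgE.
  by move=> Nx; apply/esym/quo_clsP; rewrite !tgE.
have imN (V : normal_subgroup P) : topen V ->
    exists2 W : normal_subgroup (quo N), topen W &
    forall x, W (quo_pi N x) <-> exists2 v, V v & N (v^-1 * x)%tg.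
  move=> oV; pose W (C : quo N) := exists2 v, V v & C = quo_pi N v.
  have sW : is_subgroup W.
    split; first by exists 1%tg; [apply: nset1|apply/esym/pi0/nset1].
      move=> _ _ [v Vv ->] [w Vw ->]; exists (v * w)%tg; last by rewrite piM.
      exact: nsetM.
    by move=> _ [v Vv ->]; exists (v^-1)%tg; [apply: nsetV|rewrite piV].
  have nW x y : W x -> W (y * x * y^-1)%tg.
    case=> v Vv ->; have [z ->] := piP y; exists (z * v * z^-1)%tg.
      exact: nset_normal.
    by rewrite !piM piV.
  have WE x : W (quo_pi N x) <-> exists2 v, V v & N (v^-1 * x)%tg.
    split=> -[v Vv h]; exists v => //; first by apply/quo_clsP.
    by apply/esym/quo_clsP.
  exists (NormalSubgroup sW nW) => //.
  apply: (topen_coset (V := V)) => // g v gv [u Vu e].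
  exists (u * (g^-1 * v))%tg; first exact: nsetM.
  apply: eq_trans (_ : quo_pi N (g * (g^-1 * v))%tg = _).
    by rewrite tmulKV.
  by rewrite !piM; congr (_ * _)%tg.
have cosP (W : normal_subgroup (quo N)) x y :
    eqm W (quo_pi N x) (quo_pi N y) <-> W (quo_pi N (x^-1 * y)%tg).
  by rewrite /eqm piM piV.
split.
- move=> F uF; pose G (A : P -> Prop) := F (fun C => A (quo_repr C)).
  have [p hp] := pf_compact pP (ultra_map uF (@quo_repr P N) : ultrafilter G).
  exists (quo_pi N p) => A oA Ap.
  have := hp _ oA Ap; rewrite /G; apply: (ultraS uF) => C.
  by rewrite quo_reprK.
- move=> A C oA AC; have [x e] := piP C; rewrite {}e in AC *.
  have [V oV VA] := pf_basis pP (A := fun x => A (quo_cls N x)) oA AC.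
  have [W oW WE] := imN V oV; exists W => // D.
  have [y ->] := piP D => /cosP /WE [v Vv Nv].
  have -> : quo_pi N y = quo_cls N (x * v)%tg.
    by apply/esym/quo_clsP; rewrite !tgE.
  by apply: VA; rewrite /eqm !tgE.
- move=> W C oW; have [x ->] := piP C.
  apply: (topen_cosets (A := fun y => eqm W (quo_pi N x) (quo_pi N y))) => // g xg.
  have [V oV hV] := pf_basis pP oW (nset1 W).
  exists V => // v gv; apply: eqm_trans xg _; apply/cosP.
  by apply: hV; rewrite /eqm !tgE.
- move=> C D; have [x ->] := piP C; have [y ->] := piP D => h.
  apply/quo_clsP; apply: NNPP => /(pf_basis pP cN) [V oV hV].
  have [W oW WE] := imN V oV.
  have /cosP/WE [v Vv Nv] := h W oW.
  apply: (hV (v^-1 * (x^-1 * y))%tg) => //.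
  by have := nsetJ (x^-1 * y)%tg (nsetV Vv); rewrite /eqm !tgE.
Qed.

End Profinite.

                                                                      

(** * From solutions modulo open subgroups to a homomorphism, and on to a section *)

Section Interpolation.
Variables (Gam P : tgroup) (pG : profinite Gam) (pP : profinite P).
Variables (I : Type) (D : I -> Type).
Variables (theta : forall i, D i -> Gam) (s : forall i, D i -> P).
Hypothesis dens : tdense (fun g : Gam =>
  exists i h z, g = (z * @theta i h * z^-1)%tg).

(** A solution modulo V. The map t has values in P but stands for a continuous homomorphism Gam ->
    P/V; representatives are used so that solutions for different V can be compared and passed to a
    limit in P. *)
Record interpolates (V : normal_subgroup P) (t : Gam -> P) : Prop := {
  int_hom : forall x y, eqm V (t (x * y)%tg) (t x * t y)%tg;
  int_open : topen (preimN int_hom);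
  int_conj : forall i, exists z : P, forall h : D i,
    eqm V (s h) (z * t (theta h) * z^-1)%tg }.

Lemma interpolatesS (V W : normal_subgroup P) t :
  (forall x, W x -> V x) -> topen V -> interpolates W t -> interpolates V t.
Proof.
move=> WV oV [hW oW cW].
have hV x y : eqm V (t (x * y)%tg) (t x * t y)%tg by exact: (WV _ (hW x y)).
exists hV; last by move=> i; have [z hz] := cW i; exists z => h; apply: (WV _ (hz h)).
apply: (topen_coset (V := preimN hW)) => // x y e /= Vx.
rewrite -(tmulKV x y); apply/(eqm_mem (hV _ _)); apply: nsetM => //.
exact: WV.
Qed.

                                                                             
                                                 
(** At a conjugate of theta_i(h), membership of t in V amounts to membership of s_i(h), which does
    not involve t. The set where t lies in V but t' does not is open, hence empty by density. *)
Lemma interpolates_ker (V : normal_subgroup P) t t' : interpolates V t ->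
  interpolates V t' -> forall x, V (t x) -> V (t' x).
Proof.
move=> [h o c] [h' o' c'] x Vx; apply: NNPP => nVx.
pose W := nsetI (preimN h) (preimN h').
have [|| _ [i [d [z ->]]] /= [k k']] :=
    dens (B := fun y => V (t y) /\ ~ V (t' y)).
- have oW : topen W := topenI o o'.
  apply: (topen_coset (V := W)) => //.
  move=> g v [e e'] [a a']; rewrite -(tmulKV g v); split.
    by apply/(eqm_mem (h _ _)); apply: (nsetM (V := V) a e).
  move/(eqm_mem (h' _ _)) => b; apply: a'.
  have := nsetM b (nsetV (V := V) e'); by rewrite !tgE.
- by exists x.
apply: k'; apply: (preimN_normal h').
have kd : V (t (theta d)).
  have := preimN_normal h (z^-1)%tg k.
  by rewrite !tgE.
have [y hy] := c i; have [y' hy'] := c' i.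
have /(nset_normal y) e := kd.
have sd : V (s d) by apply/(eqm_mem (hy d)).
by apply/(nsetJE V _ y'); apply/(eqm_mem (hy' d)).
Qed.

(** Solutions T W are chosen modulo all open W, and t is their pointwise limit along an ultrafilter
    that contains, for each V, the set of open W inside V. By [interpolates_ker] all these T W have
    the same open kernel modulo V, and t kills it too; this yields continuity. *)
Theorem interpolation :
  (forall V : normal_subgroup P, topen V -> exists t, interpolates V t) ->
  exists t : Gam -> P, [/\ is_hom t, tcontinuous t & forall i, exists z : P,
    forall h : D i, s h = (z * t (theta h) * z^-1)%tg].
Proof.
move=> ex.
pose T (V : normal_subgroup P) : Gam -> P :=
  epsilon (inhabits (fun=> 1%tg)) (interpolates V).
have TP (V : normal_subgroup P) : topen V -> interpolates V (T V).
  by move=> /ex; apply: epsilon_spec.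
have [F uF hF] : exists2 F, ultrafilter F & forall V : normal_subgroup P,
    topen V -> F (fun W : normal_subgroup P => topen W /\ forall x, W x -> V x).
  have [|F uF sF] := @ultra_exists (normal_subgroup P) (fun A =>
      exists2 V : normal_subgroup P, topen V &
      A = fun W : normal_subgroup P => topen W /\ forall x, W x -> V x).
    move=> A mA; suff [V oV h] : exists2 V : normal_subgroup P, topen V &
        forall W : normal_subgroup P, topen W -> (forall x, W x -> V x) -> A W.
      by exists V; apply: h.
    elim: mA => [|B C [V oV ->] _ [W oW h]].
      by exists (nsetT P) => //; apply: topenT.
    exists (nsetI V W); first exact: topenI.
    move=> X oX XV; split; first by split=> // x /XV [].
    by apply: h => // x /XV [].
  by exists F => // V oV; apply: sF; exists V.
have lim g : exists p, forall A, topen A -> A p -> F (fun W => A (T W g)).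
  exact: (pf_compact pP (ultra_map uF (fun W => T W g))).
pose t g := proj1_sig (constructive_indefinite_description _ (lim g)).
have tP (V : normal_subgroup P) g :
    topen V -> F (fun W => eqm V (t g) (T W g)).
  move=> oV; rewrite /t; case: (constructive_indefinite_description _ _) => p /=.
  by apply; [apply: pf_coset|apply: eqm_refl].
have thom : is_hom t.
  move=> x y; apply: (pf_sep pP) => V oV.
  have [W [[[oW WV] exy] [ex' ey]]] := ultra_ex uF (ultraI uF
    (ultraI uF (hF V oV) (tP V (x * y)%tg oV)) (ultraI uF (tP V x oV) (tP V y oV))).
  apply: eqm_trans exy _; apply: eqm_trans (_ : eqm V _ (T W x * T W y)%tg) _.
    exact: (WV _ (int_hom (TP W oW) x y)).
  by apply: eqm_sym; apply: eqmM.
have tker (V : normal_subgroup P) : topen V -> forall g, V (T V g) -> V (t g).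
  move=> oV g Vg.
  have [W [[oW WV] e]] := ultra_ex uF (ultraI uF (hF V oV) (tP V g oV)).
  apply/(eqm_mem e); apply: interpolates_ker (TP V oV) _ _ Vg.
  exact: interpolatesS WV oV (TP W oW).
have tcoset (V : normal_subgroup P) : topen V ->
    exists2 K : normal_subgroup Gam, topen K &
    forall g, K g <-> V (T V g).
  by move=> oV; exists (preimN (int_hom (TP V oV))); [apply: int_open|].
exists t; split=> // [A oA|i].
  apply: topen_cosets => // g Ag; have [V oV VA] := pf_basis pP oA Ag.
  have [K oK hK] := tcoset V oV; exists K => // v /hK /(tker V oV) e.
  by apply: VA; rewrite -(tmulKV g v) thom /eqm !tgE.
(* Modulo V, both t and T W kill K, so they agree everywhere once they agree on representatives of
   the finitely many cosets of K; some W achieves this. *)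
have conj (V : normal_subgroup P) : topen V -> exists z : P, forall h : D i,
    eqm V (s h) (z * t (theta h) * z^-1)%tg.
  move=> oV; have [K oK hK] := tcoset V oV.
  have [n [r hr]] := finite_index pG oK.
  have [W [[oW WV] e]] := ultra_ex uF (ultraI uF (hF V oV)
    (ultra_all uF (fun i => tP V (r i) oV))).
  have iW := interpolatesS WV oV (TP W oW).
  have tW g : eqm V (t g) (T W g).
    have [j /hK k] := hr g; rewrite -(tmulKV (r j) g).
    apply: eqm_trans (_ : eqm V _ (T W (r j) * 1)%tg) _.
      rewrite thom; apply: eqmM => //; apply/eqm_sym/eqm1.
      exact: tker.
    apply: eqm_sym; apply: eqm_trans (int_hom iW _ _) _.
    apply: eqmM (eqm_refl _ _) _; apply/eqm_sym/eqm1.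
    exact: interpolates_ker (TP V oV) iW _ k.
  have [z hz] := int_conj iW i; exists z => h.
  apply: eqm_trans (hz h) _; apply: eqmM (eqm_refl _ _).
  by apply: eqmM (eqm_refl _ _) _; apply: eqm_sym.
(* The conjugating element still depends on V. The sets of those valid modulo V have the finite
   intersection property, and a limit point is valid for all V at once. *)
have [|G uG sG] := @ultra_exists P (fun A => exists2 V : normal_subgroup P,
    topen V & A = fun z => forall h : D i,
      eqm V (s h) (z * t (theta h) * z^-1)%tg).
  move=> A mA; suff [V oV h] : exists2 V : normal_subgroup P, topen V &
      forall z, (forall h : D i, eqm V (s h) (z * t (theta h) * z^-1)%tg) -> A z.
    by have [z /h] := conj V oV; exists z.
  elim: mA => [|B C [V oV ->] _ [W oW k]].
    by exists (nsetT P) => //; apply: topenT.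
  exists (nsetI V W); first exact: topenI.
  by move=> z hz; split=> [h|]; [case: (hz h)|apply: k => h; case: (hz h)].
have [z hz] := pf_compact pP uG.
exists z => h; apply: (pf_sep pP) => V oV.
have G1 := hz _ (pf_coset pP z oV) (eqm_refl V z).
have G2 : G (fun z => forall h : D i, eqm V (s h) (z * t (theta h) * z^-1)%tg).
  by apply: sG; exists V.
have [y [zy hy]] := ultra_ex uG (ultraI uG G1 G2).
apply: eqm_trans (hy h) _; apply: eqmM; last by apply: eqm_sym; apply: eqmV.
by apply: eqmM (eqm_refl _ _); apply: eqm_sym.
Qed.

                                                                           
                                                                               
                         
(** The endomorphism a = p o t sends each theta_i(h) to a conjugate. By density it preserves and
    reflects each open normal subgroup ([aV]), so it is injective and has dense image, which is
    everything by compactness. The section is t o a^-1. *)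
Theorem section_of_interpolation (p : P -> Gam) (t : Gam -> P) :
  is_hom p -> tcontinuous p -> (forall i (h : D i), p (s h) = theta h) ->
  is_hom t -> tcontinuous t ->
  (forall i, exists z : P, forall h : D i,
    s h = (z * t (theta h) * z^-1)%tg) ->
  exists t' : Gam -> P, [/\ is_hom t', tcontinuous t',
    forall g, p (t' g) = g &
    forall i, exists2 z : P, p z = 1%tg & forall h : D i,
      s h = (z * t' (theta h) * z^-1)%tg].
Proof.
move=> hp cp ps ht ct conj; pose a g := p (t g).
have ha : is_hom a by move=> x y; rewrite /a ht hp.
have ca : tcontinuous a by move=> A /cp /ct.
have aconj i : exists z : Gam, forall h : D i,
    theta h = (z * a (theta h) * z^-1)%tg.
  have [z hz] := conj i; exists (p z) => h.
  by rewrite -{1}ps hz !hp homV.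
have aV (V : normal_subgroup Gam) : topen V -> forall g, V (a g) <-> V g.
  move=> oV.
  have key B : topen B -> (forall x z, B (z * x * z^-1)%tg <-> B x) ->
      (forall i (h : D i), ~ B (theta h)) -> forall x, ~ B x.
    move=> oB cB nB x Bx; have [|_ [i [h [z ->]]] /cB] := dens oB.
      by exists x.
    exact: nB.
  have hV x y : eqm V (a (x * y)%tg) (a x * a y)%tg.
    by rewrite ha; apply: eqm_refl.
  have oW : topen (nsetI V (preimN hV)) by apply: topenI => //; apply: ca V oV.
  have cV x z : V (z * x * z^-1)%tg <-> V x.
    by apply: nsetJE.
  have cV' x z : V (a (z * x * z^-1)%tg) <-> V (a x).
    by rewrite !ha homV //; apply: nsetJE.
  have same i (h : D i) : V (theta h) <-> V (a (theta h)).
    by have [z hz] := aconj i; rewrite {1}hz; apply: nsetJE.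
  have cos g v : eqm (nsetI V (preimN hV)) g v ->
      (V g <-> V v) /\ (V (a g) <-> V (a v)).
    case=> e /= e'; split; first exact: eqm_mem.
    by apply: eqm_mem; rewrite /eqm -homV // -ha.
  move=> g; apply: NNPP => n.
  apply: (key (fun g => ~ (V (a g) <-> V g))) n.
  - by apply: topen_coset oW _ => // x y /cos; tauto.
  - by move=> x z; have := cV x z; have := cV' x z; tauto.
  - by move=> i h; have := same i h; tauto.
have ainj x y : a x = a y -> x = y.
  move=> e; apply: (pf_sep pG) => V oV; apply/(aV V oV).
  by rewrite ha homV // e tmulVl; apply: nset1.
(* Two iterates of a at g agree modulo V by the pigeonhole principle; since a is injective modulo V,
   the common part cancels and g is congruent to a positive iterate. *)
have dense_a (V : normal_subgroup Gam) g : topen V -> exists x, eqm V g (a x).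
  move=> oV; have [n [r hr]] := finite_index pG oV.
  pose idx k := proj1_sig (constructive_indefinite_description _ (hr (iter k a g))).
  have idxP k : eqm V (r (idx k)) (iter k a g).
    by rewrite /idx; case: (constructive_indefinite_description _ _).
  have [i [j [ij e]]] : exists i j, i < j /\ idx i = idx j.
    have : ~~ injectiveb (fun i : 'I_n.+1 => idx i).
      apply/negP => /injectiveP /leq_card; rewrite !card_ord; by rewrite ltnn.
    case/injectivePn => i [j ij e].
    by case: (ltngtP i j) => [ltij|ltji|/val_inj ee];
      [exists i, j|exists j, i|rewrite ee eqxx in ij].
  have : eqm V (iter i a g) (iter j a g).
    by apply: eqm_trans (idxP j); rewrite -e; apply: eqm_sym; apply: idxP.
  rewrite -(subnKC (ltnW ij)); move: (j - i) (subn_gt0 i j) => m.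
  rewrite ij => m0; elim: i {e ij} => [|i IH] /=.
    by case: m m0 => // m _ e; exists (iter m a g).
  by rewrite /eqm -homV // -ha => /(aV V oV) /IH.
have asurj g : exists x, a x = g.
  apply: NNPP => n.
  have cT : tclosed (fun y => exists2 x : Gam, True & y = a x).
    apply: (closed_image (U := fun=> True)) => //; first exact: pf_compact pG.
    rewrite /tclosed; apply: topen_cosets => // x; tauto.
  have [|V oV hV] := pf_basis pG cT (g := g).
    by case=> x _ e; apply: n; exists x.
  by have [x /hV []] := dense_a V g oV; exists x.
pose b g := proj1_sig (constructive_indefinite_description _ (asurj g)).
have bK g : a (b g) = g.
  by rewrite /b; case: (constructive_indefinite_description _ _).
have hb : is_hom b by move=> x y; apply: ainj; rewrite ha !bK.
have bV (V : normal_subgroup Gam) g : topen V -> V g -> V (b g).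
  by move=> oV Vg; apply/(aV V oV); rewrite bK.
have ht' : is_hom (fun g => t (b g)) by move=> x y; rewrite hb ht.
have pt' g : p (t (b g)) = g by apply: bK.
exists (fun g => t (b g)); split=> // [A oA|i].
  apply: topen_cosets => // g Ag.
  have [V oV hV] := pf_basis pG (ct A oA) Ag.
  by exists V => // v /bV; rewrite hb homV // => /(_ oV) /hV.
(* The conjugating element z is moved into the kernel of p by dividing by the value of the new
   section at p z. *)
have [z hz] := conj i; exists (z * (t (b (p z)))^-1)%tg.
  by rewrite hp homV // pt' tmulVr.
move=> h; have e : theta h = (p z * a (theta h) * (p z)^-1)%tg.
  by rewrite -{1}ps hz !hp homV.
rewrite {1}hz {2}e !hb (homV _ hb) !ht (homV _ ht).
have -> : b (a (theta h)) = theta h by apply: ainj; rewrite bK.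
by rewrite !tgE.
Qed.

End Interpolation.

                         

                                                                     
                                                                 
(** * Finite quotients as finite groups *)

Section FiniteQuotient.
Variables (P : tgroup) (V : normal_subgroup P) (A : P -> Prop).
Hypothesis sA : is_subgroup A.
Variables (n : nat) (r : 'I_n -> P).
Hypothesis hr : forall g, exists i, eqm V (r i) g.

Lemma fq_idx_ex g : exists i, `[< eqm V (r i) g >].
Proof. by have [i e] := hr g; exists i; apply/asboolP. Qed.

(** A canonical label for the coset of g: the choice depends only on the set of representatives
    congruent to g. *)
Definition fq_idx g : 'I_n := xchoose (fq_idx_ex g).

Lemma fq_idxP g h : fq_idx g = fq_idx h <-> eqm V g h.
Proof.
have iP x : eqm V (r (fq_idx x)) x by apply/asboolP/(xchooseP (fq_idx_ex x)).
split=> [e|e]; first by apply: eqm_trans (eqm_sym (iP g)) _; rewrite e.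
apply: eq_xchoose => i; apply/asboolP/asboolP => h'; apply: (eqm_trans h') => //.
exact: eqm_sym.
Qed.

                                          
(** The carrier of A/(A cap V): labels of the cosets that meet A. The [let] records [sA] in the
    type, because the group structure attached to it depends on that proof. *)
Definition fq := let _ := sA in {i : 'I_n | `[< exists2 a, A a & fq_idx a = i >]}.

HB.instance Definition _ := Finite.on fq.

Lemma fq_cls_ex a : A a -> `[< exists2 a', A a' & fq_idx a' = fq_idx a >].
Proof. by move=> Aa; apply/asboolP; exists a. Qed.

Definition fq_cls a (Aa : A a) : fq := exist _ (fq_idx a) (fq_cls_ex Aa).

Lemma fq_clsP a b (Aa : A a) (Ab : A b) : fq_cls Aa = fq_cls Ab <-> eqm V a b.
Proof.
split=> [/(congr1 val) /fq_idxP //|/fq_idxP e].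
exact: val_inj.
Qed.

Lemma fq_rep_ex (x : fq) : exists a (Aa : A a), fq_cls Aa = x.
Proof.
case: x => i hi; have /asboolP [a Aa e] := hi.
by exists a, Aa; apply: val_inj.
Qed.

Definition fq_rep (x : fq) : P := projT1 (cid (fq_rep_ex x)).

Lemma fq_repP (x : fq) : A (fq_rep x).
Proof. by rewrite /fq_rep; case: cid => a []. Qed.

Lemma fq_repK (x : fq) : fq_cls (fq_repP x) = x.
Proof.
have [a [Aa <-]] := fq_rep_ex x; apply/fq_clsP; rewrite /fq_rep.
by case: cid => b [Ab e] /=; move/fq_clsP: e.
Qed.

Let A1 : A 1%tg := let: And3 h _ _ := sA in h.
Let AM x y : A x -> A y -> A (x * y)%tg := let: And3 _ h _ := sA in h x y.
Let AV x : A x -> A (x^-1)%tg := let: And3 _ _ h := sA in h x.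

Definition fq_one : fq := fq_cls A1.
Definition fq_mul (x y : fq) : fq := fq_cls (AM (fq_repP x) (fq_repP y)).
Definition fq_inv (x : fq) : fq := fq_cls (AV (fq_repP x)).

Lemma fq_rep_cls a (Aa : A a) : eqm V (fq_rep (fq_cls Aa)) a.
Proof. exact: (fq_clsP (fq_repP _) Aa).1 (fq_repK _). Qed.

Lemma fq_mulA : associative fq_mul.
Proof.
move=> x y z; apply/fq_clsP.
apply: eqm_trans (eqmM (eqm_refl _ _) (fq_rep_cls _)) _.
apply: eqm_trans (eqmM (eqm_sym (fq_rep_cls _)) (eqm_refl _ _)).
by rewrite tmulA; apply: eqm_refl.
Qed.

Lemma fq_mul1 : left_id fq_one fq_mul.
Proof.
move=> x; rewrite -[RHS]fq_repK; apply/fq_clsP.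
apply: eqm_trans (eqmM (fq_rep_cls _) (eqm_refl _ _)) _.
by rewrite tmul1l; apply: eqm_refl.
Qed.

Lemma fq_mulV : left_inverse fq_one fq_inv fq_mul.
Proof.
move=> x; apply/fq_clsP.
apply: eqm_trans (eqmM (fq_rep_cls _) (eqm_refl _ _)) _.
by rewrite tmulVl; apply: eqm_refl.
Qed.

HB.instance Definition _ := Finite_isGroup.Build fq fq_mulA fq_mul1 fq_mulV.

End FiniteQuotient.

Lemma finite_quotient (P : tgroup) (V : normal_subgroup P) (A : P -> Prop) :
  profinite P -> topen V -> is_subgroup A ->
  exists (H : finGroupType) (f : P -> H) (rep : H -> P),
  [/\ forall m, A (rep m), forall m, f (rep m) = m,
      forall a b, A a -> A b -> f (a * b)%tg = (f a * f b)%g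
    & forall a b, A a -> A b -> f a = f b <-> eqm V a b].
Proof.
move=> pP oV sA; have [n [r hr]] := finite_index pP oV.
have [A1 AM _] := sA.
(* Outside A the value 1 is a default. *)
pose f a : fq sA hr := if pselect (A a) is left Aa then fq_cls sA hr Aa else 1%g.
have fE a (Aa : A a) : f a = fq_cls sA hr Aa.
  by rewrite /f; case: pselect => // Aa'; apply/fq_clsP/eqm_refl.
exists (fq sA hr), f, (@fq_rep P V A sA n r hr); split=> [m|m|a b Aa Ab|a b Aa Ab].
- exact: fq_repP.
- by rewrite (fE _ (fq_repP m)) fq_repK.
- rewrite (fE _ (AM _ _ Aa Ab)) !fE; apply/fq_clsP.
  by apply: eqmM; apply/eqm_sym/fq_rep_cls.
by rewrite !fE; apply: fq_clsP.
Qed.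

Import GRing.Theory.
Local Open Scope ring_scope.

(** * Linear forms, tensor products and pushouts of rings *)

Section LinearForms.
Variables (R B : comPzRingType) (s : {rmorphism R -> B}) (l : B -> R).
Hypothesis hl : linear_form s l.

Lemma lform0 : l 0 = 0.
Proof. by have := hl (-1) 0 0; rewrite mulr0 addr0 mulN1r addNr. Qed.

Lemma lformD b c : l (b + c) = l b + l c.
Proof. by have := hl 1 b c; rewrite rmorph1 !mul1r. Qed.

Lemma lformZ r b : l (s r * b) = r * l b.
Proof. by have := hl r b 0; rewrite lform0 !addr0. Qed.

Lemma lformN b : l (- b) = - l b.
Proof. by have := lformZ (-1) b; rewrite rmorphN rmorph1 !mulN1r. Qed.

Lemma lform_sum I (r : seq I) (P : pred I) F :
  l (\sum_(i <- r | P i) F i) = \sum_(i <- r | P i) l (F i).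
Proof. exact: (big_morph l lformD lform0). Qed.

End LinearForms.

                                                  

                                                                             
                                                                           
                               
Section TensorModel.
Variables (R A B : comPzRingType) (f : {rmorphism R -> A})
          (s : {rmorphism R -> B}).

Record lmap := Lmap {
  lfun :> B -> A;
  lfunP : forall r b c, lfun (s r * b + c) = f r * lfun b + lfun c }.

Lemma lmap0 (u : lmap) : u 0 = 0.
Proof.
by have := lfunP u (-1) 0 0; rewrite mulr0 addr0 rmorphN1 mulN1r addNr.
Qed.
Lemma lmapD (u : lmap) b c : u (b + c) = u b + u c.
Proof. by have := lfunP u 1 b c; rewrite !rmorph1 !mul1r. Qed.
Lemma lmapZ (u : lmap) r b : u (s r * b) = f r * u b.
Proof. by have := lfunP u r b 0; rewrite lmap0 !addr0. Qed.

Definition tev (l : seq (A * B)) (u : lmap) : A := \sum_(p <- l) p.1 * u p.2.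

(** A model of the tensor product of A and B over R: a sum of tensors a, b is the function u |-> sum
    of the a u(b) on R-linear maps u : B -> A. No relations need be imposed, and the model is
    faithful when B has enough linear forms ([tens_pushout]). *)
Record tens := Tens { tfun : lmap -> A; tfunP : exists l, tfun = tev l }.

Definition tmk l : tens := Tens (ex_intro _ l erefl).
Definition trep (t : tens) : seq (A * B) := projT1 (cid (tfunP t)).

Lemma tens_ext t t' : tfun t = tfun t' -> t = t'.
Proof.
by case: t t' => [t p] [t' p'] /= e; subst t'; congr Tens; apply: Prop_irrelevance.
Qed.

Lemma trepK t : tmk (trep t) = t.
Proof. by apply: tens_ext; rewrite /trep; case: cid => l /= ->. Qed.

Lemma tmkP l l' : (forall u, tev l u = tev l' u) -> tmk l = tmk l'.
Proof. by move=> e; apply: tens_ext; apply: funext. Qed.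

Lemma tev_rep l u : tev (trep (tmk l)) u = tev l u.
Proof. by rewrite /trep; case: cid => l' /= <-. Qed.

HB.instance Definition _ := gen_eqMixin tens.
HB.instance Definition _ := gen_choiceMixin tens.

Definition ladd (l l' : seq (A * B)) := l ++ l'.
Definition lopp (l : seq (A * B)) := [seq (- p.1, p.2) | p <- l].
Definition lmul (l l' : seq (A * B)) :=
  [seq (p.1 * q.1, p.2 * q.2) | p <- l, q <- l'].

Lemma tev_add l l' u : tev (ladd l l') u = tev l u + tev l' u.
Proof. by rewrite /tev big_cat. Qed.
Lemma tev_opp l u : tev (lopp l) u = - tev l u.
Proof.
by rewrite /tev big_map -sumrN; apply: eq_bigr => p _; rewrite mulNr.
Qed.
Lemma tev_mul l l' u : tev (lmul l l') u =
  \sum_(p <- l) \sum_(q <- l') p.1 * q.1 * u (p.2 * q.2).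
Proof. by rewrite /tev /lmul big_allpairs_dep. Qed.

Lemma lshift_subproof (u : lmap) b0 r b c :
  u (b0 * (s r * b + c)) = f r * u (b0 * b) + u (b0 * c).
Proof. by rewrite mulrDr mulrCA lfunP. Qed.
Definition lshift u b0 := Lmap (lshift_subproof u b0).

Lemma tev_mull l l' u : tev (lmul l l') u =
  \sum_(p <- l) p.1 * tev l' (lshift u p.2).
Proof.
rewrite tev_mul; apply: eq_bigr => p _; rewrite /tev mulr_sumr.
by apply: eq_bigr => q _; rewrite mulrA.
Qed.

Lemma tev_mulC l l' u : tev (lmul l l') u = tev (lmul l' l) u.
Proof.
rewrite !tev_mul exchange_big; apply: eq_bigr => q _; apply: eq_bigr => p _.
by rewrite mulrC (mulrC p.2) (mulrC p.1) mulrC.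
Qed.

Definition tadd (t t' : tens) := tmk (ladd (trep t) (trep t')).
Definition topp (t : tens) := tmk (lopp (trep t)).
Definition tmult (t t' : tens) := tmk (lmul (trep t) (trep t')).

Lemma tadd_mk l l' : tadd (tmk l) (tmk l') = tmk (ladd l l').
Proof. by apply: tmkP => u; rewrite !tev_add !tev_rep. Qed.
Lemma topp_mk l : topp (tmk l) = tmk (lopp l).
Proof. by apply: tmkP => u; rewrite !tev_opp !tev_rep. Qed.
Lemma tmult_mk l l' : tmult (tmk l) (tmk l') = tmk (lmul l l').
Proof.
apply: tmkP => u; rewrite tev_mull.
under eq_bigr => p _ do rewrite tev_rep.
rewrite -tev_mull tev_mulC tev_mull.
under eq_bigr => p _ do rewrite tev_rep.
by rewrite -tev_mull tev_mulC.
Qed.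

Lemma tens_ind (P : tens -> Prop) : (forall l, P (tmk l)) -> forall t, P t.
Proof. by move=> h t; rewrite -(trepK t). Qed.

Lemma taddA : associative tadd.
Proof.
elim/tens_ind=> x; elim/tens_ind=> y; elim/tens_ind=> z.
by rewrite !tadd_mk; apply: tmkP => u; rewrite !tev_add addrA.
Qed.
Lemma taddC : commutative tadd.
Proof.
elim/tens_ind=> x; elim/tens_ind=> y.
by rewrite !tadd_mk; apply: tmkP => u; rewrite !tev_add addrC.
Qed.
Lemma tadd0 : left_id (tmk [::]) tadd.
Proof. by elim/tens_ind=> x; rewrite !tadd_mk. Qed.
Lemma taddN : left_inverse (tmk [::]) topp tadd.
Proof.
elim/tens_ind=> x; rewrite topp_mk tadd_mk; apply: tmkP => u.
by rewrite tev_add tev_opp addNr /tev big_nil.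
Qed.
Lemma tmultA : associative tmult.
Proof.
elim/tens_ind=> x; elim/tens_ind=> y; elim/tens_ind=> z.
rewrite !tmult_mk; apply: tmkP => u; rewrite !tev_mull /lmul big_allpairs_dep.
apply: eq_bigr => p _; rewrite tev_mul mulr_sumr; apply: eq_bigr => q _ /=.
rewrite /tev mulr_sumr mulr_sumr; apply: eq_bigr => r _ /=.
by rewrite !mulrA.
Qed.
Lemma tmultC : commutative tmult.
Proof.
elim/tens_ind=> x; elim/tens_ind=> y; rewrite !tmult_mk; apply: tmkP => u.
exact: tev_mulC.
Qed.
Lemma tmult1 : left_id (tmk [:: (1, 1)]) tmult.
Proof.
elim/tens_ind=> x; rewrite tmult_mk; apply: tmkP => u.
rewrite tev_mull big_seq1 mul1r; apply: eq_bigr => p _ /=.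
by rewrite mul1r.
Qed.
Lemma tmultDl : left_distributive tmult tadd.
Proof.
elim/tens_ind=> x; elim/tens_ind=> y; elim/tens_ind=> z.
rewrite !(tadd_mk, tmult_mk); apply: tmkP => u.
by rewrite tev_add !tev_mull big_cat.
Qed.

HB.instance Definition _ := GRing.isZmodule.Build tens taddA taddC tadd0 taddN.
HB.instance Definition _ :=
  GRing.Zmodule_isComPzRing.Build tens tmultA tmultC tmult1 tmultDl.

Lemma tens_add l l' : tmk l + tmk l' = tmk (ladd l l').
Proof. by rewrite -tadd_mk. Qed.
Lemma tens_opp l : - tmk l = tmk (lopp l).
Proof. by rewrite -topp_mk. Qed.
Lemma tens_mul l l' : tmk l * tmk l' = tmk (lmul l l').
Proof. by rewrite -tmult_mk. Qed.

Definition tinA_fun a := tmk [:: (a, 1)].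
Definition tinB_fun b := tmk [:: (1, b)].

Lemma tev1 p u : tev [:: p] u = p.1 * u p.2.
Proof. by rewrite /tev big_seq1. Qed.

Lemma tinA_zmod : zmod_morphism tinA_fun.
Proof.
move=> a b; apply/esym; rewrite /tinA_fun tens_opp tens_add.
by apply: tmkP => u; rewrite tev_add tev_opp !tev1 mulrBl.
Qed.
Lemma tinA_monoid : monoid_morphism tinA_fun.
Proof.
split=> // a b; apply/esym; rewrite /tinA_fun tens_mul.
by apply: tmkP => u; rewrite tev_mull big_seq1 !tev1 /= !mulr1 mulrA.
Qed.
Lemma tinB_zmod : zmod_morphism tinB_fun.
Proof.
move=> a b; apply/esym; rewrite /tinB_fun tens_opp tens_add.
apply: tmkP => u; rewrite tev_add tev_opp !tev1 !mul1r lmapD.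
by have := lmapZ u (-1) b; rewrite !rmorphN !rmorph1 !mulN1r => ->.
Qed.
Lemma tinB_monoid : monoid_morphism tinB_fun.
Proof.
split=> // a b; apply/esym; rewrite /tinB_fun tens_mul.
by apply: tmkP => u; rewrite tev_mull big_seq1 !tev1 /= !mul1r.
Qed.

HB.instance Definition _ := GRing.isZmodMorphism.Build A tens tinA_fun tinA_zmod.
HB.instance Definition _ :=
  GRing.isMonoidMorphism.Build A tens tinA_fun tinA_monoid.
HB.instance Definition _ := GRing.isZmodMorphism.Build B tens tinB_fun tinB_zmod.
HB.instance Definition _ :=
  GRing.isMonoidMorphism.Build B tens tinB_fun tinB_monoid.

Definition tinA : {rmorphism A -> tens} := tinA_fun.
Definition tinB : {rmorphism B -> tens} := tinB_fun.

Lemma tensE l : tmk l = \sum_(p <- l) tinA p.1 * tinB p.2.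
Proof.
elim: l => [|p l IH]; first by rewrite big_nil.
rewrite big_cons -IH tens_mul tens_add.
apply: tmkP => u; rewrite tev_add tev_mull big_seq1 tev1 /= !mul1r.
by rewrite /tev big_cons.
Qed.

Lemma tens_bal r : tinB (s r) = tinA (f r).
Proof.
apply: tmkP => u; rewrite !tev1 /= mul1r -[s r]mulr1 lmapZ.
by [].
Qed.

Lemma tens_ev (u : lmap) : exists2 e : tens -> A,
  linear_form tinA e & forall b, e (tinB b) = u b.
Proof.
exists (fun t => tfun t u) => [a t t'|b]; last by rewrite /= tev1 mul1r.
move: t t'; elim/tens_ind=> x; elim/tens_ind=> y.
rewrite tens_mul tens_add /= tev_add tev_mull big_seq1 /=.
by congr (_ * _ + _); apply: eq_bigr => p _ /=; rewrite mul1r.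
Qed.

End TensorModel.

Lemma rmorphism_of (A C : comPzRingType) (f : A -> C) :
  zmod_morphism f -> monoid_morphism f -> exists g : {rmorphism A -> C}, g =1 f.
Proof.
move=> hz hm.
pose g : {rmorphism A -> C} := HB.pack f (GRing.isZmodMorphism.Build A C f hz)
  (GRing.isMonoidMorphism.Build A C f hm).
by exists g.
Qed.

Section Pushouts.

(** Weaker than finite projectivity, so that it also covers an algebraic closure of a field; it is
    what makes [tens] a pushout. *)
Definition locally_projective (R B : comPzRingType) (s : {rmorphism R -> B}) :=
  forall bs : seq B, exists n (x : 'I_n -> B) (l : 'I_n -> B -> R),
    (forall i, linear_form s (l i)) /\
    {in bs, forall b, b = \sum_i s (l i b) * x i}.

(** The map to C must depend only on the function that a list of tensors defines. Expanding the
    second components with finitely many forms m_i expresses [ev] through the values of [tev] at the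
    maps f o m_i. *)
Lemma tens_pushout (R A B : comPzRingType) (f : {rmorphism R -> A})
    (s : {rmorphism R -> B}) : locally_projective s ->
  is_pushout f s (tinA f s) (tinB f s).
Proof.
move=> lp; split=> [r|C g1 g2 e]; first exact: tens_bal.
pose ev (l : seq (A * B)) : C := \sum_(p <- l) g1 p.1 * g2 p.2.
have ev_eq l l' : tmk f s l = tmk f s l' -> ev l = ev l'.
  move=> /(congr1 (@tfun _ _ _ _ _)) /= h.
  have [n [x [m [hm mP]]]] := lp [seq p.2 | p <- l ++ l'].
  have um i r b c : f (m i (s r * b + c)) = f r * f (m i b) + f (m i c).
    by rewrite hm rmorphD rmorphM.
  have E l0 : {subset l0 <= l ++ l'} ->
      ev l0 = \sum_i g1 (tev l0 (Lmap (um i))) * g2 (x i).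
    move=> sl; transitivity (\sum_(p <- l0) \sum_i
        g1 (p.1 * Lmap (um i) p.2) * g2 (x i)); last first.
      by rewrite exchange_big; apply: eq_bigr => i _;
        rewrite rmorph_sum mulr_suml.
    apply: eq_big_seq => p /sl pl /=.
    rewrite {1}(mP p.2) ?map_f // rmorph_sum mulr_sumr.
    by apply: eq_bigr => i _; rewrite !rmorphM e mulrA.
  rewrite (E l) ?(E l'); first by rewrite h.
    by move=> p pl; rewrite mem_cat pl orbT.
  by move=> p pl; rewrite mem_cat pl.
pose h0 (t : tens f s) := ev (trep t).
have h0E l : h0 (tmk f s l) = ev l by apply: ev_eq; rewrite trepK.
have evM l l' : ev (lmul l l') = ev l * ev l'.
  rewrite /ev /lmul big_allpairs_dep mulr_suml; apply: eq_bigr => p _.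
  rewrite mulr_sumr; apply: eq_bigr => q _.
  by rewrite !rmorphM mulrACA.
have [||h hE] := @rmorphism_of _ _ h0.
- elim/tens_ind=> x; elim/tens_ind=> y; rewrite tens_opp tens_add !h0E.
  rewrite /ev big_cat big_map -sumrN; congr (_ + _); apply: eq_bigr => p _.
  by rewrite rmorphN mulNr.
- split; first by rewrite h0E /ev big_seq1 !rmorph1 mulr1.
  by elim/tens_ind=> x; elim/tens_ind=> y; rewrite tens_mul !h0E evM.
have hA : h \o tinA f s =1 g1.
  by move=> a; rewrite /= hE h0E /ev big_seq1 /= rmorph1 mulr1.
have hB : h \o tinB f s =1 g2.
  by move=> b; rewrite /= hE h0E /ev big_seq1 /= rmorph1 mul1r.
exists h; split=> // h' [h'A h'B]; apply: rmorphism_ext; elim/tens_ind=> l.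
rewrite tensE !rmorph_sum; apply: eq_bigr => p _; rewrite !rmorphM.
have /= -> := hA p.1; have /= -> := hB p.2.
by have /= -> := h'A p.1; have /= -> := h'B p.2.
Qed.

Lemma pushout_sym (R R' B B' : comPzRingType) (u : {rmorphism R -> R'})
    (s : {rmorphism R -> B}) (s' : {rmorphism R' -> B'})
    (v : {rmorphism B -> B'}) : is_pushout u s s' v -> is_pushout s u v s'.
Proof.
move=> [c h]; split=> [r|C f g e]; first by rewrite c.
have [k [[k1 k2] ku]] := h C g f (fun r => esym (e r)).
by exists k; split=> // k' [? ?]; apply: ku.
Qed.

Section Square.
Variables (R R' B B' : comPzRingType) (u : {rmorphism R -> R'})
  (s : {rmorphism R -> B}) (s' : {rmorphism R' -> B'})
  (v : {rmorphism B -> B'}).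
Hypothesis po : is_pushout u s s' v.

Lemma pushout_hom (C : comPzRingType) (f : {rmorphism R' -> C})
    (g : {rmorphism B -> C}) : (forall r, f (u r) = g (s r)) ->
  exists h : {rmorphism B' -> C},
    (forall r, h (s' r) = f r) /\ (forall b, h (v b) = g b).
Proof. by move=> /(po.2 C f g) [h [[h1 h2] _]]; exists h. Qed.

Lemma pushout_eq (C : comPzRingType) (h h' : {rmorphism B' -> C}) :
  (forall r, h (s' r) = h' (s' r)) -> (forall b, h (v b) = h' (v b)) -> h =1 h'.
Proof.
move=> e1 e2 b.
have [|k [_ ku]] := po.2 C (h \o s') (h \o v).
  by move=> r /=; rewrite po.1.
have <- : k = h by apply: ku.
by have <- : k = h' by apply: ku; split=> x /=; rewrite ?e1 ?e2.
Qed.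

(** Pulled back from the tensor model, where evaluation at u o l is such a form. *)
Lemma pushout_form (l : B -> R) : linear_form s l ->
  exists2 l' : B' -> R', linear_form s' l' & forall b, l' (v b) = u (l b).
Proof.
move=> hl.
have um r b c : u (l (s r * b + c)) = u r * u (l b) + u (l c).
  by rewrite hl rmorphD rmorphM.
have [e he eP] := tens_ev (Lmap um).
have [h [h1 h2]] := pushout_hom (fun r => esym (tens_bal u s r)).
exists (fun b => e (h b)) => [r b c|b]; last by rewrite h2 eP.
by rewrite rmorphD rmorphM h1 he.
Qed.

(** By uniqueness the composite B' -> [tens] -> B' is the identity, and the tensor model is visibly
    generated in this way. *)
Lemma pushout_gen : locally_projective s ->
  forall b', exists l : seq (R' * B), b' = \sum_(p <- l) s' p.1 * v p.2.
Proof.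
move=> lp b'; have po' := tens_pushout u lp.
have [h [h1 h2]] := pushout_hom (fun r => esym (tens_bal u s r)).
have [k [[k1 k2] _]] := po'.2 B' s' v (fun r => esym (po.1 r)).
have hk : idfun =1 k \o h.
  apply: (@pushout_eq B' idfun (k \o h)) => [r|b] /=.
    by rewrite h1; have /= -> := k1 r.
  by rewrite h2; have /= -> := k2 b.
have := hk b'; rewrite /= -(trepK (h b')) => e; exists (trep (h b')).
rewrite {1}e tensE rmorph_sum; apply: eq_bigr => p _; rewrite rmorphM.
by have /= -> := k1 p.1; have /= -> := k2 p.2.
Qed.

End Square.

Lemma pushout_paste (R R1 R2 B B1 B2 : comPzRingType)
    (u1 : {rmorphism R -> R1}) (u2 : {rmorphism R1 -> R2})
    (s : {rmorphism R -> B}) (s1 : {rmorphism R1 -> B1})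
    (s2 : {rmorphism R2 -> B2}) (v1 : {rmorphism B -> B1})
    (v2 : {rmorphism B1 -> B2}) :
  is_pushout u1 s s1 v1 -> is_pushout u2 s1 s2 v2 ->
  is_pushout (u2 \o u1) s s2 (v2 \o v1).
Proof.
move=> p1 p2; split=> [r /=|C f g e]; first by rewrite p1.1 p2.1.
have [|h1 [h1a h1b]] := @pushout_hom _ _ _ _ _ _ _ _ p1 C (f \o u2) g.
  by move=> r; apply: e.
have [|h2 [h2a h2b]] := @pushout_hom _ _ _ _ _ _ _ _ p2 C f h1.
  by move=> r; rewrite h1a.
exists h2; split=> [|h' [h'a h'b]].
  by split=> // b /=; rewrite h2b h1b.
apply: rmorphism_ext; apply: (pushout_eq p2) => [r|b].
  by rewrite h2a; have /= -> := h'a r.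
rewrite h2b; apply: (@pushout_eq _ _ _ _ _ _ _ _ p1 C h1 (h' \o v2)) => [r|b'] /=.
  by rewrite h1a p2.1; have /= -> := h'a (u2 r).
by rewrite h1b; have /= -> := h'b b'.
Qed.

Lemma pushout_cancel (R R1 R2 B B1 B2 : comPzRingType)
    (u1 : {rmorphism R -> R1}) (u2 : {rmorphism R1 -> R2})
    (u : {rmorphism R -> R2}) (v : {rmorphism B -> B2})
    (s : {rmorphism R -> B}) (s1 : {rmorphism R1 -> B1})
    (s2 : {rmorphism R2 -> B2}) (v1 : {rmorphism B -> B1})
    (v2 : {rmorphism B1 -> B2}) : u =1 u2 \o u1 -> v =1 v2 \o v1 ->
  (forall r, v2 (s1 r) = s2 (u2 r)) ->
  is_pushout u1 s s1 v1 -> is_pushout u s s2 v -> is_pushout u2 s1 s2 v2.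
Proof.
move=> eu ev c p1 p; split=> // C f g e.
have [|h [ha hb]] := @pushout_hom _ _ _ _ _ _ _ _ p C f (g \o v1).
  by move=> r /=; rewrite eu /= e p1.1.
exists h; split=> [|h' [h'a h'b]].
  split=> //; apply: (@pushout_eq _ _ _ _ _ _ _ _ p1 C (h \o v2) g) => [r|b] /=.
    by rewrite c ha e.
  by have /= <- := ev b; rewrite hb.
apply: rmorphism_ext; apply: (pushout_eq p) => [r|b].
  by rewrite ha; have /= -> := h'a r.
by rewrite hb ev /=; have /= -> := h'b (v1 b).
Qed.

End Pushouts.

(** * Finite etale algebras through dual bases *)

Section EtaleFrames.

                                                                           
                                             
(** Dual bases y, w for the form tr. The last equation forces tr to be the trace of B over R, and
    makes the sum of the tensors y_i, w_i the separability idempotent. These data carry over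
    directly to base changes and composites. *)
Definition etale_frame (R B : comPzRingType) (s : {rmorphism R -> B}) n
    (y w : 'I_n -> B) (tr : B -> R) : Prop :=
  [/\ linear_form s tr, forall b, b = \sum_i s (tr (b * w i)) * y i
    & \sum_i y i * w i = 1].

(** Perfectness gives w_i with l_i = tr(w_i -). Both 1 and the sum of the x_i w_i represent the
    trace, so they coincide. Conversely a form f is represented by the sum of the f(y_i) w_i. *)
Lemma finite_etale_frame (R B : comPzRingType) (s : {rmorphism R -> B}) :
  finite_etale s <-> exists n (y w : 'I_n -> B) tr, etale_frame s y w tr.
Proof.
split=> [[n [x [l [hl hx perf]]]]|[n [y [w [tr [htr hy h1]]]]]].
  pose tr b := \sum_i l i (b * x i).
  have htr : linear_form s tr.
    move=> r b c; rewrite /tr mulr_sumr -big_split; apply: eq_bigr => i _ /=.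
    by rewrite mulrDl -mulrA hl.
  have hw i : exists w, forall c, l i c = tr (w * c).
    by have [w [hw _]] := perf _ (hl i); exists w.
  pose w i := projT1 (cid (hw i)).
  have wP i c : l i c = tr (w i * c) by rewrite /w; case: cid.
  exists n, x, w, tr; split=> // [b|].
    rewrite {1}(hx b); apply: eq_bigr => i _; rewrite wP.
    by rewrite (mulrC b).
  have [b [hb bu]] := perf tr htr.
  rewrite -(bu 1) => [|c]; last by rewrite mul1r.
  apply/esym/bu => c.
  transitivity (tr ((\sum_i x i * w i) * c)) => //.
  rewrite mulr_suml (lform_sum htr); apply: eq_bigr => i _.
  by rewrite (mulrC (x i)) -mulrA -wP mulrC.
have hl i : linear_form s (fun c => tr (w i * c)).
  by move=> r b c /=; rewrite mulrDr mulrCA htr.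
exists n, y, (fun i c => tr (w i * c)); split=> // [b|f hf].
  by rewrite {1}(hy b); apply: eq_bigr => i _; rewrite (mulrC (w i)).
have trE b c : \sum_i tr (w i * (b * c * y i)) = tr (b * c).
  rewrite -[b * c in RHS]mulr1 -h1 mulr_sumr (lform_sum htr).
  by apply: eq_bigr => i _; rewrite (mulrC (w i)) mulrA.
exists (\sum_i s (f (y i)) * w i); split=> [c|b hb].
  rewrite trE {1}(hy c) (lform_sum hf) mulr_suml (lform_sum htr).
  apply: eq_bigr => i _; rewrite (lformZ hf) -mulrA (lformZ htr) mulrC.
  by rewrite (mulrC c).
have nd d : (forall c, tr (d * c) = 0) -> d = 0.
  by move=> hd; rewrite (hy d) big1 // => i _; rewrite hd rmorph0 mul0r.
apply/eqP; rewrite -subr_eq0; apply/eqP/nd => c.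
rewrite mulrBl (lformD htr) (lformN htr) -[tr (b * c)]trE -hb.
rewrite {2}(hy c) (lform_sum hf) mulr_suml (lform_sum htr).
rewrite -sumrB big1 // => i _.
rewrite (lformZ hf) -mulrA (lformZ htr) (mulrC (w i)) (mulrC (f _)) subrr.
by [].
Qed.

Section Frame.
Variables (R B : comPzRingType) (s : {rmorphism R -> B}) (n : nat).
Variables (y w : 'I_n -> B) (tr : B -> R).
Hypothesis F : etale_frame s y w tr.

Let htr : linear_form s tr. Proof. by case: F. Qed.
Let hy b : b = \sum_i s (tr (b * w i)) * y i. Proof. by case: F. Qed.
Let h1 : \sum_i y i * w i = 1. Proof. by case: F. Qed.

Lemma frame_form i : linear_form s (fun b => tr (b * w i)).
Proof. by move=> r b c; rewrite mulrDl -mulrA htr. Qed.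

Lemma frame_locally_projective : locally_projective s.
Proof.
move=> bs; exists n, y, (fun i b => tr (b * w i)); split=> // i.
exact: frame_form.
Qed.

Lemma frame_nondeg d : (forall c, tr (d * c) = 0) -> d = 0.
Proof. by move=> hd; rewrite (hy d) big1 // => i _; rewrite hd rmorph0 mul0r. Qed.

Lemma frame_dual b : b = \sum_i s (tr (b * y i)) * w i.
Proof.
apply/eqP; rewrite -subr_eq0; apply/eqP/frame_nondeg => c.
rewrite mulrBl (lformD htr) (lformN htr) {1}(hy c) mulr_sumr mulr_suml.
rewrite !(lform_sum htr) -sumrB big1 // => i _.
rewrite mulrCA (lformZ htr) -mulrA (lformZ htr) mulrC (mulrC (w i)).
by rewrite subrr.
Qed.

                                                                              
                                    
(** The image of the separability idempotent under f and g: the idempotent of the open and closed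
    locus where f and g agree. *)
Definition agree_idem (C : comPzRingType) (f g : {rmorphism B -> C}) : C :=
  \sum_i f (y i) * g (w i).

Section Agree.
Variables (C : comPzRingType) (f g : {rmorphism B -> C}).
Hypothesis fg : forall r, f (s r) = g (s r).

(** Expanding b y_i in the y_j on one side and b w_j in the w_i on the other gives the same double
    sum. *)
Lemma agree_idemE b : f b * agree_idem f g = g b * agree_idem f g.
Proof.
rewrite /agree_idem !mulr_sumr.
transitivity (\sum_i \sum_j f (s (tr (b * y i * w j))) * (f (y j) * g (w i))).
  apply: eq_bigr => i _; rewrite mulrA -rmorphM {1}(hy (b * y i)).
  rewrite rmorph_sum mulr_suml; apply: eq_bigr => j _.
  by rewrite rmorphM mulrA.
rewrite exchange_big; apply: eq_bigr => j _; rewrite mulrCA -rmorphM.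
rewrite (frame_dual (b * w j)) rmorph_sum mulr_sumr; apply: eq_bigr => i _.
by rewrite rmorphM fg mulrCA -!mulrA (mulrC (w j)).
Qed.

Lemma agree_idem_idem : agree_idem f g * agree_idem f g = agree_idem f g.
Proof.
rewrite {1}/agree_idem mulr_suml.
under eq_bigr => i _ do rewrite mulrAC agree_idemE mulrAC -rmorphM.
by rewrite -!mulr_suml -rmorph_sum h1 rmorph1 mul1r.
Qed.

Lemma agree_idem_uniq e : (forall b, f b * e = g b * e) -> e * e = e ->
  agree_idem f g * e = e.
Proof.
move=> he _; rewrite /agree_idem mulr_suml.
under eq_bigr => i _ do rewrite mulrAC he mulrAC -rmorphM.
by rewrite -mulr_suml -rmorph_sum h1 rmorph1 mul1r.
Qed.

Lemma agree_idem1 : f =1 g -> agree_idem f g = 1.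
Proof.
move=> e; rewrite /agree_idem.
under eq_bigr => i _ do rewrite e -rmorphM.
by rewrite -rmorph_sum h1 rmorph1.
Qed.

End Agree.
End Frame.

Lemma frame_pushout (R R' B B' : comPzRingType) (u : {rmorphism R -> R'})
    (s : {rmorphism R -> B}) (s' : {rmorphism R' -> B'})
    (v : {rmorphism B -> B'}) n (y w : 'I_n -> B) tr :
  is_pushout u s s' v -> etale_frame s y w tr ->
  exists2 tr', etale_frame s' (v \o y) (v \o w) tr' &
    forall b, tr' (v b) = u (tr b).
Proof.
move=> po F; have [htr hy h1] := F.
have [tr' htr' e] := pushout_form po htr; exists tr' => //; split=> // [b|].
  have [l ->] := pushout_gen po (frame_locally_projective F) b.
  under [RHS]eq_bigr do rewrite mulr_suml (lform_sum htr') rmorph_sum mulr_suml.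
  rewrite exchange_big; apply: eq_bigr => p _ /=.
  rewrite {1}(hy p.2) rmorph_sum mulr_sumr; apply: eq_bigr => i _.
  rewrite rmorphM po.1 -mulrA (lformZ htr') -rmorphM e rmorphM.
  by rewrite mulrA.
by under eq_bigr do rewrite /= -rmorphM; rewrite -rmorph_sum h1 rmorph1.
Qed.

Lemma frame_comp (R A B : comPzRingType) (s : {rmorphism R -> A})
    (t : {rmorphism A -> B}) : finite_etale s -> finite_etale t ->
  finite_etale (t \o s).
Proof.
move=> /finite_etale_frame [n [y [w [tr [htr hy h1]]]]].
move=> /finite_etale_frame [m [z [v [tr' [htr' hz h1']]]]].
apply/finite_etale_frame.
pose dec (i : 'I_#|{: 'I_n * 'I_m}|) := enum_val i : 'I_n * 'I_m.
exists #|{: 'I_n * 'I_m}|, (fun i => t (y (dec i).1) * z (dec i).2),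
  (fun i => t (w (dec i).1) * v (dec i).2), (tr \o tr').
have sumE (F : 'I_n * 'I_m -> B) : \sum_i F (dec i) = \sum_j \sum_i F (i, j).
  rewrite -(big_enum_val F).
  rewrite exchange_big pair_big /=.
  by apply: eq_big => [[]|[]].
split=> [r b c|b|] /=.
- by rewrite htr' htr.
- rewrite (sumE (fun p => t (s (tr (tr' (b * (t (w p.1) * v p.2))))) *
    (t (y p.1) * z p.2))) /=.
  rewrite {1}(hz b); apply: eq_bigr => j _.
  rewrite {1}(hy (tr' (b * v j))) rmorph_sum mulr_suml; apply: eq_bigr => i _.
  by rewrite rmorphM (mulrC _ (w i)) -(lformZ htr') (mulrCA _ b) -!mulrA.
rewrite (sumE (fun p => t (y p.1) * z p.2 * (t (w p.1) * v p.2))) /=.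
under eq_bigr => j _ do under eq_bigr => i _ do rewrite mulrACA -rmorphM.
under eq_bigr => j _ do rewrite -mulr_suml -rmorph_sum h1 rmorph1 mul1r.
exact: h1'.
Qed.

Lemma finite_etale_pushout (R R' B B' : comPzRingType) (u : {rmorphism R -> R'})
    (s : {rmorphism R -> B}) (s' : {rmorphism R' -> B'})
    (v : {rmorphism B -> B'}) :
  is_pushout u s s' v -> finite_etale s -> finite_etale s'.
Proof.
move=> po /finite_etale_frame [n [y [w [tr /(frame_pushout po) [tr' F _]]]]].
by apply/finite_etale_frame; exists n, (v \o y), (v \o w), tr'.
Qed.

Lemma etale_locally_projective (R B : comPzRingType) (s : {rmorphism R -> B}) :
  finite_etale s -> locally_projective s.
Proof.
by move=> /finite_etale_frame [n [y [w [tr /frame_locally_projective]]]].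
Qed.

End EtaleFrames.

                                                                        
(** * Polynomials in algebras; finite etale algebras over a field *)

Section Peval.
Variables (K : fieldType) (B : comPzRingType) (s : {rmorphism K -> B}).
Implicit Types p q : {poly K}.

(** Evaluation in an arbitrary commutative algebra, the zero ring included. *)
Definition pev p (b : B) : B := \sum_(i < size p) s p`_i * b ^+ i.

Lemma pev_wide n p b : (size p <= n)%N ->
  pev p b = \sum_(i < n) s p`_i * b ^+ i.
Proof.
move=> le_n; rewrite /pev (big_ord_widen n (fun i => s p`_i * b ^+ i) le_n).
rewrite big_mkcond; apply: eq_bigr => i _; case: ltnP => // h.
by rewrite nth_default // rmorph0 mul0r.
Qed.

Lemma pevD p q b : pev (p + q) b = pev p b + pev q b.
Proof.
have le := size_polyD p q.
rewrite (pev_wide _ le) (pev_wide b (leq_maxl (size p) (size q))).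
rewrite (pev_wide b (leq_maxr (size p) (size q))) -big_split.
by apply: eq_bigr => i _; rewrite coefD rmorphD mulrDl.
Qed.

Lemma pevC c b : pev c%:P b = s c.
Proof.
rewrite (pev_wide (n := 1) b (size_polyC_leq1 c)) big_ord1 coefC eqxx.
by rewrite expr0 mulr1.
Qed.

Lemma pev_mulX p b : pev (p * 'X) b = pev p b * b.
Proof.
rewrite (pev_wide (n := (size p).+1)) ?size_mulX_leq //; last first.
  by rewrite (leq_trans (size_polyMleq _ _)) // size_polyX addn2.
rewrite big_ord_recl coefMX eqxx rmorph0 mul0r add0r /pev mulr_suml.
by apply: eq_bigr => i _; rewrite coefMX /= exprSr mulrA.
Qed.

Lemma pev_Cmul c p b : pev (c%:P * p) b = s c * pev p b.
Proof.
rewrite (pev_wide (n := size p)); last by rewrite mul_polyC size_scale_leq.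
rewrite /pev mulr_sumr; apply: eq_bigr => i _.
by rewrite coefCM rmorphM mulrA.
Qed.

Lemma pev0 b : pev 0 b = 0.
Proof. by rewrite /pev size_poly0 big_ord0. Qed.

Lemma pevM p q b : pev (p * q) b = pev p b * pev q b.
Proof.
elim/poly_ind: p q => [|p c IH] q; first by rewrite mul0r pev0 mul0r.
rewrite mulrDl pevD pev_Cmul pevD pev_mulX pevC mulrDl; congr (_ + _).
by rewrite -mulrA (mulrC 'X) mulrA pev_mulX IH mulrAC.
Qed.

Lemma pev1 b : pev 1 b = 1. Proof. by rewrite pevC rmorph1. Qed.
Lemma pevX b : pev 'X b = b. Proof. by rewrite -[X in pev X]mul1r pev_mulX pev1 mul1r. Qed.
Lemma pevN p b : pev (- p) b = - pev p b.
Proof. by rewrite -mulN1r -polyC1 -polyCN pev_Cmul rmorphN rmorph1 mulN1r. Qed.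
Lemma pevXn p n b : pev (p ^+ n) b = pev p b ^+ n.
Proof. by elim: n => [|n IH]; rewrite ?pev1 // !exprS pevM IH. Qed.

Lemma pev_dvd p q b : p %| q -> pev p b = 0 -> pev q b = 0.
Proof. by move=> /divpK <- h; rewrite pevM h mulr0. Qed.

End Peval.

Lemma pev_morph (K : fieldType) (B C : comPzRingType) (s : {rmorphism K -> B})
    (t : {rmorphism K -> C}) (g : {rmorphism B -> C}) p b :
  (forall c, g (s c) = t c) -> g (pev s p b) = pev t p (g b).
Proof.
move=> e; rewrite /pev rmorph_sum; apply: eq_bigr => i _.
by rewrite rmorphM rmorphXn e.
Qed.

Lemma pev_horner (K L : fieldType) (s : {rmorphism K -> L}) p b :
  pev s p b = (map_poly s p).[b].
Proof.
rewrite horner_coef size_map_poly; apply: eq_bigr => i _.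
by rewrite coef_map.
Qed.

Lemma deriv_neq0 (K : fieldType) (p : {poly K}) :
  [pchar K] =i pred0 -> (1 < size p)%N -> p^`() != 0.
Proof.
move=> /pcharf0P c0 p1; apply/eqP => /polyP /(_ (size p).-2).
have e : (size p).-2.+1 = (size p).-1 by case: (size p) p1 => [|[]].
rewrite coef_deriv e coef0 -mulr_natr => /eqP; rewrite mulf_eq0 c0.
rewrite -/(lead_coef p) lead_coef_eq0 -size_poly_eq0.
by case: (size p) p1 => [|[]].
Qed.

Section FieldFrames.
Variables (K : fieldType) (B : comPzRingType) (s : {rmorphism K -> B}) (n : nat).
Variables (y w : 'I_n -> B) (tr : B -> K).
Hypothesis F : etale_frame s y w tr.

Let htr : linear_form s tr. Proof. by case: F. Qed.
Let hy b : b = \sum_i s (tr (b * w i)) * y i. Proof. by case: F. Qed.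
Let h1 : \sum_i y i * w i = 1. Proof. by case: F. Qed.

(** The n+1 powers of b have n coordinates each, so they satisfy a linear relation. *)
Lemma frame_integral b : exists2 p : {poly K}, p != 0 & pev s p b = 0.
Proof.
pose V : 'M[K]_(n.+1, n) := \matrix_(i, j) tr (b ^+ i * w j).
have : ~~ row_free V.
  by rewrite /row_free neq_ltn ltnS rank_leq_col.
rewrite -kermx_eq0 => /rowV0Pn [v /sub_kermxP vV v0].
exists (rVpoly v).
  by apply: contra v0 => /eqP e; rewrite -(rVpolyK v) e linear0.
rewrite (@pev_wide _ _ s n.+1) ?size_poly // (hy (\sum_i _)) big1 // => j _.
rewrite mulr_suml (lform_sum htr) (_ : \sum_i _ = (v *m V) 0 j).
  by rewrite vV mxE rmorph0 mul0r.
rewrite mxE; apply: eq_bigr => i _; rewrite mxE -mulrA (lformZ htr).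
by rewrite coef_rVpoly_ord.
Qed.

Hypothesis red : forall b : B, b * b = 0 -> b = 0.

(** A polynomial q of least degree killing b divides all others. If q = c d^2, then c d kills b
    because B is reduced, so d is constant; thus q is squarefree, hence separable in characteristic
    0. *)
Lemma reduced_separable (char0 : [pchar K] =i pred0) b :
  exists q : {poly K}, [/\ q \is monic, (1 < size q)%N, separable_poly q
    & pev s q b = 0].
Proof.
have [p0 p0n p0b] := frame_integral b.
have [q [qn qb qmin]] : exists q : {poly K}, [/\ q != 0, pev s q b = 0 &
    forall p, pev s p b = 0 -> p != 0 -> (size q <= size p)%N].
  pose P m := `[<exists p : {poly K}, [/\ p != 0, pev s p b = 0 & size p = m]>].
  have exP : exists m, P m by exists (size p0); apply/asboolP; exists p0.
  case: (ex_minnP exP) => m /asboolP [q [qn qb sq]] min; exists q; split=> //.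
  by move=> p pb pn; rewrite sq; apply: min; apply/asboolP; exists p.
have dvd p : pev s p b = 0 -> q %| p.
  move=> pb; apply/modp_eq0P/eqP; apply: contraT => rn.
  have rb : pev s (p %% q) b = 0.
    have := pb; rewrite {1}(divp_eq p q) pevD pevM qb mulr0 add0r.
    by [].
  by have := qmin _ rb rn; rewrite leqNgt ltn_modp qn.
(* A nonzero constant kills b only in the zero ring, where X may be taken instead. *)
case: (ltnP 1 (size q)) => [q1|q1]; last first.
  have qc : q = (q`_0)%:P by apply: size1_polyC.
  have c0 : q`_0 != 0 by rewrite -polyC_eq0 -qc.
  have B0 : (1 : B) = 0.
    by rewrite -(rmorph1 s) -(mulVf c0) rmorphM -(pevC s (q`_0) b) -qc qb mulr0.
  exists 'X; split; rewrite ?monicX ?size_polyX //; last first.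
    by rewrite -[LHS]mul1r B0 mul0r.
  by rewrite unlock derivX coprimep1.
have lq : lead_coef q != 0 by rewrite lead_coef_eq0.
exists ((lead_coef q)^-1 *: q); split.
- by rewrite monicE lead_coefZ mulVf.
- by rewrite size_scale // invr_eq0.
- apply/separable_polyP; split=> [u v uv|u _ u1]; last first.
      exact: deriv_neq0.
  have {}uv : u * v %| q by rewrite (eqp_dvdr _ (eqp_scale _ _)) // in uv;
    rewrite invr_eq0.
  pose d := gcdp u v.
  have : d * d %| q by apply: dvdp_trans uv; apply: dvdp_mul;
    [apply: dvdp_gcdl|apply: dvdp_gcdr].
  case/dvdpP => c qc.
  have dc0 : c * d != 0.
    by apply: contra qn => /eqP e; rewrite qc mulrA e mul0r.
  have /dvd : pev s (c * d) b = 0.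
    by apply: red; rewrite -pevM -mulrA (mulrCA d) -qc pevM qb mulr0.
  rewrite qc mulrA -{2}[c * d]mulr1 dvdp_mul2l // dvdp1.
  by rewrite coprimep_def.
- by rewrite -mul_polyC pev_Cmul qb mulr0.
Qed.

End FieldFrames.

Section Support.
Variables (R B : comPzRingType) (s : {rmorphism R -> B}).

Definition frame_mx n (y w : 'I_n -> B) (tr : B -> R) (e : B) : 'M[R]_n :=
  \matrix_(i, j) tr (e * y i * w j).

                                                                             
                                        
(** For idempotent e, the determinant is 1 where multiplication by e vanishes on the fibre and 0
    elsewhere. So this is the idempotent of the image in Spec R of the open and closed subset e = 1
    of Spec B. *)
Definition idem_support n (y w : 'I_n -> B) (tr : B -> R) (e : B) : R :=
  1 - \det (1%:M - frame_mx y w tr e).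

(** Sylvester's identity, by eliminating either off-diagonal block of one block matrix. *)
Lemma det_1subM m n (M : 'M[R]_(m, n)) (N : 'M[R]_(n, m)) :
  \det (1%:M - M *m N) = \det (1%:M - N *m M).
Proof.
pose X := block_mx 1%:M M N 1%:M.
have <- : \det X = \det (1%:M - N *m M).
  have -> : \det X = \det (block_mx 1%:M 0 (- N) 1%:M *m X).
    by rewrite det_mulmx det_lblock !det1 !mul1r.
  rewrite mulmx_block !mul1mx !mul0mx !addr0 mulmx1 addNr det_ublock det1 mul1r.
  by rewrite mulNmx addrC.
have -> : \det X = \det (block_mx 1%:M (- M) 0 1%:M *m X).
  by rewrite det_mulmx det_ublock !det1 !mul1r.
rewrite mulmx_block !mul1mx !mul0mx !add0r !mulmx1 subrr det_lblock det1 mulr1.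
by rewrite mulNmx.
Qed.

Section OneFrame.
Variables (n : nat) (y w : 'I_n -> B) (tr : B -> R).
Hypothesis F : etale_frame s y w tr.

Let htr : linear_form s tr. Proof. by case: F. Qed.
Let hy b : b = \sum_i s (tr (b * w i)) * y i. Proof. by case: F. Qed.
Let h1 : \sum_i y i * w i = 1. Proof. by case: F. Qed.

Lemma frame_mxM e e' :
  frame_mx y w tr (e * e') = frame_mx y w tr e *m frame_mx y w tr e'.
Proof.
apply/matrixP => i j; rewrite !mxE.
rewrite (mulrAC e e') {1}(hy (e * y i)) !mulr_suml.
rewrite (lform_sum htr); apply: eq_bigr => k _; rewrite !mxE.
by rewrite -!mulrA (lformZ htr) (mulrCA (y k)) !mulrA.
Qed.

Lemma frame_mx_eq0 e : frame_mx y w tr e = 0 -> e = 0.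
Proof.
move=> h; rewrite -[e]mulr1 -h1 mulr_sumr big1 // => i _.
rewrite mulrA (hy (e * y i)) big1 ?mul0r // => j _.
by have := congr1 (fun M : 'M_n => M i j) h; rewrite !mxE => ->;
  rewrite rmorph0 mul0r.
Qed.

Lemma frame_mx0 : frame_mx y w tr 0 = 0.
Proof. by apply/matrixP => i j; rewrite !mxE !mul0r (lform0 htr). Qed.

Lemma support_idem e : e * e = e ->
  idem_support y w tr e * idem_support y w tr e = idem_support y w tr e.
Proof.
move=> ee; rewrite /idem_support; set M := frame_mx y w tr e.
have MM : M *m M = M by rewrite -frame_mxM ee.
set d := \det _; have dd : d * d = d.
  rewrite /d -det_mulmx; congr (\det _).
  by rewrite mulmxBl mul1mx mulmxBr mulmx1 MM subrr subr0.
by rewrite mulrBl mul1r mulrBr mulr1 dd subrr subr0.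
Qed.

Lemma support0 : idem_support y w tr 0 = 0.
Proof. by rewrite /idem_support frame_mx0 subr0 det1 subrr. Qed.

(** If det(1 - M) = 1 then 1 - M is invertible, whereas (1 - M) M = 0. *)
Lemma support_eq0 e : e * e = e -> idem_support y w tr e = 0 -> e = 0.
Proof.
move=> ee /eqP; rewrite subr_eq0 => /eqP d1.
apply: frame_mx_eq0; set M := frame_mx y w tr e in d1 *.
have MM : M *m M = M by rewrite -frame_mxM ee.
rewrite -[M]mul1mx -[1%:M]/(1%:M : 'M_n) d1 -mul_adj_mx -mulmxA mulmxBl mul1mx.
by rewrite MM subrr mulmx0.
Qed.

End OneFrame.

(** Writing e as e e and changing frames in between turns the two matrices of e into M N and N M, to
    which [det_1subM] applies. *)
Lemma support_uniq n m (y w : 'I_n -> B) (y' w' : 'I_m -> B) tr tr' e :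
  etale_frame s y w tr -> etale_frame s y' w' tr' -> e * e = e ->
  idem_support y w tr e = idem_support y' w' tr' e.
Proof.
move=> [htr hy h1] [htr' hy' h1'] ee; congr (1 - _).
pose M : 'M[R]_(n, m) := \matrix_(i, j) tr' (e * y i * w' j).
pose N : 'M[R]_(m, n) := \matrix_(i, j) tr (e * y' i * w j).
have -> : frame_mx y w tr e = M *m N.
  apply/matrixP => i j; rewrite !mxE -{1}ee.
  rewrite (mulrAC e e) {1}(hy' (e * y i)) !mulr_suml.
  rewrite (lform_sum htr); apply: eq_bigr => k _; rewrite !mxE -!mulrA.
  by rewrite (lformZ htr) (mulrCA (y' k)) !mulrA.
have -> : frame_mx y' w' tr' e = N *m M.
  apply/matrixP => i j; rewrite !mxE -{1}ee.
  rewrite (mulrAC e e) {1}(hy (e * y' i)) !mulr_suml.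
  rewrite (lform_sum htr'); apply: eq_bigr => k _; rewrite !mxE -!mulrA.
  by rewrite (lformZ htr') (mulrCA (y k)) !mulrA.
exact: det_1subM.
Qed.

End Support.

(** Here tr(b c) is the trace of a matrix M with M M = 0. A rank factorization M = C D gives D C =
    0, so the trace is 0; hence b is orthogonal to everything. *)
Lemma frame_reduced (K : fieldType) (B : comPzRingType) (s : {rmorphism K -> B}) :
  finite_etale s -> forall b : B, b * b = 0 -> b = 0.
Proof.
move=> /finite_etale_frame [n [y [w [tr F]]]] b bb.
have [htr hy h1] := F; apply: (frame_nondeg F) => c.
have -> : tr (b * c) = \tr (frame_mx y w tr (b * c)).
  rewrite -[b * c in LHS]mulr1 -h1 mulr_sumr (lform_sum htr).
  by apply: eq_bigr => i _; rewrite mxE mulrA.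
set M := frame_mx y w tr _.
have MM : M *m M = 0.
  by rewrite -(frame_mxM F) mulrACA bb mul0r (frame_mx0 F).
have [C [D [MCD [fC fD]]]] : exists C D, M = C *m D /\
    (forall p (Z : 'M_(_, p)), C *m Z = 0 -> Z = 0) /\
    (forall p (Z : 'M_(p, \rank M)), Z *m D = 0 -> Z = 0).
  exists (col_base M), (row_base M); split; first by rewrite mulmx_base.
  split=> p Z; last first.
    by move=> h; apply: (row_free_inj (row_base_free M)); rewrite h mul0mx.
  by move=> h; apply: (row_full_inj (col_base_full M)); rewrite h mulmx0.
move: MM; rewrite MCD -mulmxA => /fC; rewrite mulmxA => /fD DC.
by rewrite mxtrace_mulC DC mxtrace0.
Qed.

(** * Points of finite etale algebras; the algebras k[X]/q *)

Section Points.
Variables (W : closedFieldType) (B : comPzRingType) (s : {rmorphism W -> B}).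

Lemma pev_prod_XsubC (zs : seq W) b :
  pev s (\prod_(z <- zs) ('X - z%:P)) b = \prod_(z <- zs) (b - s z).
Proof.
elim: zs => [|z zs IH]; first by rewrite !big_nil pev1.
by rewrite !big_cons pevM IH pevD pevN pevX pevC.
Qed.

Lemma split_eigen (zs : seq W) b c : c != 0 ->
  (\prod_(z <- zs) (b - s z)) * c = 0 ->
  exists z d, d * c != 0 /\ b * (d * c) = s z * (d * c).
Proof.
move=> c0; elim: zs => [|z zs IH]; first by rewrite big_nil mul1r => /eqP /negPn;
  rewrite c0.
rewrite big_cons -mulrA; set d := \prod_(i <- zs) _ => h.
case: (eqVneq (d * c) 0) => [/IH //|dc0]; exists z, d; split=> //.
by apply/eqP; rewrite -subr_eq0 -mulrBl h.
Qed.

                                                                       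
                                                                 
(** A nonzero multiple c of a whose multiplication matrix has least rank generates a minimal ideal.
    Each b has an eigenvector in that ideal, so it acts on c by a scalar h(b). If h(a) were 0, then
    c c = 0, against reducedness. *)
Lemma nonzero_point a : finite_etale s -> a != 0 ->
  exists2 h : {rmorphism B -> W}, (forall c, h (s c) = c) & h a != 0.
Proof.
move=> et a0; have [n [y [w [tr F]]]] := (finite_etale_frame s).1 et.
have [htr hy h1] := F.
pose rk c := \rank (frame_mx y w tr c).
have [c [c0 [ca caE] cmin]] : exists c, [/\ c != 0, exists d, c = d * a &
    forall d, d * a != 0 -> (rk c <= rk (d * a)%R)%N].
  pose P m := `[<exists d, d * a != 0 /\ rk (d * a) = m>].
  have exP : exists m, P m.
    by exists (rk (1 * a)); apply/asboolP; exists 1; rewrite mul1r.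
  case: (ex_minnP exP) => m /asboolP [d [d0 rd]] min; exists (d * a).
  split=> //; first by exists d.
  by move=> x x0; rewrite rd; apply: min; apply/asboolP; exists x.
(* Minimality gives equal ranks, so the matrix of c factors through that of d c; applying the factor
   to the coordinates of 1 yields d'. *)
have gen d : d * c != 0 -> exists d', c = d' * (d * c).
  move=> dc0; have lerk : (rk c <= rk (d * c)%R)%N.
    by rewrite {2}caE mulrA; apply: cmin; rewrite -mulrA -caE.
  have sub : (frame_mx y w tr (d * c) <= frame_mx y w tr c)%MS.
    by rewrite (frame_mxM F) submxMl.
  have /submxP [D eD] : (frame_mx y w tr c <= frame_mx y w tr (d * c))%MS.
    by have := mxrank_leqif_sup sub => /geq_leqif <-.
  exists (\sum_i s (\sum_k tr (1 * w k) * D k i) * y i).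
  rewrite [LHS]hy [RHS]hy; apply: eq_bigr => j _; congr (s _ * _).
  have -> : c * w j = \sum_k s (tr (1 * w k)) * (c * y k * w j).
    rewrite -{1}[c]mulr1 {1}(hy 1) mulr_sumr mulr_suml; apply: eq_bigr => k _.
    by rewrite mulrCA !mulrA.
  rewrite (lform_sum htr) !mulr_suml (lform_sum htr).
  have E k : tr (c * y k * w j) = \sum_i D k i * tr (d * c * y i * w j).
    have := congr1 (fun M : 'M_n => M k j) eD; rewrite !mxE => ->.
    by apply: eq_bigr => i _; rewrite mxE.
  under eq_bigr => k _ do rewrite (lformZ htr) E mulr_sumr.
  rewrite exchange_big; apply: eq_bigr => i _.
  rewrite -!mulrA (lformZ htr) mulr_suml; apply: eq_bigr => k _.
  by rewrite mulrA (mulrCA (y i)) (mulrCA (y i)) -!mulrA.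
have ex b : exists z, b * c = s z * c.
  have [p p0 pb] := frame_integral F b.
  have [zs pE] := closed_field_poly_normal p.
  have [|z [d [dc0 bd]]] := @split_eigen zs b c c0.
    have l0 : lead_coef p != 0 by rewrite lead_coef_eq0.
    move: pb; rewrite pE -mul_polyC pev_Cmul pev_prod_XsubC => k.
    have -> : \prod_(z <- zs) (b - s z) = 0; last by rewrite mul0r.
    rewrite -[LHS]mul1r -{1}(rmorph1 s) -(mulVf l0) rmorphM.
    by rewrite -mulrA k mulr0.
  by have [d' cE] := gen d dc0; exists z; rewrite {1}cE mulrCA bd mulrCA -cE.
pose h0 b := projT1 (cid (ex b)).
have hP b : b * c = s (h0 b) * c by rewrite /h0; case: cid.
have inj z z' : s z * c = s z' * c -> z = z'.
  move=> e1; apply/eqP; rewrite -subr_eq0; apply: contraNT c0 => zz.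
  rewrite -[c]mul1r -(rmorph1 s) -(mulVf zz) rmorphM -mulrA rmorphB mulrBl e1.
  by rewrite subrr mulr0.
have [||h hE] := @rmorphism_of _ _ h0.
- by move=> x b; apply: inj; rewrite -hP rmorphB !mulrBl (hP x) (hP b).
- split; first by apply: inj; rewrite -hP rmorph1.
  move=> x b; apply: inj; rewrite -(hP (x * b)) -mulrA (hP b) mulrCA (hP x).
  by rewrite rmorphM mulrA (mulrC (s (h0 b))).
exists h => [b|]; first by rewrite hE; apply: inj; rewrite -hP.
apply: contra c0 => /eqP ha0; apply/eqP; apply: (frame_reduced et).
by rewrite {1}caE -mulrA (hP a) -hE ha0 rmorph0 mul0r mulr0.
Qed.

Lemma idem_point e : finite_etale s -> e * e = e -> e != 0 ->
  exists2 h : {rmorphism B -> W}, (forall a, h (s a) = a) & h e = 1.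
Proof.
move=> et ee /(nonzero_point et) [h hs he]; exists h => //.
by apply: (mulfI he); rewrite -rmorphM ee mulr1.
Qed.

End Points.

(** Finiteness for types without decidable equality; repetitions are allowed. *)
Definition listed (T : Type) := exists n (e : 'I_n -> T), forall t, exists i, e i = t.

Lemma listed_inj (T : Type) (F : finType) (g : T -> F) : injective g -> listed T.
Proof.
move=> gi; pose A := [set x | `[<exists t, g t = x>]].
have hA (i : 'I_#|A|) : exists t, g t = enum_val i.
  by have := enum_valP i; rewrite inE => /asboolP.
exists #|A|, (fun i => projT1 (cid (hA i))) => t.
have At : g t \in A by rewrite inE; apply/asboolP; exists t.
exists (enum_rank_in At (g t)); case: cid => t' /=.
by rewrite enum_rankK_in // => /gi.
Qed.

(** A point is determined by its values at the y_i, which are roots of nonzero polynomials killing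
    the y_i. The list L collects these roots. *)
Lemma frame_points (W : closedFieldType) (B : comPzRingType)
    (s : {rmorphism W -> B}) : finite_etale s ->
  exists n (y : 'I_n -> B) (L : seq W), forall g : {rmorphism B -> W},
    (forall a, g (s a) = a) -> (forall i, g (y i) \in L) /\
    (forall g' : {rmorphism B -> W}, (forall a, g' (s a) = a) ->
      (forall i, g (y i) = g' (y i)) -> g =1 g').
Proof.
move=> /finite_etale_frame [n [y [w [tr F]]]]; have [htr hy h1] := F.
have rt b : exists rs : seq W, forall g : {rmorphism B -> W},
    (forall a, g (s a) = a) -> g b \in rs.
  have [p p0 pb] := frame_integral F b.
  have [rs pE] := closed_field_poly_normal p; exists rs => g gs.
  have : pev (idfun : {rmorphism W -> W}) p (g b) = 0.
    by rewrite -(pev_morph (t := (idfun : {rmorphism W -> W})) p b gs) pb rmorph0.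
  rewrite pE -mul_polyC pev_Cmul pev_prod_XsubC => /eqP.
  rewrite mulf_eq0 lead_coef_eq0 (negPf p0) /= prodf_seq_eq0 => /hasP [z zr /=].
  by rewrite subr_eq0 => /eqP ->.
exists n, y, (flatten [seq projT1 (cid (rt (y i))) | i <- enum 'I_n]) => g gs.
split=> [i|g' g's e b].
  apply/flatten_mapP; exists i; rewrite ?mem_enum //.
  by case: cid => rs /=; apply.
rewrite (hy b) !rmorph_sum; apply: eq_bigr => i _.
by rewrite !rmorphM gs g's e.
Qed.

Section PolyQuotient.
Variables (K : fieldType) (q : {poly K}).
Hypotheses (qm : q \is monic) (q1 : (1 < size q)%N).

Notation B := {poly %/ q}.
Notation s := (qpolyC q : {rmorphism K -> B}).
Notation inq := (in_qpoly q : {rmorphism {poly K} -> B}).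

Let mkq : mk_monic q = q. Proof. by rewrite /mk_monic q1 qm. Qed.

Lemma val_in_qpoly p : in_qpoly q p = p %% q :> {poly K}.
Proof. by rewrite /= mkq Pdiv.IdomainMonic.modpE. Qed.

Lemma in_qpoly_val (b : B) : inq b = b.
Proof.
by apply: val_inj; rewrite /= Pdiv.CommonRing.rmodp_small ?size_mk_monic.
Qed.

Lemma in_qpoly_eq p p' : q %| p - p' -> inq p = inq p'.
Proof.
move=> d; apply: val_inj; rewrite /= !mkq -!Pdiv.IdomainMonic.modpE //.
by apply/eqP; rewrite -subr_eq0 -modpN -modpD modp_eq0.
Qed.

Lemma in_qpolyC c : inq c%:P = s c.
Proof.
apply: val_inj; rewrite /= mkq -Pdiv.IdomainMonic.modpE // modp_small //.
exact: leq_ltn_trans (size_polyC_leq1 c) q1.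
Qed.

Lemma pev_in_qpoly p : pev s p (inq 'X) = inq p.
Proof.
elim/poly_ind: p => [|p c IH]; first by rewrite pev0 rmorph0.
by rewrite pevD pev_mulX pevC IH rmorphD rmorphM in_qpolyC.
Qed.

Lemma pev_qpolyX : pev s q (inq 'X) = 0.
Proof.
rewrite pev_in_qpoly -[RHS](rmorph0 inq); apply: in_qpoly_eq.
by rewrite subr0.
Qed.

Lemma qpoly_lift (C : comPzRingType) (t : {rmorphism K -> C}) c :
  pev t q c = 0 -> exists h : {rmorphism B -> C},
    (forall a, h (s a) = t a) /\ h (inq 'X) = c.
Proof.
move=> qc; pose h0 (b : B) := pev t b c.
have hE p : h0 (inq p) = pev t p c.
  rewrite /h0 val_in_qpoly {2}(divp_eq p q) pevD pevM qc mulr0 add0r.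
  by [].
have [||h hh] := @rmorphism_of _ _ h0.
- move=> a b; rewrite -(in_qpoly_val a) -(in_qpoly_val b) -rmorphB !hE.
  by rewrite pevD pevN.
- split; first by rewrite -(rmorph1 inq) hE pev1.
  by move=> a b; rewrite -(in_qpoly_val a) -(in_qpoly_val b) -rmorphM !hE pevM.
exists h; split=> [a|]; first by rewrite hh -in_qpolyC hE pevC.
by rewrite hh hE pevX.
Qed.

Let n := (size q).-1.
Let sq : size q = n.+1. Proof. by rewrite /n; case: (size q) q1. Qed.

Lemma size_qpoly (b : B) : (size (b : {poly K}) < size q)%N.
Proof. by apply: (leq_trans (size_mk_monic b)); rewrite mkq. Qed.

Let lam (b : B) : K := (b : {poly K})`_n.-1.

Lemma qpoly_lam_form : linear_form s lam.
Proof.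
move=> r b c; rewrite /lam -in_qpolyC -{1}(in_qpoly_val b) -{1}(in_qpoly_val c).
rewrite -rmorphM -rmorphD val_in_qpoly modpD mul_polyC modpZl.
rewrite !modp_small ?coefD ?coefZ //.
  exact: size_qpoly.
exact: size_qpoly.
Qed.

(** The tails of q are dual to the powers of X for the coefficient form [lam]. When k > i, the
    multiple of the tail is congruent modulo q to minus a multiple of the complementary head, whose
    degree is too small to reach n-1. *)
Lemma qpoly_lam_delta (k i : 'I_n) :
  lam (inq ('X^k * drop_poly i.+1 q)) = (k == i)%:R.
Proof.
have lt_in := ltn_ord i; have lt_kn := ltn_ord k.
have n0 : (0 < n)%N by apply: leq_ltn_trans lt_in.
have le_kn : (k <= n.-1)%N by rewrite -ltnS prednK.
rewrite /lam; case: (leqP k i) => [le_ki|lt_ik].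
  rewrite val_in_qpoly modp_small; last first.
    have [->|d0] := eqVneq (drop_poly i.+1 q) 0.
      by rewrite mulr0 size_poly0 sq.
    rewrite size_monicM ?monicXn // size_polyXn size_drop_poly sq.
    rewrite subSS addSn /=.
    by rewrite ltnS -[X in (_ <= X)%N](subnKC (ltnW lt_in)) leq_add2r.
  rewrite coefXnM ltnNge le_kn /= coef_drop_poly.
  case: (eqVneq k i) => [ki|ne_ki].
    have -> : (n.-1 - k + i.+1)%N = n by rewrite addnS -ki subnK // prednK.
    by have /monicP := qm; rewrite /lead_coef sq.
  have lt_ki : (k < i)%N by rewrite ltn_neqAle le_ki andbT; exact: ne_ki.
  rewrite nth_default // sq addnS ltnS -[X in (X <= _)%N](prednK n0).
  by rewrite -{1}(subnK le_kn) -addnS leq_add2l.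
have -> : k = (k - i.+1 + i.+1)%N :> nat by rewrite subnK.
have -> : inq ('X^(k - i.+1 + i.+1) * drop_poly i.+1 q) =
    inq (- ('X^(k - i.+1) * take_poly i.+1 q)).
  apply: in_qpoly_eq; rewrite opprK exprD -mulrA -mulrDr (mulrC 'X^(i.+1)).
  by rewrite addrC poly_take_drop dvdp_mull.
have le_s : (size ('X^(k - i.+1) * take_poly i.+1 q)%R <= k)%N.
  have [->|d0] := eqVneq (take_poly i.+1 q) 0.
    by rewrite mulr0 size_poly0.
  rewrite size_monicM ?monicXn // size_polyXn addSn /=.
  by rewrite -[X in (_ <= X)%N](subnK lt_ik) leq_add2l size_take_poly.
rewrite val_in_qpoly modp_small ?size_polyN; last first.
  by rewrite sq ltnS (leq_trans le_s) // ltnW.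
rewrite nth_default ?size_polyN; last first.
  by rewrite (leq_trans le_s).
by case: eqP lt_ik => // ->; rewrite ltnn.
Qed.

Lemma qpoly_euler : \sum_(i < n) 'X^i * drop_poly i.+1 q = q^`().
Proof.
apply/polyP => m; rewrite coef_sum coef_deriv.
rewrite (eq_bigr (fun i : 'I_n => if (i < m.+1)%N then q`_m.+1 else 0)).
  rewrite -big_mkcond /=; case: (ltnP m n) => lt_mn.
    rewrite -(big_ord_widen n (fun=> q`_m.+1) lt_mn) sumr_const card_ord.
    by [].
  rewrite nth_default ?sq // big1 ?mul0rn //.
move=> i _; rewrite coefXnM ltnS (leqNgt i m).
by case: ltnP => //= le_im; rewrite coef_drop_poly addnS subnK.
Qed.

                                                                        
                                                           
(** Euler's formula: the trace is c |-> lam(q' c), and the basis dual to the powers of X consists of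
    the tails of q divided by q', which is invertible modulo q. *)
Lemma qpoly_etale : coprimep q q^`() -> finite_etale s.
Proof.
move=> /Bezout_eq1_coprimepP [[u v] /= uv].
have vq : inq v * inq q^`() = 1.
  rewrite -rmorphM -(rmorph1 inq); apply: in_qpoly_eq.
  by rewrite -uv opprD addrCA subrr addr0 dvdpNr dvdp_mull.
set D := inq q^`() in vq; pose b (i : 'I_n) := inq (drop_poly i.+1 q).
apply/finite_etale_frame.
exists n, (fun i => inq 'X^i), (fun i => inq v * b i), (fun c => lam (D * c)).
have hl := qpoly_lam_form.
split=> [r c d|c|].
- by rewrite mulrDr mulrCA hl.
- have cE : c = \sum_(k < n) s (c : {poly K})`_k * inq 'X^k.
    have {1}-> : c = inq (\poly_(k < n) (c : {poly K})`_k).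
      rewrite -{1}(in_qpoly_val c); congr (inq _); apply/polyP => k.
      rewrite coef_poly; case: ltnP => // nk; rewrite nth_default //.
      by have := size_qpoly c; rewrite sq ltnS => /leq_trans; apply.
    rewrite poly_def rmorph_sum; apply: eq_bigr => k _.
    by rewrite -mul_polyC rmorphM in_qpolyC.
  rewrite {1}cE; apply: eq_bigr => i _; congr (s _ * _).
  rewrite (mulrCA c) (mulrA D) (mulrC D) vq mul1r {2}cE mulr_suml (lform_sum hl).
  rewrite (bigD1 i) //= -mulrA (lformZ hl) -rmorphM qpoly_lam_delta eqxx mulr1.
  rewrite big1 ?addr0 // => k ne_ki.
  by rewrite -mulrA (lformZ hl) -rmorphM qpoly_lam_delta (negPf ne_ki) mulr0.
under eq_bigr => i _ do rewrite mulrCA.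
rewrite -mulr_sumr -[RHS]vq; congr (_ * _); rewrite /D -qpoly_euler rmorph_sum.
by apply: eq_bigr => i _; rewrite rmorphM.
Qed.

End PolyQuotient.

                                      

(** * Covers: tensor products, covers defined by a polynomial, global sections *)

Section CoverConstructions.
Variables (K : fieldType) (Y : site K).

Lemma idfun_etale (R : comPzRingType) : finite_etale (idfun : {rmorphism R -> R}).
Proof.
apply/finite_etale_frame; exists 1%N, (fun=> 1), (fun=> 1), idfun.
split=> [r b c //|b|]; rewrite big_ord1 mulr1 //=.
by rewrite mulr1.
Qed.

Lemma idfun_pushout (R R' : comPzRingType) (u : {rmorphism R -> R'}) :
  is_pushout u idfun idfun u.
Proof.
split=> // C f g e; exists f; split=> [|h [h1 h2]].
  by split=> // b /=; rewrite e.
by apply: rmorphism_ext => b; have /= -> := h1 b.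
Qed.

Definition cover_triv : etale_cover Y :=
  @EtaleCover K Y (fun R e x => R) (fun R e x => idfun)
    (fun R e x => idfun_etale R) (fun R R' e e' u x x' a => u)
    (fun R e u x a h => h) (fun R R' R'' e e' e'' u u' u'' x x' x'' a a' a'' h => h)
    (fun R R' e e' u x x' a => idfun_pushout u).

Section Tensor.
Variables E F : etale_cover Y.

Definition ct_alg (R : comPzRingType) (e : {rmorphism K -> R}) (x : spt Y e) :
  comPzRingType := tens (cstr E x) (cstr F x).

Definition ct_inl (R : comPzRingType) (e : {rmorphism K -> R}) (x : spt Y e) :
  {rmorphism calg E x -> ct_alg x} := tinA (cstr E x) (cstr F x).

Definition ct_inr (R : comPzRingType) (e : {rmorphism K -> R}) (x : spt Y e) :
  {rmorphism calg F x -> ct_alg x} := tinB (cstr E x) (cstr F x).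

Definition ct_str (R : comPzRingType) (e : {rmorphism K -> R}) (x : spt Y e) :
  {rmorphism R -> ct_alg x} := ct_inl x \o cstr E x.

Lemma ct_po (R : comPzRingType) (e : {rmorphism K -> R}) (x : spt Y e) :
  is_pushout (cstr E x) (cstr F x) (ct_inl x) (ct_inr x).
Proof. exact: tens_pushout (etale_locally_projective (cet F x)). Qed.

Lemma ct_bal (R : comPzRingType) (e : {rmorphism K -> R}) (x : spt Y e) r :
  ct_inr x (cstr F x r) = ct_str x r.
Proof. exact: tens_bal. Qed.

Lemma ct_et (R : comPzRingType) (e : {rmorphism K -> R}) (x : spt Y e) :
  finite_etale (ct_str x).
Proof.
exact: frame_comp (cet E x) (finite_etale_pushout (ct_po x) (cet F x)).
Qed.

Section Map.
Variables (R R' : comPzRingType) (e : {rmorphism K -> R})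
  (e' : {rmorphism K -> R'}) (u : {rmorphism R -> R'}) (x : spt Y e)
  (x' : spt Y e') (a : arrow u x x').

Lemma ct_map_ex : exists h : {rmorphism ct_alg x -> ct_alg x'},
  (forall b, h (ct_inl x b) = ct_inl x' (cmap E a b)) /\
  (forall b, h (ct_inr x b) = ct_inr x' (cmap F a b)).
Proof.
apply: (@pushout_hom _ _ _ _ _ _ _ _ (ct_po x) _ (ct_inl x' \o cmap E a)
  (ct_inr x' \o cmap F a)) => r /=.
by rewrite (cmap_push E a).1 (cmap_push F a).1 ct_bal.
Qed.

Definition ct_map := projT1 (cid ct_map_ex).

Lemma ct_mapl b : ct_map (ct_inl x b) = ct_inl x' (cmap E a b).
Proof. by rewrite /ct_map; case: cid => h []. Qed.

Lemma ct_mapr b : ct_map (ct_inr x b) = ct_inr x' (cmap F a b).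
Proof. by rewrite /ct_map; case: cid => h []. Qed.

Lemma ct_push : is_pushout u (ct_str x) (ct_str x') ct_map.
Proof.
split=> [r|C f g fg]; first by rewrite /= ct_mapl (cmap_push E a).1.
have [hE [hE1 hE2]] := pushout_hom (cmap_push E a) (f := f) (g := g \o ct_inl x) fg.
have [|hF [hF1 hF2]] := pushout_hom (cmap_push F a) (f := f) (g := g \o ct_inr x).
  by move=> r /=; rewrite ct_bal fg.
have [|h [h1 h2]] := pushout_hom (ct_po x') (f := hE) (g := hF).
  by move=> r; rewrite hE1 hF1.
exists h; split=> [|k [k1 k2]].
  split=> [r|]; first by rewrite /= h1 hE1.
  apply: (pushout_eq (ct_po x) (h := h \o ct_map) (h' := g)) => b /=.
    by rewrite ct_mapl h1 hE2.
  by rewrite ct_mapr h2 hF2.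
apply: rmorphism_ext; apply: (pushout_eq (ct_po x')) => b.
  rewrite h1; apply: (pushout_eq (cmap_push E a) (h := hE) (h' := k \o ct_inl x')) => [r|c].
    by rewrite hE1; have /= -> := k1 r.
  by rewrite hE2 /= -ct_mapl; have /= -> := k2 (ct_inl x c).
rewrite h2; apply: (pushout_eq (cmap_push F a) (h := hF) (h' := k \o ct_inr x')) => [r|c].
  by rewrite hF1 /= ct_bal; have /= -> := k1 r.
by rewrite hF2 /= -ct_mapr; have /= -> := k2 (ct_inr x c).
Qed.

End Map.

Lemma ct_map_id (R : comPzRingType) (e : {rmorphism K -> R})
  (u : {rmorphism R -> R}) (x : spt Y e) (a : arrow u x x) :
  u =1 id -> ct_map a =1 id.
Proof.
move=> hu; apply: (pushout_eq (ct_po x) (h := ct_map a) (h' := idfun)) => b /=.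
  by rewrite ct_mapl cmap_id.
by rewrite ct_mapr cmap_id.
Qed.

Lemma ct_map_comp (R R' R'' : comPzRingType) (e : {rmorphism K -> R})
    (e' : {rmorphism K -> R'}) (e'' : {rmorphism K -> R''})
    (u : {rmorphism R -> R'}) (u' : {rmorphism R' -> R''})
    (u'' : {rmorphism R -> R''}) (x : spt Y e) (x' : spt Y e')
    (x'' : spt Y e'') (a : arrow u x x') (a' : arrow u' x' x'')
    (a'' : arrow u'' x x'') :
    u'' =1 u' \o u -> ct_map a'' =1 ct_map a' \o ct_map a.
Proof.
move=> hu; apply: (pushout_eq (ct_po x) (h := ct_map a'')
  (h' := ct_map a' \o ct_map a)) => b /=.
  by rewrite !ct_mapl (cmap_comp a a' a'').
by rewrite !ct_mapr (cmap_comp a a' a'').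
Qed.

Definition cover_tens : etale_cover Y :=
  EtaleCover ct_et ct_map_id ct_map_comp ct_push.

Definition tens_inl : cover_map E cover_tens :=
  @CoverMap K Y E cover_tens ct_inl (fun R e x r => erefl)
    (fun R R' e e' u x x' a b => esym (ct_mapl a b)).

Definition tens_inr : cover_map F cover_tens :=
  @CoverMap K Y F cover_tens ct_inr (fun R e x r => ct_bal x r)
    (fun R R' e e' u x x' a b => esym (ct_mapr a b)).

End Tensor.

Section PolyCover.
Variable q : {poly K}.

Definition etale_poly := [/\ q \is monic, (1 < size q)%N & coprimep q q^`()].
Hypothesis hq : etale_poly.

Let sq : {rmorphism K -> {poly %/ q}} := qpolyC q.

Definition cp_alg (R : comPzRingType) (e : {rmorphism K -> R}) (x : spt Y e) :
  comPzRingType := tens e sq.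
Definition cp_str (R : comPzRingType) (e : {rmorphism K -> R}) (x : spt Y e) :
  {rmorphism R -> cp_alg x} := tinA e sq.
Definition cp_in (R : comPzRingType) (e : {rmorphism K -> R}) (x : spt Y e) :
  {rmorphism {poly %/ q} -> cp_alg x} := tinB e sq.

Lemma sq_et : finite_etale sq.
Proof. by case: hq => *; apply: qpoly_etale. Qed.

Lemma cp_po (R : comPzRingType) (e : {rmorphism K -> R}) (x : spt Y e) :
  is_pushout e sq (cp_str x) (cp_in x).
Proof. exact: tens_pushout (etale_locally_projective sq_et). Qed.

Lemma cp_et (R : comPzRingType) (e : {rmorphism K -> R}) (x : spt Y e) :
  finite_etale (cp_str x).
Proof. exact: finite_etale_pushout (cp_po x) sq_et. Qed.

Section Map.
Variables (R R' : comPzRingType) (e : {rmorphism K -> R})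
  (e' : {rmorphism K -> R'}) (u : {rmorphism R -> R'}) (x : spt Y e)
  (x' : spt Y e') (a : arrow u x x').

Lemma cp_map_ex : exists h : {rmorphism cp_alg x -> cp_alg x'},
  (forall b, h (cp_str x b) = cp_str x' (u b)) /\
  (forall b, h (cp_in x b) = cp_in x' b).
Proof.
apply: (@pushout_hom _ _ _ _ _ _ _ _ (cp_po x) _ (cp_str x' \o u) (cp_in x')).
by move=> r /=; rewrite a.1 (cp_po x').1.
Qed.

Definition cp_map := projT1 (cid cp_map_ex).

Lemma cp_map_str b : cp_map (cp_str x b) = cp_str x' (u b).
Proof. by rewrite /cp_map; case: cid => h []. Qed.

Lemma cp_map_in b : cp_map (cp_in x b) = cp_in x' b.
Proof. by rewrite /cp_map; case: cid => h []. Qed.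

Lemma cp_push : is_pushout u (cp_str x) (cp_str x') cp_map.
Proof.
apply: (pushout_cancel _ _ _ (cp_po x) (cp_po x')) => r.
- by rewrite /= a.1.
- by rewrite /= cp_map_in.
- by rewrite cp_map_str.
Qed.

End Map.

Lemma cp_map_id (R : comPzRingType) (e : {rmorphism K -> R})
  (u : {rmorphism R -> R}) (x : spt Y e) (a : arrow u x x) :
  u =1 id -> cp_map a =1 id.
Proof.
move=> hu; apply: (pushout_eq (cp_po x) (h := cp_map a) (h' := idfun)) => b /=.
  by rewrite cp_map_str hu.
by rewrite cp_map_in.
Qed.

Lemma cp_map_comp (R R' R'' : comPzRingType) (e : {rmorphism K -> R})
    (e' : {rmorphism K -> R'}) (e'' : {rmorphism K -> R''})
    (u : {rmorphism R -> R'}) (u' : {rmorphism R' -> R''})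
    (u'' : {rmorphism R -> R''}) (x : spt Y e) (x' : spt Y e')
    (x'' : spt Y e'') (a : arrow u x x') (a' : arrow u' x' x'')
    (a'' : arrow u'' x x'') :
    u'' =1 u' \o u -> cp_map a'' =1 cp_map a' \o cp_map a.
Proof.
move=> hu; apply: (pushout_eq (cp_po x) (h := cp_map a'')
  (h' := cp_map a' \o cp_map a)) => b /=.
  by rewrite !cp_map_str hu.
by rewrite !cp_map_in.
Qed.

Definition cover_poly : etale_cover Y :=
  EtaleCover cp_et cp_map_id cp_map_comp cp_push.

End PolyCover.

Section Sections.
Variable F : etale_cover Y.

(** Global sections of F. Idempotent ones cut out open and closed parts of the cover, and those
    killed by an etale polynomial q are the maps out of [cover_poly] ([poly_map]). *)
Record nsection := NSection {
  nval : forall (R : comPzRingType) (e : {rmorphism K -> R}) (x : spt Y e),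
    calg F x;
  nval_nat : forall (R R' : comPzRingType) (e : {rmorphism K -> R})
    (e' : {rmorphism K -> R'}) (u : {rmorphism R -> R'}) (x : spt Y e)
    (x' : spt Y e') (a : arrow u x x'), cmap F a (nval x) = nval x' }.

Definition kstr (R : comPzRingType) (e : {rmorphism K -> R}) (x : spt Y e) :
  {rmorphism K -> calg F x} := cstr F x \o e.

End Sections.

Definition gen_val q (hq : etale_poly q) (R : comPzRingType)
    (e : {rmorphism K -> R}) (x : spt Y e) : calg (cover_poly hq) x :=
  cp_in q x (in_qpoly q 'X).

Lemma gen_nat q (hq : etale_poly q) (R R' : comPzRingType)
    (e : {rmorphism K -> R}) (e' : {rmorphism K -> R'}) (u : {rmorphism R -> R'})
    (x : spt Y e) (x' : spt Y e') (a : arrow u x x') :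
  cmap (cover_poly hq) a (gen_val hq x) = gen_val hq x'.
Proof. exact: cp_map_in. Qed.

Definition gen q (hq : etale_poly q) := NSection (gen_nat hq).

Lemma gen_root q (hq : etale_poly q) (R : comPzRingType)
    (e : {rmorphism K -> R}) (x : spt Y e) :
  pev (kstr (cover_poly hq) x) q (gen_val hq x) = 0.
Proof.
have [qm q1 _] := hq.
rewrite -(pev_morph (s := qpolyC q : {rmorphism K -> {poly %/ q}})
  (t := kstr (cover_poly hq) x) (g := cp_in q x)).
  by rewrite pev_qpolyX // rmorph0.
by move=> c; apply: (cp_po hq x).1.
Qed.

Lemma cp_lift q (hq : etale_poly q) (R : comPzRingType)
    (e : {rmorphism K -> R}) (x : spt Y e) (C : comPzRingType)
    (f : {rmorphism R -> C}) c : pev (f \o e) q c = 0 ->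
  exists h : {rmorphism calg (cover_poly hq) x -> C},
    (forall r, h (cstr (cover_poly hq) x r) = f r) /\ h (gen_val hq x) = c.
Proof.
have [qm q1 _] := hq => qc.
have [g [g1 g2]] := qpoly_lift qm q1 qc.
have [h [h1 h2]] := pushout_hom (cp_po hq x) (f := f) (g := g) (fun r => esym (g1 r)).
by exists h; split=> //; rewrite h2.
Qed.

Lemma cp_ext q (hq : etale_poly q) (R : comPzRingType)
    (e : {rmorphism K -> R}) (x : spt Y e) (C : comPzRingType)
    (h h' : {rmorphism calg (cover_poly hq) x -> C}) :
  (forall r, h (cstr (cover_poly hq) x r) = h' (cstr (cover_poly hq) x r)) ->
  h (gen_val hq x) = h' (gen_val hq x) -> h =1 h'.
Proof.
have [qm q1 _] := hq => e1 e2; apply: (pushout_eq (cp_po hq x)) => // b.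
have key (k : {rmorphism cp_alg q x -> C}) : k (cp_in q x b) =
    pev (k \o cp_str q x \o e) (b : {poly K}) (k (gen_val hq x)).
  rewrite -{1}(in_qpoly_val b) -(pev_in_qpoly qm q1).
  rewrite -(pev_morph (s := qpolyC q : {rmorphism K -> {poly %/ q}})
    (t := k \o cp_str q x \o e) (g := k \o cp_in q x)) // => c.
  by rewrite /= (cp_po hq x).1.
rewrite !key e2 /pev; apply: eq_bigr => i _; congr (_ * _) => /=.
exact: e1.
Qed.

Section PolyMap.
Variables (q : {poly K}) (hq : etale_poly q) (F : etale_cover Y) (v : nsection F).
Hypothesis hv : forall (R : comPzRingType) (e : {rmorphism K -> R}) (x : spt Y e),
  pev (kstr F x) q (nval v x) = 0.

Definition poly_map_fun (R : comPzRingType) (e : {rmorphism K -> R})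
    (x : spt Y e) := projT1 (cid (@cp_lift q hq R e x _ (cstr F x) _ (hv x))).

Lemma poly_map_str (R : comPzRingType) (e : {rmorphism K -> R}) (x : spt Y e) r :
  poly_map_fun x (cstr (cover_poly hq) x r) = cstr F x r.
Proof. by rewrite /poly_map_fun; case: cid => h []. Qed.

Lemma poly_map_gen (R : comPzRingType) (e : {rmorphism K -> R}) (x : spt Y e) :
  poly_map_fun x (gen_val hq x) = nval v x.
Proof. by rewrite /poly_map_fun; case: cid => h []. Qed.

Lemma poly_map_nat (R R' : comPzRingType) (e : {rmorphism K -> R})
    (e' : {rmorphism K -> R'}) (u : {rmorphism R -> R'}) (x : spt Y e)
    (x' : spt Y e') (a : arrow u x x') b :
  poly_map_fun x' (cmap (cover_poly hq) a b) = cmap F a (poly_map_fun x b).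
Proof.
apply: (cp_ext (h := poly_map_fun x' \o cmap (cover_poly hq) a)
  (h' := cmap F a \o poly_map_fun x)) => [r|] /=.
  rewrite (cmap_push (cover_poly hq) a).1 !poly_map_str.
  by rewrite (cmap_push F a).1.
by rewrite (gen_nat hq a) !poly_map_gen nval_nat.
Qed.

Definition poly_map : cover_map (cover_poly hq) F :=
  CoverMap poly_map_str poly_map_nat.

End PolyMap.

End CoverConstructions.

(** * Fibres, and the fundamental group as a profinite group *)

Section Fibers.
Variables (K : fieldType) (Y : site K) (W : closedFieldType).
Variables (w : {rmorphism K -> W}) (y : spt Y w).

Lemma fiber_listed (E : etale_cover Y) : listed (fiber y E).
Proof.
have [n [b [L hL]]] := frame_points (cet E y).
pose g (h : fiber y E) : {ffun 'I_n -> 'I_(size L).+1} :=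
  [ffun i => inord (index (h (b i)) L)].
apply: (listed_inj (g := g)) => h h' e; apply: fiber_ext.
have [hm hu] := hL h (fibP h); apply: hu => [|i]; first exact: fibP.
have [h'm _] := hL h' (fibP h').
have /ffunP/(_ i) := e; rewrite !ffunE => /(congr1 val) /=.
rewrite !inordK ?ltnS ?index_size //.
by move=> ei; rewrite -(nth_index 0 (hm i)) ei nth_index.
Qed.

Definition fiber_triv : fiber y (cover_triv Y) := @Fiber _ _ _ _ y (cover_triv Y) idfun (frefl _).

Lemma fiber_triv_uniq h : h = fiber_triv.
Proof. by apply: fiber_ext => r; apply: (fibP h r). Qed.

Section FiberTensor.
Variables (E F : etale_cover Y) (h : fiber y E) (k : fiber y F).

Lemma fiber_tens_ex : exists t : fiber y (cover_tens E F),
  fiber_map (tens_inl E F) t = h /\ fiber_map (tens_inr E F) t = k.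
Proof.
have [|t [t1 t2]] := pushout_hom (ct_po E F y) (f := h) (g := k).
  by move=> r; rewrite !fibP.
have ts r : t (cstr (cover_tens E F) y r) = r by rewrite /= t1 fibP.
by exists (Fiber ts); split; apply: fiber_ext.
Qed.

Definition fiber_tens := projT1 (cid fiber_tens_ex).

Lemma fiber_tens_inl : fiber_map (tens_inl E F) fiber_tens = h.
Proof. by rewrite /fiber_tens; case: cid => t []. Qed.
Lemma fiber_tens_inr : fiber_map (tens_inr E F) fiber_tens = k.
Proof. by rewrite /fiber_tens; case: cid => t []. Qed.

End FiberTensor.

Lemma fiber_tens_eta (E F : etale_cover Y) (t : fiber y (cover_tens E F)) :
  t = fiber_tens (fiber_map (tens_inl E F) t) (fiber_map (tens_inr E F) t).
Proof.
set t' := fiber_tens _ _.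
have e1 := fiber_tens_inl (fiber_map (tens_inl E F) t) (fiber_map (tens_inr E F) t).
have e2 := fiber_tens_inr (fiber_map (tens_inl E F) t) (fiber_map (tens_inr E F) t).
apply: fiber_ext; apply: (pushout_eq (ct_po E F y)) => b.
  by have := congr1 (fun h : fiber y E => h b) e1 => /= <-.
by have := congr1 (fun h : fiber y F => h b) e2 => /= <-.
Qed.

Lemma aut_tens (g : pi1 y) E F (h : fiber y E) (k : fiber y F) :
  aut_act g (fiber_tens h k) = fiber_tens (aut_act g h) (aut_act g k).
Proof.
by rewrite [LHS]fiber_tens_eta -!aut_act_nat fiber_tens_inl fiber_tens_inr.
Qed.

Section FiberPoly.
Variables (q : {poly K}) (hq : etale_poly q) (a : W).
Hypothesis qa : pev w q a = 0.

Lemma fiber_poly_ex : exists h : fiber y (cover_poly Y hq), h (gen_val hq y) = a.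
Proof.
have [|h [h1 h2]] := @cp_lift _ _ q hq W w y W idfun a.
  by rewrite -[RHS]qa; apply: eq_bigr.
by exists (Fiber h1).
Qed.

Definition fiber_poly := projT1 (cid fiber_poly_ex).
Lemma fiber_polyE : fiber_poly (gen_val hq y) = a.
Proof. by rewrite /fiber_poly; case: cid. Qed.

End FiberPoly.

Lemma fiber_pev (F : etale_cover Y) (h : fiber y F) q b :
  pev w q (h b) = h (pev (kstr F y) q b).
Proof. by apply/esym/pev_morph => c /=; rewrite fibP. Qed.

Lemma fiber_poly_ext q (hq : etale_poly q) (h h' : fiber y (cover_poly Y hq)) :
  h (gen_val hq y) = h' (gen_val hq y) -> h = h'.
Proof.
by move=> e; apply: fiber_ext; apply: cp_ext => // r; rewrite !fibP.
Qed.

Lemma fiber_poly_root q (hq : etale_poly q) (h : fiber y (cover_poly Y hq)) :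
  pev w q (h (gen_val hq y)) = 0.
Proof. by rewrite fiber_pev gen_root rmorph0. Qed.

Lemma const_nat (c : K) (R R' : comPzRingType) (e : {rmorphism K -> R})
    (e' : {rmorphism K -> R'}) (u : {rmorphism R -> R'}) (x : spt Y e)
    (x' : spt Y e') (a : arrow u x x') : cmap (cover_triv Y) a (e c) = e' c.
Proof. exact: a.1. Qed.

Definition const_section c : nsection (cover_triv Y) := NSection (const_nat c).

(** A root in K defines a map from [cover_poly] to the trivial cover, whose fibre has a single
    point; h is the image of that point. *)
Lemma aut_const (g : pi1 y) q (hq : etale_poly q) c (h : fiber y (cover_poly Y hq)) :
  root q c -> h (gen_val hq y) = w c -> aut_act g h = h.
Proof.
move=> qc hc.
have v0 (R : comPzRingType) (e : {rmorphism K -> R}) (x : spt Y e) :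
    pev (kstr (cover_triv Y) x) q (nval (const_section c) x) = 0.
  have -> : pev (kstr (cover_triv Y) x) q (e c) = e (pev (idfun : {rmorphism K -> K}) q c).
    by apply/esym/pev_morph.
  by rewrite pev_horner map_poly_id // (rootP qc) rmorph0.
have -> : h = fiber_map (poly_map hq v0) fiber_triv.
  by apply: fiber_poly_ext; rewrite hc /= (poly_map_gen hq v0).
by rewrite aut_act_nat; congr fiber_map; apply: fiber_triv_uniq.
Qed.

Lemma etale_idem : etale_poly ('X * ('X - 1) : {poly K}).
Proof.
split; first by rewrite rpredM ?monicX // -polyC1 monicXsubC.
  by rewrite mulrC -polyC1 size_monicM ?monicXsubC ?monicX ?polyX_eq0 //
    size_XsubC size_polyX.
rewrite derivM derivB derivX -polyC1 derivC subr0 polyC1 mul1r mulr1.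
apply/Bezout_coprimepP; exists (- 4%:R, 'X *+ 2 - 1) => /=.
have -> : - 4%:R * ('X * ('X - 1)) + ('X *+ 2 - 1) * ('X - 1 + 'X) = 1 :> {poly K}.
  by rewrite -[4%:R]/((2 * 2)%:R) natrM -mulr_natr; ring.
exact: eqpxx.
Qed.

Definition idem_section (F : etale_cover Y) (v : nsection F) :=
  forall (R : comPzRingType) (e : {rmorphism K -> R}) (x : spt Y e),
  nval v x * nval v x = nval v x.

(** An idempotent is a root of X (X - 1), hence a map out of the cover defined by this polynomial;
    its fibre consists of the rational roots 0 and 1, fixed by [aut_const]. *)
Lemma aut_idem (g : pi1 y) (F : etale_cover Y) (v : nsection F) (h : fiber y F) :
  idem_section v -> aut_act g h (nval v y) = h (nval v y).
Proof.
move=> vi; pose hq := etale_idem.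
have v0 (R : comPzRingType) (e : {rmorphism K -> R}) (x : spt Y e) :
    pev (kstr F x) ('X * ('X - 1)) (nval v x) = 0.
  by rewrite pevM pevD pevN pev1 pevX mulrBr mulr1 vi subrr.
rewrite -(poly_map_gen hq v0 y).
have -> : aut_act g h (poly_map_fun hq v0 y (gen_val hq y)) =
    fiber_map (poly_map hq v0) (aut_act g h) (gen_val hq y) by [].
rewrite -aut_act_nat.
set k := fiber_map _ h; have -> // : aut_act g k = k.
have : pev w ('X * ('X - 1)) (k (gen_val hq y)) = 0 by apply: fiber_poly_root.
rewrite pevM pevD pevN pev1 pevX => /eqP; rewrite mulf_eq0 subr_eq0.
case/orP => /eqP kE; [apply: (@aut_const g _ hq 0)|apply: (@aut_const g _ hq 1)];
  rewrite ?kE ?rmorph0 ?rmorph1 //; by rewrite rootE !hornerE ?subrr ?mulr0.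
Qed.

(** Limits along an ultrafilter are taken pointwise in the finite fibres, for automorphisms and
    their inverses alike. The subgroups acting trivially on finitely many fibres form the basis. *)
Lemma pi1_profinite : profinite (pi1 y).
Proof.
have openE n (E : 'I_n -> etale_cover Y) : exists2 V : normal_subgroup (pi1 y),
    topen V & forall g, V g <-> forall i, aut_act g (E := E i) =1 id.
  pose V (g : pi1 y) := forall i, aut_act g (E := E i) =1 id.
  have sV : is_subgroup V.
    split=> [i h //|g g' Vg Vg' i h|g Vg i h] /=; first by rewrite Vg' Vg.
    by rewrite -{1}(Vg i h) aut_actK.
  have nV g g' : V g -> V (g' * g * g'^-1)%tg.
    by move=> Vg i h /=; rewrite Vg aut_actVK.
  exists (NormalSubgroup sV nV) => // g Vg; exists n, E => g' e i h.
  by rewrite e Vg.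
split.
- move=> F uF.
  have lim E (h : fiber y E) : exists v, F (fun g : pi1 y => aut_act g h = v).
    have [n [e he]] := fiber_listed E; apply: (ultra_fin uF (e := e)).
    by apply: (ultraS uF _ (ultraT uF)) => g _; apply: he.
  have limV E (h : fiber y E) : exists v, F (fun g : pi1 y => aut_actV g h = v).
    have [n [e he]] := fiber_listed E; apply: (ultra_fin uF (e := e)).
    by apply: (ultraS uF _ (ultraT uF)) => g _; apply: he.
  pose a E (h : fiber y E) := projT1 (cid (lim E h)).
  pose b E (h : fiber y E) := projT1 (cid (limV E h)).
  have aP E h : F (fun g : pi1 y => aut_act g h = a E h) by rewrite /a; case: cid.
  have bP E h : F (fun g : pi1 y => aut_actV g h = b E h) by rewrite /b; case: cid.
  have aK E : cancel (a E) (b E).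
    move=> h; have [g [<- <-]] := ultra_ex uF (ultraI uF (bP E (a E h)) (aP E h)).
    by rewrite aut_actK.
  have bK E : cancel (b E) (a E).
    move=> h; have [g [<- <-]] := ultra_ex uF (ultraI uF (aP E (b E h)) (bP E h)).
    by rewrite aut_actVK.
  have anat E E' (f : cover_map E E') h : a E (fiber_map f h) = fiber_map f (a E' h).
    have [g [<- <-]] := ultra_ex uF (ultraI uF (aP E (fiber_map f h)) (aP E' h)).
    by rewrite aut_act_nat.
  exists (Aut aK bK anat) => A oA /oA [n [E hE]].
  have FE i : F (fun g : pi1 y => forall h, aut_act g h = a (E i) h).
    have [m [e he]] := fiber_listed (E i).
    apply: (ultraS uF _ (ultra_all uF (fun j => aP (E i) (e j)))) => g hg h.
    by have [j <-] := he h.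
  by apply: (ultraS uF _ (ultra_all uF FE)) => g hg; apply: hE.
- move=> A g oA /oA [n [E hE]]; have [V oV hV] := openE n E.
  exists V => // v /hV e; apply: hE => i h.
  by rewrite -{2}(e i h) /= aut_actVK.
- move=> V g oV v /oV [n [E hE]]; exists n, E => v' e; apply: hE => i h /=.
  by rewrite e.
move=> g g' e; apply: aut_ext => E h.
have [V oV hV] := openE 1%N (fun=> E).
by have /hV /(_ ord0 h) /= {1}<- := e V oV; rewrite aut_actVK.
Qed.

End Fibers.

                                                         

(** * The map from the fundamental group to the Galois group *)

Lemma pev_comp (K : fieldType) (B : comPzRingType) (s : {rmorphism K -> B})
    (p f : {poly K}) b : pev s (p \Po f) b = pev s p (pev s f b).
Proof.
elim/poly_ind: p => [|p c IH]; first by rewrite comp_poly0 !pev0.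
rewrite comp_polyD comp_polyM comp_polyX comp_polyC !pevD pev_mulX !pevC.
by rewrite pevM IH.
Qed.

Section AlgebraicClosure.
Variables (K : fieldType) (W : closedFieldType) (w : {rmorphism K -> W}).
Hypotheses (char0 : [pchar K] =i pred0) (hw : is_algebraic_closure w).

Lemma minpoly_ex a : exists q : {poly K}, [/\ etale_poly q, pev w q a = 0 &
  forall p, pev w p a = 0 -> q %| p].
Proof.
have [p0 p0n p0a] := hw a; move: p0a; rewrite rootE -pev_horner => /eqP p0a.
have [q [qn qb qmin]] : exists q : {poly K}, [/\ q != 0, pev w q a = 0 &
    forall p, pev w p a = 0 -> p != 0 -> (size q <= size p)%N].
  pose P m := `[<exists p : {poly K}, [/\ p != 0, pev w p a = 0 & size p = m]>].
  have exP : exists m, P m by exists (size p0); apply/asboolP; exists p0.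
  case: (ex_minnP exP) => m /asboolP [q [qn qb sq]] min; exists q; split=> //.
  by move=> p pb pn; rewrite sq; apply: min; apply/asboolP; exists p.
have dvd p : pev w p a = 0 -> q %| p.
  move=> pb; apply/modp_eq0P/eqP; apply: contraT => rn.
  have rb : pev w (p %% q) a = 0.
    have := pb; rewrite {1}(divp_eq p q) pevD pevM qb mulr0 add0r.
    by [].
  by have := qmin _ rb rn; rewrite leqNgt ltn_modp qn.
have lq : lead_coef q != 0 by rewrite lead_coef_eq0.
have q1 : (1 < size q)%N.
  rewrite ltnNge; apply: contra lq => /size1_polyC qc.
  move: qb; rewrite qc pevC lead_coefC => /eqP; by rewrite fmorph_eq0.
have qe : (lead_coef q)^-1 *: q %= q by rewrite eqp_scale // invr_eq0.
have sq : size ((lead_coef q)^-1 *: q) = size q by rewrite size_scale // invr_eq0.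
exists ((lead_coef q)^-1 *: q); split=> [||p /dvd]; last by rewrite (eqp_dvdl _ qe).
  split; first by rewrite monicE lead_coefZ mulVf.
    by rewrite sq.
  rewrite derivZ coprimepZl ?coprimepZr ?invr_eq0 // coprimep_def.
  set d := gcdp q q^`(); have /dvdpP [e qE] : d %| q by apply: dvdp_gcdl.
  have [da|da] := eqVneq (pev w d a) 0.
    have : q %| q^`() := dvdp_trans (dvd d da) (dvdp_gcdr _ _).
    move/(dvdp_leq (deriv_neq0 char0 q1)); rewrite leqNgt lt_size_deriv //.
  have /eqP := qb; rewrite qE pevM mulf_eq0 (negPf da) orbF => /eqP /dvd.
  have en : e != 0 by apply: contra qn => /eqP e0; rewrite qE e0 mul0r.
  by rewrite qE -{2}[e]mulr1 dvdp_mul2l // dvdp1.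
by rewrite -mul_polyC pev_Cmul qb mulr0.
Qed.

Definition minp a : {poly K} := projT1 (cid (minpoly_ex a)).

Lemma minp_etale a : etale_poly (minp a).
Proof. by rewrite /minp; case: cid => q []. Qed.
Lemma minp_root a : pev w (minp a) a = 0.
Proof. by rewrite /minp; case: cid => q []. Qed.
Lemma minp_dvd a p : pev w p a = 0 -> minp a %| p.
Proof. by rewrite /minp; case: cid => q [_ _] /= h /h. Qed.

(** Primitive element theorem: statements about two algebraic elements reduce to polynomials in
    one. *)
Lemma primitive2 a b : exists z (f g : {poly K}), pev w f z = a /\ pev w g z = b.
Proof.
have [p p0 pa] := hw a; have [q q0 qb] := hw b.
have c0 : has_char0 K by exact: char0.
have [n /= [[f fa] [g gb]]] := pchar0_PET p0 pa q0 qb c0.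
by exists (b *+ n - a), f, g; rewrite !pev_horner.
Qed.

Section Augment.
Variables (Y : site K) (y : spt Y w).

(** An explicit form of [pi1_galois]: a is a fibre point of the constant cover defined by its
    minimal polynomial, and g moves it to another root. *)
Definition augval (g : pi1 y) (a : W) : W :=
  aut_act g (fiber_poly y (minp_etale a) (minp_root a)) (gen_val (minp_etale a) y).

Lemma augval_poly (g : pi1 y) q (hq : etale_poly q)
    (h : fiber y (cover_poly Y hq)) :
  aut_act g h (gen_val hq y) = augval g (h (gen_val hq y)).
Proof.
set a := h _; pose hm := minp_etale a.
have v0 (R : comPzRingType) (e : {rmorphism K -> R}) (x : spt Y e) :
    pev (kstr (cover_poly Y hm) x) q (nval (gen Y hm) x) = 0.
  apply: pev_dvd (gen_root hm x); apply: minp_dvd.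
  exact: fiber_poly_root.
have hE : h = fiber_map (poly_map hq v0) (fiber_poly y hm (minp_root a)).
  by apply: fiber_poly_ext; rewrite /= (poly_map_gen hq v0) fiber_polyE.
rewrite hE aut_act_nat /= (poly_map_gen hq v0).
by [].
Qed.

Lemma augval_section (g : pi1 y) (F : etale_cover Y) (v : nsection F)
    (h : fiber y F) q : etale_poly q ->
  (forall (R : comPzRingType) (e : {rmorphism K -> R}) (x : spt Y e),
    pev (kstr F x) q (nval v x) = 0) ->
  aut_act g h (nval v y) = augval g (h (nval v y)).
Proof.
move=> hq v0; rewrite -(poly_map_gen hq v0 y).
have -> : aut_act g h (poly_map_fun hq v0 y (gen_val hq y)) =
    fiber_map (poly_map hq v0) (aut_act g h) (gen_val hq y) by [].
by rewrite -aut_act_nat augval_poly.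
Qed.

Lemma pev_section_nat (F : etale_cover Y) (v : nsection F) p
    (R R' : comPzRingType) (e : {rmorphism K -> R})
    (e' : {rmorphism K -> R'}) (u : {rmorphism R -> R'}) (x : spt Y e)
    (x' : spt Y e') (a : arrow u x x') :
  cmap F a (pev (kstr F x) p (nval v x)) = pev (kstr F x') p (nval v x').
Proof.
rewrite (pev_morph (t := kstr F x')) ?nval_nat // => c.
by rewrite /= (cmap_push F a).1 a.1.
Qed.

Definition pev_section (F : etale_cover Y) (v : nsection F) p :=
  NSection (fun R R' e e' u x x' a => @pev_section_nat F v p R R' e e' u x x' a).

(** On the cover attached to z, the value of f at the generator is a section killed by the minimal
    polynomial of f(z), so [augval_section] applies. *)
Lemma augval_pev (g : pi1 y) (f : {poly K}) z :
  augval g (pev w f z) = pev w f (augval g z).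
Proof.
pose hz := minp_etale z; pose a := pev w f z.
pose k := fiber_poly y hz (minp_root z).
have ka : k (nval (pev_section (gen Y hz) f) y) = a.
  by rewrite /= -fiber_pev fiber_polyE.
rewrite -/a -ka -(@augval_section g _ _ k (minp a) (minp_etale a)) /=.
  by rewrite -fiber_pev.
move=> R e x /=; rewrite -pev_comp; apply: pev_dvd (gen_root hz x).
by apply: minp_dvd; rewrite pev_comp minp_root.
Qed.

(** Compatibility with sums and products follows from [augval_pev], after writing both elements as
    polynomials in one z. *)
Lemma augval_gal (g : pi1 y) : exists s : gal_group w, s =1 augval g.
Proof.
have zm h : zmod_morphism (augval h).
  move=> a b; have [z [f [f' [<- <-]]]] := primitive2 a b.
  by rewrite -pevN -pevD !augval_pev pevD pevN.
have mm h : monoid_morphism (augval h).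
  split=> [|a b]; first by rewrite -(pev1 w 0) augval_pev !pev1.
  have [z [f [f' [<- <-]]]] := primitive2 a b.
  by rewrite -pevM !augval_pev pevM.
have [s sE] := rmorphism_of (zm g) (mm g).
have [s' s'E] := rmorphism_of (zm (aut_inv g)) (mm (aut_inv g)).
have comp h h' a : augval (aut_mul h h') a = augval h (augval h' a).
  by rewrite {1}/augval /= augval_poly.
have one a : augval (aut_one y) a = a by rewrite /augval /= fiber_polyE.
have sK : cancel s s'.
  by move=> a; rewrite sE s'E -comp (aut_mulVl g : aut_mul _ _ = _) one.
have s'K : cancel s' s.
  move=> a; rewrite sE s'E -comp.
  by rewrite (tmulVr (g : pi1 y) : aut_mul g (aut_inv g) = aut_one y) one.
have sw c : s (w c) = w c by rewrite sE -(pevC w c 0) augval_pev !pevC.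
by exists (GaloisAut sK s'K sw).
Qed.

Notation pt0 := (tt : spt (Spec K) (idfun : {rmorphism K -> K})).

Lemma spec_arrow (R : comPzRingType) (e : {rmorphism K -> R}) (x : spt Y e) :
  @arrow K (Spec K) K R idfun (e \o idfun) e pt0 (sm (to_Spec Y) x).
Proof. by split. Qed.

Section SpecSection.
Variables (E : etale_cover (Spec K)) (b : calg E pt0).

Lemma spec_section_nat (R R' : comPzRingType) (e : {rmorphism K -> R})
    (e' : {rmorphism K -> R'}) (u : {rmorphism R -> R'}) (x : spt Y e)
    (x' : spt Y e') (a : arrow u x x') :
  cmap (pullback (to_Spec Y) E) a (cmap E (spec_arrow x) b) =
    cmap E (spec_arrow x') b.
Proof.
apply/esym; apply: (cmap_comp (spec_arrow x) (sm_arrow (to_Spec Y) a)).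
by move=> c /=; rewrite a.1.
Qed.

Definition spec_section : nsection (pullback (to_Spec Y) E) :=
  NSection spec_section_nat.

End SpecSection.

(** A cover of Spec K comes by base change from its algebra at the tautological point. Each element
    of that algebra gives a section of the pullback, killed by a separable polynomial because the
    algebra is reduced. *)
Lemma augval_spec (g : pi1 y) (s : gal_group w) : s =1 augval g ->
  forall (E : etale_cover (Spec K)) (h : fiber y (pullback (to_Spec Y) E)) a,
    aut_act g h (cmap E (galois_arrow y s) a) = s (h a).
Proof.
move=> sE E h.
apply: (pushout_eq (cmap_push E (spec_arrow y))
  (h := aut_act g h \o cmap E (galois_arrow y s)) (h' := s \o h)) => [r|b].
  have e1 := (cmap_push E (galois_arrow y s)).1 r.
  have e2 := fibP (aut_act g h); have e3 := fibP h; rewrite /= in e1 e2 e3 *.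
  by rewrite e1 e2 e3.
have [n [yy [ww [tr F]]]] := (finite_etale_frame _).1 (cet E pt0).
have [q [qm q1 qs qb]] := reduced_separable F (frame_reduced (cet E _)) char0 b.
have hq : etale_poly q.
  by split=> //; move: qs; rewrite unlock.
have e1 : cmap E (galois_arrow y s) (cmap E (spec_arrow y) b) = cmap E (spec_arrow y) b.
  apply/esym; apply: (cmap_comp (spec_arrow y) (galois_arrow y s)).
  by move=> c /=; rewrite gfun_id.
rewrite /= e1 sE.
apply: (@augval_section g _ (spec_section b) h q hq) => R e x /=.
rewrite -(pev_morph (s := cstr E pt0)
  (g := cmap E (spec_arrow x))) ?qb ?rmorph0 // => c.
exact: (cmap_push E (spec_arrow x)).1.
Qed.

(** The property defining [pi1_galois] is met by [augval], and testing it on covers defined by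
    minimal polynomials shows that it determines the automorphism. *)
Lemma pi1_galoisE (g : pi1 y) : pi1_galois g =1 augval g.
Proof.
have [s0 s0E] := augval_gal g.
have := epsilon_spec (inhabits 1%tg) (fun s : gal_group w =>
    forall (E : etale_cover (Spec K)) (h : fiber y (pullback (to_Spec Y) E)) a,
      aut_act g h (cmap E (galois_arrow y s) a) = s (h a))
   (ex_intro _ s0 (augval_spec s0E)).
rewrite -/(pi1_galois g); set s := pi1_galois g => sP a.
pose E := cover_poly (Spec K) (minp_etale a).
pose v := gen (Spec K) (minp_etale a).
have vn (R R' : comPzRingType) (e : {rmorphism K -> R})
    (e' : {rmorphism K -> R'}) (u : {rmorphism R -> R'}) (x : spt Y e)
    (x' : spt Y e') (b : arrow u x x') :
    cmap (pullback (to_Spec Y) E) b (gen_val (minp_etale a) (sm (to_Spec Y) x)) =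
    gen_val (minp_etale a) (sm (to_Spec Y) x').
  exact: (gen_nat (minp_etale a) (sm_arrow (to_Spec Y) b)).
have a0 : pev (w \o idfun) (minp a) a = 0 by rewrite -[RHS](minp_root a).
pose k := fiber_poly (sm (to_Spec Y) y) (minp_etale a) a0.
pose h : fiber y (pullback (to_Spec Y) E) := @Fiber _ _ _ _ y (pullback (to_Spec Y) E) k (fibP k).
have hE : h (gen_val (minp_etale a) (sm (to_Spec Y) y)) = a by exact: fiber_polyE.
have := sP E h (gen_val (minp_etale a) (sm (to_Spec Y) y)).
rewrite hE => <-.
have -> : cmap E (galois_arrow y s) (gen_val (minp_etale a) (sm (to_Spec Y) y)) =
  gen_val (minp_etale a) (sm (to_Spec Y) y) by apply: (gen_nat (minp_etale a)).
rewrite -[in RHS]hE; apply/esym.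
apply/esym; apply: (@augval_section g _ (NSection vn) h (minp a) (minp_etale a)) => R e x.
exact: (gen_root (minp_etale a) (sm (to_Spec Y) x)).
Qed.

Lemma pi1_galois_hom : is_hom (@pi1_galois K Y W w y : pi1 y -> gal_group w).
Proof.
move=> g h; apply: galois_ext => a; rewrite /= !pi1_galoisE.
by rewrite {1}/augval /= augval_poly.
Qed.

Lemma pi1_galois_cont : tcontinuous (@pi1_galois K Y W w y : pi1 y -> gal_group w).
Proof.
move=> A oA g /oA [s hs].
exists (size s), (fun i => cover_poly Y (minp_etale (s`_i))) => g' e.
apply: hs => a /(nthP 0) [i lt_is <-]; rewrite !pi1_galoisE /augval.
by rewrite (e (Ordinal lt_is)).
Qed.

Lemma pi1_galois_section (g : pi1 y) (F : etale_cover Y) (v : nsection F)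
    (h : fiber y F) q : etale_poly q ->
  (forall (R : comPzRingType) (e : {rmorphism K -> R}) (x : spt Y e),
    pev (kstr F x) q (nval v x) = 0) ->
  aut_act g h (nval v y) = pi1_galois g (h (nval v y)).
Proof. by move=> hq v0; rewrite pi1_galoisE; apply: augval_section hq v0. Qed.

End Augment.
End AlgebraicClosure.

(** * Functoriality of the fundamental group *)

Section Pi1Map.
Variables (K K' : fieldType) (j : {rmorphism K -> K'}).
Variables (Y' : site K') (Y : site K) (f : site_map j Y' Y).
Variables (W W' : closedFieldType) (w : {rmorphism K -> W})
  (w' : {rmorphism K' -> W'}) (y : spt Y w) (y' : spt Y' w')
  (b : {rmorphism W -> W'}).
Hypothesis hb : arrow b y (sm f y').

Lemma fiber_up_ex E (h : fiber y E) : exists h' : fiber y' (pullback f E),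
  forall a, h' (cmap E hb a) = b (h a).
Proof.
have [|h' [h'1 h'2]] := pushout_hom (cmap_push E hb) (f := idfun) (g := b \o h).
  by move=> r /=; rewrite fibP.
by exists (@Fiber _ _ _ _ y' (pullback f E) h' h'1).
Qed.

Definition fiber_up E (h : fiber y E) := projT1 (cid (fiber_up_ex h)).

Lemma fiber_upE E (h : fiber y E) a : fiber_up h (cmap E hb a) = b (h a).
Proof. by rewrite /fiber_up; case: cid. Qed.

Lemma fiber_up_eq E (h1 h2 : fiber y' (pullback f E)) :
  (forall a, h1 (cmap E hb a) = h2 (cmap E hb a)) -> h1 = h2.
Proof.
move=> e; apply: fiber_ext; apply: (pushout_eq (cmap_push E hb)) => // r.
by rewrite (fibP h1 r) (fibP h2 r).
Qed.

(** The values of h' on E(y) are roots of polynomials over W; these split over W, so the values lie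
    in the image of b. *)
Lemma fiber_down_ex E (h' : fiber y' (pullback f E)) :
  exists h : fiber y E, fiber_up h = h'.
Proof.
have [n [yy [ww [tr F]]]] := (finite_etale_frame _).1 (cet E y).
have val a : exists c, b c = h' (cmap E hb a).
  have [p p0 pa] := frame_integral F a.
  have [rs pE] := closed_field_poly_normal p.
  have l0 : lead_coef p != 0 by rewrite lead_coef_eq0.
  have : pev b p (h' (cmap E hb a)) = 0.
    have bP c : h' (cmap E hb (cstr E y c)) = b c.
      have e1 := (cmap_push E hb).1 c; rewrite e1; exact: fibP.
    by rewrite -(pev_morph (g := h' \o cmap E hb) p a bP) pa rmorph0.
  rewrite pev_horner pE map_polyZ rmorph_prod hornerZ horner_prod => /eqP.
  rewrite mulf_eq0 fmorph_eq0 (negPf l0) /= prodf_seq_eq0 => /hasP [z _ /=].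
  rewrite rmorphB /= map_polyX map_polyC !hornerE subr_eq0 => /eqP ->.
  by exists z.
pose h0 a := projT1 (cid (val a)).
have hP a : b (h0 a) = h' (cmap E hb a) by rewrite /h0; case: cid.
have [||h hE] := @rmorphism_of _ _ h0.
- by move=> x z; apply: (fmorph_inj b); rewrite rmorphB !hP !rmorphB.
- split; first by apply: (fmorph_inj b); rewrite hP !rmorph1.
  by move=> x z; apply: (fmorph_inj b); rewrite rmorphM !hP !rmorphM.
have hs r : h (cstr E y r) = r.
  apply: (fmorph_inj b); rewrite hE hP.
  by have -> := (cmap_push E hb).1 r; apply: fibP.
exists (@Fiber _ _ _ _ y E h hs); apply: fiber_up_eq => a.
by rewrite fiber_upE /= hE hP.
Qed.

Definition fiber_down E (h' : fiber y' (pullback f E)) :=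
  projT1 (cid (fiber_down_ex h')).

Lemma fiber_downK E : cancel (@fiber_down E) (@fiber_up E).
Proof. by move=> h'; rewrite /fiber_down; case: cid. Qed.

Lemma fiber_up_inj E : injective (@fiber_up E).
Proof.
move=> h1 h2 e; apply: fiber_ext => a; apply: (fmorph_inj b).
by rewrite -!fiber_upE e.
Qed.

Lemma fiber_upK E : cancel (@fiber_up E) (@fiber_down E).
Proof. by move=> h; apply: fiber_up_inj; rewrite fiber_downK. Qed.

Section PullbackMap.
Variables (E F : etale_cover Y) (m : cover_map E F).

Definition pullback_map : cover_map (pullback f E) (pullback f F) :=
  @CoverMap _ _ (pullback f E) (pullback f F) (fun R e x => cm m (sm f x))
    (fun R e x r => cm_str m (sm f x) r)
    (fun R R' e e' u x x' a c => cm_map m (sm_arrow f a) c).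

Lemma fiber_up_map (h : fiber y F) :
  fiber_up (fiber_map m h) = fiber_map pullback_map (fiber_up h).
Proof.
apply: fiber_up_eq => a; rewrite fiber_upE /=.
by rewrite cm_map fiber_upE.
Qed.

End PullbackMap.

Lemma fiber_down_map (E F : etale_cover Y) (m : cover_map E F) h' :
  fiber_down (fiber_map (pullback_map m) h') = fiber_map m (fiber_down h').
Proof. by apply: fiber_up_inj; rewrite fiber_up_map !fiber_downK. Qed.

(** An explicit form of [pi1_map]: the action of g' transported along the bijection [fiber_up]. *)
Definition transfer_act (g' : pi1 y') E (h : fiber y E) :=
  fiber_down (aut_act g' (fiber_up h)).

Lemma transfer_actK (g' : pi1 y') E :
  cancel (@transfer_act g' E) (@transfer_act (aut_inv g') E).
Proof. by move=> h; rewrite /transfer_act fiber_downK /= aut_actK fiber_upK. Qed.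

Lemma transfer_actVK (g' : pi1 y') E :
  cancel (@transfer_act (aut_inv g') E) (@transfer_act g' E).
Proof. by move=> h; rewrite /transfer_act fiber_downK /= aut_actVK fiber_upK. Qed.

Lemma transfer_nat (g' : pi1 y') E F (m : cover_map E F) h :
  transfer_act g' (fiber_map m h) = fiber_map m (transfer_act g' h).
Proof. by rewrite /transfer_act fiber_up_map aut_act_nat fiber_down_map. Qed.

Definition transfer (g' : pi1 y') : pi1 y :=
  Aut (@transfer_actK g') (@transfer_actVK g') (@transfer_nat g').

Lemma pi1_mapE (g' : pi1 y') : pi1_map hb g' = transfer g'.
Proof.
have tP E (h : fiber y E) (h' : fiber y' (pullback f E)) :
    (forall a, h' (cmap E hb a) = b (h a)) ->
    forall a, aut_act g' h' (cmap E hb a) = b (aut_act (transfer g') h a).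
  move=> e a; have -> : h' = fiber_up h.
    by apply: fiber_up_eq => c; rewrite fiber_upE.
  by rewrite -fiber_upE /= fiber_downK.
have := epsilon_spec (inhabits 1%tg) (fun g : pi1 y =>
    forall (E : etale_cover Y) (h : fiber y E) (h' : fiber y' (pullback f E)),
      (forall a, h' (cmap E hb a) = b (h a)) ->
      forall a, aut_act g' h' (cmap E hb a) = b (aut_act g h a))
  (ex_intro _ (transfer g') tP).
rewrite -/(pi1_map hb g') => mP; apply: aut_ext => E h; apply: fiber_ext => a.
apply: (fmorph_inj b); have eu := fiber_upE h.
by rewrite -(mP E h _ eu) -(tP E h _ eu).
Qed.

Lemma pi1_map_cont : tcontinuous (pi1_map hb).
Proof.
move=> A oA g /oA [n [E hE]]; exists n, (fun i => pullback f (E i)) => g' e.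
apply: hE => i h; rewrite !pi1_mapE /= /transfer_act; congr fiber_down.
exact: e.
Qed.

Lemma pev_map (B : comPzRingType) (s : {rmorphism K' -> B}) (q : {poly K}) c :
  pev s (map_poly j q) c = pev (s \o j) q c.
Proof.
by rewrite /pev size_map_poly; apply: eq_bigr => i _; rewrite coef_map.
Qed.

Lemma etale_poly_map (q : {poly K}) : etale_poly q -> etale_poly (map_poly j q).
Proof.
by case=> qm q1 qs; split; rewrite ?map_monic ?size_map_poly // deriv_map coprimep_map.
Qed.

Hypotheses (char0 : [pchar K] =i pred0) (hw : is_algebraic_closure w).
Hypotheses (char0' : [pchar K'] =i pred0) (hw' : is_algebraic_closure w').

(** Pulled back to Y', the generator of the cover attached to a is a section killed by the image of
    its minimal polynomial, which is still etale; so [pi1_galois_section] computes both sides. *)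
Lemma pi1_galois_map (g' : pi1 y') a :
  b (pi1_galois (pi1_map hb g') a) = pi1_galois g' (b a).
Proof.
rewrite (pi1_galoisE char0 hw) /augval pi1_mapE /= -fiber_upE.
rewrite fiber_downK; set E := cover_poly _ _; set h := fiber_poly _ _ _.
have vn (R R' : comPzRingType) (e : {rmorphism K' -> R})
    (e' : {rmorphism K' -> R'}) (u : {rmorphism R -> R'}) (x : spt Y' e)
    (x' : spt Y' e') (c : arrow u x x') :
    cmap (pullback f E) c (gen_val (minp_etale char0 hw a) (sm f x)) =
    gen_val (minp_etale char0 hw a) (sm f x').
  exact: (gen_nat (minp_etale char0 hw a) (sm_arrow f c)).
have e1 : cmap E hb (gen_val (minp_etale char0 hw a) y) =
    gen_val (minp_etale char0 hw a) (sm f y') by apply: gen_nat.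
have -> : b a = fiber_up h (gen_val (minp_etale char0 hw a) (sm f y')).
  by rewrite -e1 fiber_upE fiber_polyE.
rewrite e1.
apply: (pi1_galois_section char0' hw' g' (v := NSection vn) (fiber_up h)
  (etale_poly_map (minp_etale char0 hw a))) => R e x.
by rewrite pev_map -[RHS](gen_root (minp_etale char0 hw a) (sm f x)).
Qed.

End Pi1Map.

                                                   

(** * Exactness: lifting automorphisms that respect connected components *)

Lemma idem01 (F : fieldType) (a : F) : a * a = a -> a = 0 \/ a = 1.
Proof.
move=> aa; have : a * (a - 1) = 0 by rewrite mulrBr mulr1 aa subrr.
by move/eqP; rewrite mulf_eq0 subr_eq0 => /orP [] /eqP ->; [left|right].
Qed.

(** The iterates of f at t repeat, and injectivity cancels the common initial part. *)
Lemma listed_surj (T : Type) (f : T -> T) : listed T -> injective f ->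
  forall t, exists x, f x = t.
Proof.
move=> [n [e he]] fi t.
pose idx k := projT1 (cid (he (iter k f t))).
have idxP k : e (idx k) = iter k f t by rewrite /idx; case: cid.
have [i [j [ij ee]]] : exists i j, (i < j)%N /\ idx i = idx j.
  have : ~~ injectiveb (fun i : 'I_n.+1 => idx i).
    by apply/negP => /injectiveP /leq_card; rewrite !card_ord ltnn.
  case/injectivePn => i [j ij ee].
  by case: (ltngtP i j) => [ltij|ltji|/val_inj eij];
    [exists i, j|exists j, i|rewrite eij eqxx in ij].
have : iter i f t = iter j f t by rewrite -!idxP ee.
rewrite -(subnKC (ltnW ij)); move: (j - i)%N (subn_gt0 i j) => m.
rewrite ij => m0; elim: i {ee ij} => [|i IH].
  by case: m m0 => // m _ /= e0; exists (iter m f t); apply: esym.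
by rewrite addSn /= => /fi /IH.
Qed.

Section CoverMaps.
Variables (K : fieldType) (Y : site K).

Definition cover_comp (E F G : etale_cover Y) (m : cover_map E F)
    (n : cover_map F G) : cover_map E G.
refine (@CoverMap K Y E G (fun R e x => cm n x \o cm m x) _ _).
- by move=> R e x r; rewrite /= !cm_str.
- by move=> R R' e e' u x x' a b; rewrite /= !cm_map.
Defined.

Definition cover_id (E : etale_cover Y) : cover_map E E :=
  @CoverMap K Y E E (fun R e x => idfun) (fun _ _ _ _ => erefl)
    (fun _ _ _ _ _ _ _ _ _ => erefl).

Lemma fiber_map_comp (W : comPzRingType) (w : {rmorphism K -> W}) (y : spt Y w)
    (E F G : etale_cover Y) (m : cover_map E F) (n : cover_map F G)
    (h : fiber y G) : fiber_map (cover_comp m n) h = fiber_map m (fiber_map n h).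
Proof. exact: fiber_ext. Qed.

Lemma fiber_map_id (W : comPzRingType) (w : {rmorphism K -> W}) (y : spt Y w)
    (E : etale_cover Y) (h : fiber y E) : fiber_map (cover_id E) h = h.
Proof. exact: fiber_ext. Qed.

Section Agreement.
Variables (F G : etale_cover Y) (m n : cover_map F G).

Lemma agree_ex (R : comPzRingType) (e : {rmorphism K -> R}) (x : spt Y e) :
  exists d : calg G x, exists k (yy ww : 'I_k -> calg F x) tr,
    etale_frame (cstr F x) yy ww tr /\ d = agree_idem yy ww (cm m x) (cm n x).
Proof.
have [k [yy [ww [tr H]]]] := (finite_etale_frame _).1 (cet F x).
by exists (agree_idem yy ww (cm m x) (cm n x)), k, yy, ww, tr.
Qed.

(** Independence of the frame ([agree_valE]) makes these local idempotents compatible, so that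
    equality of two maps at a fibre point becomes the value of an idempotent section. *)
Definition agree_val (R : comPzRingType) (e : {rmorphism K -> R}) (x : spt Y e) :=
  projT1 (cid (agree_ex x)).

Lemma cm_agree (R : comPzRingType) (e : {rmorphism K -> R}) (x : spt Y e) r :
  cm m x (cstr F x r) = cm n x (cstr F x r).
Proof. by rewrite !cm_str. Qed.

Lemma agree_valE (R : comPzRingType) (e : {rmorphism K -> R}) (x : spt Y e)
    k (yy ww : 'I_k -> calg F x) tr : etale_frame (cstr F x) yy ww tr ->
  agree_val x = agree_idem yy ww (cm m x) (cm n x).
Proof.
move=> H; rewrite /agree_val; case: cid => d [k' [yy' [ww' [tr' [H' /= ->]]]]].
have c := @cm_agree R e x.
rewrite -(agree_idem_uniq H' (agree_idemE H c) (agree_idem_idem H c)) mulrC.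
by apply: esym; apply: (agree_idem_uniq H (agree_idemE H' c) (agree_idem_idem H' c)).
Qed.

Lemma agree_nat (R R' : comPzRingType) (e : {rmorphism K -> R})
    (e' : {rmorphism K -> R'}) (u : {rmorphism R -> R'}) (x : spt Y e)
    (x' : spt Y e') (a : arrow u x x') :
  cmap G a (agree_val x) = agree_val x'.
Proof.
have [k [yy [ww [tr H]]]] := (finite_etale_frame _).1 (cet F x).
have [tr' H' _] := frame_pushout (cmap_push F a) H.
rewrite (agree_valE H) (agree_valE H') /agree_idem rmorph_sum.
by apply: eq_bigr => i _; rewrite rmorphM /= !cm_map.
Qed.

Definition agree_section := NSection agree_nat.

Lemma agree_section_idem : idem_section agree_section.
Proof.
move=> R e x /=; have [k [yy [ww [tr H]]]] := (finite_etale_frame _).1 (cet F x).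
by rewrite (agree_valE H) (agree_idem_idem H (@cm_agree R e x)).
Qed.

Lemma agree_sectionP (W : fieldType) (w : {rmorphism K -> W}) (y : spt Y w)
    (t : fiber y G) :
  t (nval agree_section y) = 1 <-> fiber_map m t = fiber_map n t.
Proof.
have [k [yy [ww [tr H]]]] := (finite_etale_frame _).1 (cet F y).
rewrite /= (agree_valE H); split=> h.
  apply: fiber_ext => b /=.
  have := congr1 t (agree_idemE H (@cm_agree _ _ y) b).
  by rewrite !rmorphM h !mulr1.
have e : t \o cm m y =1 t \o cm n y.
  by move=> b; have := congr1 (fun f : fiber y F => f b) h.
rewrite -(agree_idem1 H e) /agree_idem rmorph_sum; apply: eq_bigr => i _.
by rewrite rmorphM.
Qed.

End Agreement.

Lemma compl_nat (F : etale_cover Y) (v : nsection F) (R R' : comPzRingType) (e : {rmorphism K -> R})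
    (e' : {rmorphism K -> R'}) (u : {rmorphism R -> R'}) (x : spt Y e)
    (x' : spt Y e') (a : arrow u x x') :
  cmap F a (1 - nval v x) = 1 - nval v x'.
Proof. by rewrite rmorphB rmorph1 nval_nat. Qed.

Definition compl_section F (v : nsection F) :=
  NSection (fun R R' e e' u x x' a => @compl_nat F v R R' e e' u x x' a).

Lemma compl_idem F (v : nsection F) : idem_section v -> idem_section (compl_section v).
Proof.
move=> vi R e x /=; rewrite mulrBl mul1r mulrBr mulr1 vi subrr subr0.
by [].
Qed.

Lemma prod_nat (F : etale_cover Y) n (v : 'I_n -> nsection F) (R R' : comPzRingType) (e : {rmorphism K -> R})
    (e' : {rmorphism K -> R'}) (u : {rmorphism R -> R'}) (x : spt Y e)
    (x' : spt Y e') (a : arrow u x x') :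
  cmap F a (\prod_i nval (v i) x) = \prod_i nval (v i) x'.
Proof. by rewrite rmorph_prod; apply: eq_bigr => i _; rewrite nval_nat. Qed.

Definition prod_section F n (v : 'I_n -> nsection F) :=
  NSection (fun R R' e e' u x x' a => @prod_nat F n v R R' e e' u x x' a).

                                                                
(** Connected components as seen by open and closed subsets, without being constructed. *)
Definition same_component (W : comPzRingType) (w : {rmorphism K -> W})
    (y : spt Y w) (F : etale_cover Y) (t t' : fiber y F) :=
  forall v : nsection F, idem_section v -> t (nval v y) = 1 -> t' (nval v y) = 1.

Section Support.
Variables (D T : etale_cover Y) (v : nsection (cover_tens D T)).
Hypothesis vi : idem_section v.

Lemma ct_inl_push (R R' : comPzRingType) (e : {rmorphism K -> R})
    (e' : {rmorphism K -> R'}) (u : {rmorphism R -> R'}) (x : spt Y e)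
    (x' : spt Y e') (a : arrow u x x') :
  is_pushout (cmap D a) (ct_inl D T x) (ct_inl D T x') (ct_map D T a).
Proof.
apply: (pushout_cancel _ _ _ (ct_po D T x)
  (pushout_paste (cmap_push T a) (ct_po D T x'))) => r /=.
- by rewrite (cmap_push D a).1.
- by rewrite ct_mapr.
- by rewrite ct_mapl.
Qed.

Lemma ct_inl_et (R : comPzRingType) (e : {rmorphism K -> R}) (x : spt Y e) :
  finite_etale (ct_inl D T x).
Proof. exact: finite_etale_pushout (ct_po D T x) (cet T x). Qed.

Lemma supp_ex (R : comPzRingType) (e : {rmorphism K -> R}) (x : spt Y e) :
  exists d : calg D x, exists k (yy ww : 'I_k -> ct_alg D T x) tr,
    etale_frame (ct_inl D T x) yy ww tr /\ d = idem_support yy ww tr (nval v x).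
Proof.
have [k [yy [ww [tr H]]]] := (finite_etale_frame _).1 (ct_inl_et x).
by exists (idem_support yy ww tr (nval v x)), k, yy, ww, tr.
Qed.

Definition supp_val (R : comPzRingType) (e : {rmorphism K -> R}) (x : spt Y e) :=
  projT1 (cid (supp_ex x)).

Lemma supp_valE (R : comPzRingType) (e : {rmorphism K -> R}) (x : spt Y e)
    k (yy ww : 'I_k -> ct_alg D T x) tr : etale_frame (ct_inl D T x) yy ww tr ->
  supp_val x = idem_support yy ww tr (nval v x).
Proof.
move=> H; rewrite /supp_val; case: cid => d [k' [yy' [ww' [tr' [H' /= ->]]]]].
by apply: support_uniq H' H _; apply: vi.
Qed.

Lemma support_map (R R' B B' : comPzRingType) (u : {rmorphism R -> R'})
    (f : {rmorphism B -> B'}) n (yy ww : 'I_n -> B) (tr : B -> R) (tr' : B' -> R') b :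
  (forall c, tr' (f c) = u (tr c)) ->
  idem_support (f \o yy) (f \o ww) tr' (f b) = u (idem_support yy ww tr b).
Proof.
move=> e; rewrite /idem_support rmorphB (rmorph1 u) -det_map_mx; congr (1 - \det _).
apply/matrixP => i l; rewrite !mxE rmorphB rmorph_nat; congr (_ - _).
by rewrite -e !rmorphM.
Qed.

Lemma supp_nat (R R' : comPzRingType) (e : {rmorphism K -> R})
    (e' : {rmorphism K -> R'}) (u : {rmorphism R -> R'}) (x : spt Y e)
    (x' : spt Y e') (a : arrow u x x') :
  cmap D a (supp_val x) = supp_val x'.
Proof.
have [k [yy [ww [tr H]]]] := (finite_etale_frame _).1 (ct_inl_et x).
have [tr' H' e1] := frame_pushout (ct_inl_push a) H.
rewrite (supp_valE H) (supp_valE H') -(support_map yy ww (nval v x) e1).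
by congr idem_support; apply: (nval_nat v a).
Qed.

Definition supp_section := NSection supp_nat.

Lemma supp_section_idem : idem_section supp_section.
Proof.
move=> R e x /=; have [k [yy [ww [tr H]]]] := (finite_etale_frame _).1 (ct_inl_et x).
by rewrite (supp_valE H); apply: (support_idem H); apply: vi.
Qed.

(** Base change along t turns v into an idempotent of a finite etale W-algebra. Its support vanishes
    exactly when it is 0 ([support_eq0]), and otherwise some point takes it to 1 ([idem_point]). *)
Lemma supp_section_point (W : closedFieldType) (w : {rmorphism K -> W})
    (y : spt Y w) (t : fiber y D) :
  t (nval supp_section y) <> 0 <->
  exists2 h : fiber y T, True & fiber_tens t h (nval v y) = 1.
Proof.
have [k [yy [ww [tr H]]]] := (finite_etale_frame _).1 (ct_inl_et y).
have po := tens_pushout t (frame_locally_projective H).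
set inW := tinA _ _ in po; set inD := tinB _ _ in po.
have [tr' H' e1] := frame_pushout po H.
rewrite /= (supp_valE H) -(support_map yy ww (nval v y) e1).
have vv : inD (nval v y) * inD (nval v y) = inD (nval v y).
  by rewrite -rmorphM vi.
split=> [h|[h _ h1] h0].
  have ne : inD (nval v y) != 0.
    by apply/eqP => e0; apply: h; rewrite e0 (support0 H').
  have etW : finite_etale inW by apply: finite_etale_pushout po (ct_inl_et y).
  have [p p1 p2] := idem_point etW vv ne.
  have ps r : (p \o inD) (cstr (cover_tens D T) y r) = r.
    by rewrite /= po.1 p1 fibP.
  pose q : fiber y (cover_tens D T) := @Fiber _ _ _ _ y (cover_tens D T) (p \o inD) ps.
  exists (fiber_map (tens_inr D T) q) => //.
  have -> : t = fiber_map (tens_inl D T) q.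
    by apply: fiber_ext => b; rewrite /= po.1 p1.
  by rewrite -fiber_tens_eta.
have := support_eq0 H' vv h0.
have [|p [p1 p2]] := pushout_hom po (f := idfun) (g := fiber_tens t h).
  move=> b; have := congr1 (fun f : fiber y D => f b) (fiber_tens_inl t h).
  by move=> /= ->.
move/(congr1 p); rewrite p2 h1 rmorph0 => /eqP; by rewrite oner_eq0.
Qed.

End Support.

End CoverMaps.

Section SameComponent.
Variables (K : fieldType) (Y : site K) (W : fieldType) (w : {rmorphism K -> W}).
Variables (y : spt Y w) (G : etale_cover Y) (t t' : fiber y G).
Hypothesis tt' : same_component t t'.

Lemma fiber_idem01 (v : nsection G) (s : fiber y G) : idem_section v ->
  s (nval v y) = 0 \/ s (nval v y) = 1.
Proof. by move=> vi; apply: idem01; rewrite -rmorphM vi. Qed.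

Lemma same_componentE (v : nsection G) : idem_section v ->
  t' (nval v y) = t (nval v y).
Proof.
move=> vi; case: (fiber_idem01 t vi) => [t0|t1]; last by rewrite t1 tt'.
have := tt' (compl_idem vi); rewrite /= !rmorphB !rmorph1 t0 subr0.
by move=> /(_ erefl) /eqP; rewrite subr_eq addrC -subr_eq subrr => /eqP <-.
Qed.

Lemma same_component_agree F (m n : cover_map F G) :
  fiber_map m t = fiber_map n t <-> fiber_map m t' = fiber_map n t'.
Proof.
by rewrite -!agree_sectionP (same_componentE (agree_section_idem m n)).
Qed.

End SameComponent.

Section Lifting.
Variables (K K' : fieldType) (j : {rmorphism K -> K'}).
Variables (Y' : site K') (Y : site K) (f : site_map j Y' Y).
Variables (W W' : closedFieldType) (w : {rmorphism K -> W})
  (w' : {rmorphism K' -> W'}) (y : spt Y w) (y' : spt Y' w')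
  (b : {rmorphism W -> W'}).
Variable hb : arrow b y (sm f y').
Variable g : pi1 y.
Hypothesis hg : forall (E : etale_cover Y) (t : fiber y E),
  same_component (fiber_up hb t) (fiber_up hb (aut_act g t)).

(** Otherwise each of the finitely many candidates s' is excluded by an idempotent. Let p be their
    product: its support on the pullback of E is nonzero at t, hence also at g t by [hg], so p takes
    the value 1 at (g t, s') for some s', a contradiction. *)
Lemma lift_point (E : etale_cover Y) (t : fiber y E) (T : etale_cover Y')
    (s : fiber y' T) : exists s' : fiber y' T,
  same_component (fiber_tens (fiber_up hb t) s)
                 (fiber_tens (fiber_up hb (aut_act g t)) s').
Proof.
apply: NNPP => no; have [n [e he]] := fiber_listed y' T.
set D := pullback f E.
have sep i : exists v : nsection (cover_tens D T), [/\ idem_section v,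
    fiber_tens (fiber_up hb t) s (nval v y') = 1 &
    fiber_tens (fiber_up hb (aut_act g t)) (e i) (nval v y') = 0].
  apply: NNPP => k; apply: no; exists (e i) => v vi v1.
  case: (fiber_idem01 (fiber_tens (fiber_up hb (aut_act g t)) (e i)) vi) => // v0.
  by case: k; exists v.
pose v i := projT1 (cid (sep i)).
have vP i : [/\ idem_section (v i),
    fiber_tens (fiber_up hb t) s (nval (v i) y') = 1 &
    fiber_tens (fiber_up hb (aut_act g t)) (e i) (nval (v i) y') = 0].
  by rewrite /v; case: cid.
pose p := prod_section v.
have pidem : idem_section p.
  move=> R e0 x; rewrite /= -big_split; apply: eq_bigr => i _ /=.
  by have [vi _ _] := vP i; rewrite vi.
have p1 : fiber_tens (fiber_up hb t) s (nval p y') = 1.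
  by rewrite /= rmorph_prod big1 // => i _; have [] := vP i.
have := same_componentE (@hg E t) (supp_section_idem pidem).
have n0 : fiber_up hb t (nval (supp_section pidem) y') <> 0.
  by apply/supp_section_point; exists s.
move=> eq; have : fiber_up hb (aut_act g t) (nval (supp_section pidem) y') <> 0.
  by rewrite eq.
move=> /supp_section_point [s' _]; have [i <-] := he s'.
rewrite /= rmorph_prod (bigD1 i) //=; have [_ _ ->] := vP i.
by rewrite mul0r => /esym/eqP; rewrite oner_eq0.
Qed.

(** A finite piece of the lifting problem: where to send [pt1], given that g moves [pt0]. Any two
    pieces are dominated by a third, through tensor products. *)
Record pointed_pair := PointedPair {
  pE : etale_cover Y; pt0 : fiber y pE;
  pT : etale_cover Y'; pt1 : fiber y' pT }.

Definition pp_lift nu := projT1 (cid (lift_point (pt0 nu) (pt1 nu))).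

Lemma pp_liftP nu : same_component (fiber_tens (fiber_up hb (pt0 nu)) (pt1 nu))
  (fiber_tens (fiber_up hb (aut_act g (pt0 nu))) (pp_lift nu)).
Proof. by rewrite /pp_lift; case: cid. Qed.

Definition above1 (F : etale_cover Y') (h : fiber y' F) nu :=
  exists m : cover_map F (pT nu), fiber_map m (pt1 nu) = h.
Definition above0 (E : etale_cover Y) (h : fiber y E) nu :=
  exists m : cover_map E (pE nu), fiber_map m (pt0 nu) = h.

Inductive base_set : (pointed_pair -> Prop) -> Prop :=
| base1 F (h : fiber y' F) : base_set (above1 h)
| base0 E (h : fiber y E) : base_set (above0 h).

Definition pp_le nu nu' := above0 (pt0 nu) nu' /\ above1 (pt1 nu) nu'.

Lemma base_fip : fip base_set.
Proof.
move=> A mA; suff [] : (exists nu, A nu) /\ forall nu nu', pp_le nu nu' -> A nu -> A nu'.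
  by [].
elim: mA => [|B C [F h|E h] _ [[nu Cnu] Cup]].
- by split=> //; exists (PointedPair (fiber_triv y) (fiber_triv y')).
- split=> [|nu1 nu2 le [[m mh] C1]].
    exists (PointedPair (pt0 nu) (fiber_tens (pt1 nu) h)); split.
      by exists (tens_inr (pT nu) F); apply: fiber_tens_inr.
    apply: Cup Cnu; split; first by exists (cover_id _); apply: fiber_map_id.
    by exists (tens_inl (pT nu) F); apply: fiber_tens_inl.
  split; last exact: Cup le C1.
  have [_ [m' m'h]] := le.
  by exists (cover_comp m m'); rewrite fiber_map_comp m'h.
split=> [|nu1 nu2 le [[m mh] C1]].
  exists (PointedPair (fiber_tens (pt0 nu) h) (pt1 nu)); split.
    by exists (tens_inr (pE nu) E); apply: fiber_tens_inr.
  apply: Cup Cnu; split; last by exists (cover_id _); apply: fiber_map_id.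
  by exists (tens_inl (pE nu) E); apply: fiber_tens_inl.
split; last exact: Cup le C1.
have [[m' m'h] _] := le.
by exists (cover_comp m m'); rewrite fiber_map_comp m'h.
Qed.

Lemma lift_agree nu F (m n : cover_map F (pT nu)) :
  fiber_map m (pt1 nu) = fiber_map n (pt1 nu) <->
  fiber_map m (pp_lift nu) = fiber_map n (pp_lift nu).
Proof.
have := same_component_agree (@pp_liftP nu)
  (cover_comp m (tens_inr _ _)) (cover_comp n (tens_inr _ _)).
by rewrite !fiber_map_comp !fiber_tens_inr.
Qed.

(** The image of h prescribed by nu when h comes from [pt1 nu]; it does not depend on the map of
    covers by [lift_agree]. For other h the value is arbitrary. *)
Definition pp_val nu F (h : fiber y' F) : fiber y' F :=
  epsilon (inhabits h) (fun h' => exists m : cover_map F (pT nu),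
    fiber_map m (pt1 nu) = h /\ fiber_map m (pp_lift nu) = h').

Lemma pp_valE nu F (m : cover_map F (pT nu)) :
  pp_val nu (fiber_map m (pt1 nu)) = fiber_map m (pp_lift nu).
Proof.
rewrite /pp_val; set Q := (fun h' => _); set h0 := inhabits _.
have [|n [/lift_agree -> //]] := epsilon_spec h0 Q.
by exists (fiber_map m (pp_lift nu)), m.
Qed.

                                                                       
                                        
(** The automorphism u is the limit of the [pp_val nu] along an ultrafilter of pairs in which every
    given point is eventually dominated. Limits exist in finite fibres, and injectivity passes to
    the limit, so u is bijective. *)
Theorem lift_aut : exists u : pi1 y', pi1_map hb u = g.
Proof.
have [F uF bF] := ultra_exists base_fip.
have F1 E (h : fiber y' E) : F (above1 h) by apply: bF; apply: base1.
have F0 E (h : fiber y E) : F (above0 h) by apply: bF; apply: base0.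
have lim E (h : fiber y' E) : exists v, F (fun nu => pp_val nu h = v).
  have [n [e he]] := fiber_listed y' E; apply: (ultra_fin uF (e := e)).
  by apply: (ultraS uF _ (ultraT uF)) => nu _; apply: he.
pose a E (h : fiber y' E) := projT1 (cid (lim E h)).
have aP E h : F (fun nu => pp_val nu h = a E h) by rewrite /a; case: cid.
have ainj E : injective (a E).
  move=> h1 h2 e.
  have [nu [[[m1 e1] v1] [[m2 e2] v2]]] := ultra_ex uF (ultraI uF
    (ultraI uF (F1 _ h1) (aP _ h1)) (ultraI uF (F1 _ h2) (aP _ h2))).
  move: e; rewrite -v1 -v2 -e1 -e2 !pp_valE => /lift_agree; by rewrite e1 e2.
have asurj E := listed_surj (fiber_listed y' E) (@ainj E).
pose c E h := projT1 (cid (asurj E h)).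
have aK E : cancel (c E) (a E) by move=> h; rewrite /c; case: cid.
have cK E : cancel (a E) (c E) by move=> h; apply: ainj; rewrite aK.
have anat E E' (q : cover_map E E') h : a E (fiber_map q h) = fiber_map q (a E' h).
  have [nu [[m mh] [<- <-]]] := ultra_ex uF (ultraI uF (F1 _ h)
    (ultraI uF (aP _ (fiber_map q h)) (aP _ h))).
  by rewrite -mh -fiber_map_comp !pp_valE fiber_map_comp.
exists (Aut cK aK anat); rewrite pi1_mapE; apply: aut_ext => E h /=.
apply: (fiber_up_inj (hb := hb)); rewrite /transfer_act fiber_downK /=.
have [nu [[m mh] [[m0 m0h] <-]]] := ultra_ex uF (ultraI uF (F1 _ (fiber_up hb h))
  (ultraI uF (F0 _ h) (aP _ (fiber_up hb h)))).
rewrite -{1}mh pp_valE.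
have := same_component_agree (@pp_liftP nu)
  (cover_comp m (tens_inr _ _)) (cover_comp (pullback_map f m0) (tens_inl _ _)).
rewrite !fiber_map_comp !fiber_tens_inr !fiber_tens_inl -!fiber_up_map.
rewrite -aut_act_nat mh m0h => -[+ _]; exact.
Qed.

End Lifting.

(** * Linear forms on an algebraic closure *)

Section LinearFunctionals.
Variables (k W : fieldType) (iota : {rmorphism k -> W}).

Inductive span (A : W -> Prop) : W -> Prop :=
| span0 : span A 0
| spanD x c a : span A x -> A a -> span A (x + iota c * a).

Lemma span_sub (A B : W -> Prop) x : subs A B -> span A x -> span B x.
Proof. by move=> AB; elim=> [|y c a _ Sy /AB Ba]; [apply: span0|apply: spanD]. Qed.

Lemma span_id (A : W -> Prop) x :
  A 0 -> (forall x c a, A x -> A a -> A (x + iota c * a)) -> span A x -> A x.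
Proof. by move=> A0 AD; elim=> [//|y c a _ Ay Aa]; apply: AD. Qed.

Lemma spanDD (A : W -> Prop) x y : span A x -> span A y -> span A (x + y).
Proof.
move=> Sx; elim=> [|z c a _ Sz Aa]; first by rewrite addr0.
by rewrite addrA; apply: spanD.
Qed.

Lemma spanZ (A : W -> Prop) c x : span A x -> span A (iota c * x).
Proof.
elim=> [|z d a _ Sz Aa]; first by rewrite mulr0; apply: span0.
by rewrite mulrDr mulrA -rmorphM; apply: spanD.
Qed.

Lemma span_add1 (A : W -> Prop) a x : span (add1 A a) x ->
  exists c y, span A y /\ x = y + iota c * a.
Proof.
elim=> [|z d b _ [c [y [Sy ->]]] [Ab|->]].
- by exists 0, 0; split; [apply: span0|rewrite rmorph0 mul0r addr0].
- by exists c, (y + iota d * b); split; [apply: spanD|rewrite addrAC].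
by exists (c + d), y; split=> //; rewrite rmorphD mulrDl addrA.
Qed.

(** A set containing H and maximal among those whose span avoids v is a hyperplane complementary to
    the line of v; l is the coordinate along v. *)
Lemma functional_ex (H : W -> Prop) v : ~ span H v ->
  exists l : W -> k, [/\ linear_form iota l, l v = 1 & forall h, H h -> l h = 0].
Proof.
move=> nHv; have [C|A [HA nAv max]] := @zorn_sets _ (fun A => ~ span A v) _ H nHv.
  move=> [A0 CA0] hC tot.
  have key x : span (chain_union C) x -> exists2 A, C A & span A x.
    elim=> [|y c a _ [A CA Ay] [B CB Ba]]; first by exists A0 => //; apply: span0.
    case: (tot A B CA CB) => h.
      by exists B => //; apply: spanD => //; apply: span_sub Ay.
    by exists A => //; apply: spanD => //; apply: h.
  by move=> /key [A CA]; apply: hC.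
have Aspan x : span A x -> A x.
  move=> Sx; apply: max => /span_add1 [c [y [Sy e]]]; apply: nAv.
  by rewrite e; apply: spanDD => //; apply: spanZ.
have ex x : exists c, A (x - iota c * v).
  case: (classic (A x)) => [Ax|nAx]; first by exists 0; rewrite rmorph0 mul0r subr0.
  have /NNPP /span_add1 [c [y [Sy e]]] : ~ ~ span (add1 A x) v.
    by move=> h; apply: nAx; apply: max.
  have c0 : c != 0.
    by apply/eqP => c0; apply: nAv; rewrite e c0 rmorph0 mul0r addr0.
  exists c^-1; apply: Aspan.
  rewrite e mulrDr mulrA -rmorphM mulVf // rmorph1 mul1r opprD addrCA subrr addr0.
  by rewrite -mulrN -mulN1r -(rmorph1 iota) -rmorphN; do 2 apply: spanZ.
pose l x := projT1 (cid (ex x)).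
have lP x : A (x - iota (l x) * v) by rewrite /l; case: cid.
have AD x y c : A x -> A y -> A (iota c * x + y).
  move=> Ax Ay; apply: Aspan; rewrite addrC; apply: spanD => //.
  by rewrite -[y]add0r -[y]mul1r -(rmorph1 iota); apply: spanD => //; apply: span0.
have uni x c c' : A (x - iota c * v) -> A (x - iota c' * v) -> c = c'.
  move=> h h'; apply/eqP; rewrite -subr_eq0; apply: contraT => n0.
  case: nAv; have := AD _ _ (-1) h h'; rewrite rmorphN1 mulN1r opprB.
  rewrite addrA subrK -mulrBl -rmorphB => h2.
  have -> : v = 0 + iota (c - c')^-1 * (iota (c - c') * v).
    by rewrite add0r mulrA -rmorphM mulVf // rmorph1 mul1r.
  by apply: spanD => //; apply: span0.
exists l; split.
- move=> r x y; apply: (uni (iota r * x + y)) => //.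
  have := AD _ _ r (lP x) (lP y).
  rewrite mulrBr addrACA -opprD mulrA -rmorphM -mulrDl -rmorphD.
  by [].
- apply: (uni v) => //; rewrite rmorph1 mul1r subrr; apply: Aspan; exact: span0.
by move=> h /HA Ah; apply: (uni h) => //; rewrite rmorph0 mul0r subr0.
Qed.

End LinearFunctionals.

Section PowerForms.
Variables (K : fieldType) (W : closedFieldType) (w : {rmorphism K -> W}).
Hypotheses (char0 : [pchar K] =i pred0) (hw : is_algebraic_closure w).

Lemma primitive_seq (s : seq W) : exists z, forall a, a \in s ->
  exists f : {poly K}, pev w f z = a.
Proof.
elim: s => [|a s [z hz]]; first by exists 0.
have [z' [f [g [fa gz]]]] := primitive2 char0 hw a z.
exists z' => c; rewrite inE => /orP [/eqP ->|/hz [h hc]]; first by exists f.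
by exists (h \Po g); rewrite pev_comp gz.
Qed.

Variable z : W.
Let n := (size (minp char0 hw z)).-1.

Lemma minp_size (p : {poly K}) : (size p <= n)%N -> pev w p z = 0 -> p = 0.
Proof.
move=> sp /(minp_dvd char0 hw) d; apply: contraTeq d => p0.
apply/negP => /(dvdp_leq p0); have [_ q1 _] := minp_etale char0 hw z.
by rewrite leqNgt (leq_ltn_trans sp) // /n prednK // ltnW.
Qed.

Lemma power_forms : exists l : 'I_n -> W -> K,
  (forall i, linear_form w (l i)) /\
  forall (p : {poly K}) i, (size p <= n)%N -> l i (pev w p z) = p`_i.
Proof.
pose H (i : 'I_n) a := exists p : {poly K}, [/\ (size p <= n)%N, p`_i = 0 & a = pev w p z].
have hi (i : 'I_n) : exists l : W -> K, [/\ linear_form w l, l (z ^+ i) = 1 &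
    forall h, H i h -> l h = 0].
  apply: functional_ex => Hz; have [||p [sp pi e]] := span_id _ _ Hz.
  - by exists 0; rewrite size_poly0 coef0 pev0.
  - move=> _ c _ [p [sp pi ->]] [p' [sp' pi' ->]]; exists (p + c%:P * p'); split.
    + rewrite (leq_trans (size_polyD _ _)) // geq_max sp mul_polyC.
      exact: leq_trans (size_scale_leq _ _) sp'.
    + by rewrite coefD coefCM pi pi' mulr0 addr0.
    + by rewrite pevD pev_Cmul.
  have /minp_size : pev w ('X^i - p) z = 0.
    by rewrite pevD pevN pevXn pevX e subrr.
  rewrite (leq_trans (size_polyD _ _)) => [/(_ isT)|]; last first.
    by rewrite geq_max size_polyXn ltn_ord size_polyN.
  move/(congr1 (fun q : {poly K} => q`_i)).
  rewrite coefB coefXn eqxx pi subr0 coef0 => /eqP; by rewrite oner_eq0.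
pose l i := projT1 (cid (hi i)).
have lP (i : 'I_n) : [/\ linear_form w (l i), l i (z ^+ i) = 1 & forall h, H i h -> l i h = 0].
  by rewrite /l; case: cid.
exists l; split=> [i|p i sp]; first by have [] := lP i.
have [hl l1 l0] := lP i.
have -> : pev w p z = w (p`_i) * z ^+ i + pev w (p - (p`_i)%:P * 'X^i) z.
  by rewrite pevD pevN pev_Cmul pevXn pevX addrC subrK.
rewrite hl l1 mulr1 l0 ?addr0 //; exists (p - (p`_i)%:P * 'X^i); split=> //.
  rewrite (leq_trans (size_polyD _ _)) // geq_max sp size_polyN mul_polyC.
  by rewrite (leq_trans (size_scale_leq _ _)) // size_polyXn.
by rewrite coefB coefCM coefXn eqxx mulr1 subrr.
Qed.

Lemma pev_powers (f : {poly K}) : exists p : {poly K},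
  (size p <= n)%N /\ pev w f z = pev w p z.
Proof.
exists (f %% minp char0 hw z); split.
  have [_ q1 _] := minp_etale char0 hw z; rewrite -ltnS /n prednK ?(ltnW q1) //.
  by rewrite ltn_modp -size_poly_gt0 ltnW.
by rewrite {1}(divp_eq f (minp char0 hw z)) pevD pevM minp_root mulr0 add0r.
Qed.

End PowerForms.

(** Finitely many elements lie in a common K(z), where powers of z and [power_forms] serve as dual
    bases. *)
Lemma closure_locally_projective (K : fieldType) (W : closedFieldType)
    (w : {rmorphism K -> W}) : [pchar K] =i pred0 -> is_algebraic_closure w ->
  locally_projective w.
Proof.
move=> c0 hw bs; have [z hz] := primitive_seq c0 hw bs.
have [l [hl lP]] := power_forms c0 hw z.
exists (size (minp c0 hw z)).-1, (fun i => z ^+ i), l; split=> // b /hz [f <-].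
have [p [sp ->]] := pev_powers c0 hw z f.
rewrite {1}(pev_wide w z sp); apply: eq_bigr => i _.
by rewrite lP.
Qed.

                                              

(** * Exactness: descending idempotents from kb to a finite extension *)

Lemma pushout_powers (k : fieldType) (q : {poly k}) (A G : comPzRingType)
    (s : {rmorphism k -> A}) (inl : {rmorphism A -> G})
    (r : {rmorphism {poly %/ q} -> G}) : q \is monic -> (1 < size q)%N ->
  finite_etale (qpolyC q : {rmorphism k -> {poly %/ q}}) ->
  is_pushout s (qpolyC q) inl r -> forall g, exists e : 'I_(size q).-1 -> A,
  g = \sum_i inl (e i) * r (in_qpoly q 'X) ^+ i.
Proof.
move=> qm q1 et po g.
have rE (b : {poly %/ q}) :
    r b = \sum_(i < (size q).-1) inl (s ((b : {poly k})`_i)) * r (in_qpoly q 'X) ^+ i.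
  rewrite -{1}(in_qpoly_val b) -(pev_in_qpoly qm q1).
  rewrite (pev_morph (t := inl \o s)) => [|c]; last exact: po.1.
  by rewrite (@pev_wide _ _ _ (size q).-1) // -ltnS prednK ?(ltnW q1) // size_qpoly.
have [l ->] := pushout_gen po (etale_locally_projective et) g.
exists (fun i => \sum_(p <- l) p.1 * s ((p.2 : {poly k})`_i)).
under [RHS]eq_bigr do rewrite rmorph_sum mulr_suml.
rewrite exchange_big; apply: eq_bigr => p _.
rewrite (rE p.2) mulr_sumr; apply: eq_bigr => i _.
by rewrite rmorphM mulrA.
Qed.

(** The coordinate forms of [power_forms], extended to the pushout, read off each coefficient. *)
Lemma pushout_powers_free (k : fieldType) (kb : closedFieldType)
    (iota : {rmorphism k -> kb}) (char0 : [pchar k] =i pred0)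
    (hk : is_algebraic_closure iota) (A B G : comPzRingType)
    (s : {rmorphism k -> A}) (a : {rmorphism A -> B}) (v : {rmorphism kb -> B})
    (inl : {rmorphism A -> G}) (h : {rmorphism G -> B}) z T :
  (forall e, h (inl e) = a e) -> h T = v z -> is_pushout s iota a v ->
  forall c : 'I_(size (minp char0 hk z)).-1 -> A,
  h (\sum_i inl (c i) * T ^+ i) = 0 -> forall i, c i = 0.
Proof.
move=> hinl hT po c h0 i.
have [l [hl lP]] := power_forms char0 hk z.
have [l' hl' l'P] := pushout_form po (hl i).
have term m : l' (h (inl (c m) * T ^+ m)) = c m * s (l i (pev iota 'X^m z)).
  by rewrite rmorphM rmorphXn hinl hT -rmorphXn (lformZ hl') l'P pevXn pevX.
have : l' 0 = 0 by apply: lform0 hl'.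
rewrite -{1}h0 rmorph_sum (lform_sum hl') (bigD1 i) //= big1 => [|m nmi].
  by rewrite term lP ?size_polyXn ?ltn_ord // coefXn eqxx rmorph1 mulr1 addr0.
rewrite term lP ?size_polyXn ?ltn_ord // coefXn eq_sym (inj_eq val_inj) (negPf nmi).
by rewrite rmorph0 mulr0.
Qed.

Section Descent.
Variables (k : fieldType) (kb : closedFieldType) (iota : {rmorphism k -> kb}).
Hypotheses (char0 : [pchar k] =i pred0) (hk : is_algebraic_closure iota).
Variables (X : variety k) (E : etale_cover (base_change X idfun)).

Let Y := base_change X (idfun : {rmorphism k -> k}).
Let Yb := base_change X iota.
Let f : site_map iota Yb Y := bc_proj X iota.

Section Chart.
Variables (S : {set 'I_(nchart X)}) (hS : S != set0).

Definition chart_kb : comPzRingType := tens (scal X S) iota.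
Definition chart_in : {rmorphism chart X S -> chart_kb} := tinA (scal X S) iota.
Definition kb_in : {rmorphism kb -> chart_kb} := tinB (scal X S) iota.

Lemma chart_kb_po : is_pushout (scal X S) iota chart_in kb_in.
Proof. exact: tens_pushout (closure_locally_projective char0 hk). Qed.

Lemma chart_pt_subproof c : (idfun : {rmorphism chart X S -> chart X S})
  (scal X S c) = scal X S (idfun c).
Proof. by []. Qed.

Definition chart_pt : spt Y (scal X S) := @BcPt k X k idfun _ _ S hS idfun chart_pt_subproof.

Lemma chart_ptb_subproof c : chart_in (scal X S c) = kb_in (iota c).
Proof. exact: (esym (chart_kb_po.1 c)). Qed.

Definition chart_ptb : spt Yb kb_in := @BcPt k X kb iota _ _ S hS chart_in chart_ptb_subproof.

Lemma chart_arrow : @arrow k Y _ _ _ _ chart_in chart_pt (sm f chart_ptb).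
Proof.
split=> [c|]; first exact: chart_ptb_subproof.
by exists (subxx _) => a; rewrite /= res_id.
Qed.

(** The algebra of E over a chart; [ESb] is its base change to kb, and [GS] below its base change to
    k[X]/(minp z), a model of k(z). *)
Definition ES : comPzRingType := calg E chart_pt.
Definition ESb : comPzRingType := calg E (sm f chart_ptb).
Definition to_ESb : {rmorphism ES -> ESb} := cmap E chart_arrow.
Definition kES : {rmorphism k -> ES} := kstr E chart_pt.
Definition kESb : {rmorphism kb -> ESb} := cstr E (sm f chart_ptb) \o kb_in.

Lemma ESb_po : is_pushout kES iota to_ESb kESb.
Proof. exact: pushout_paste chart_kb_po (pushout_sym (cmap_push E chart_arrow)). Qed.

Lemma ESb_gen (b : ESb) : exists l : seq (ES * kb),
  b = \sum_(p <- l) to_ESb p.1 * kESb p.2.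
Proof. exact: (pushout_gen ESb_po (closure_locally_projective char0 hk)). Qed.

Variable z : kb.
Let q := minp char0 hk z.
Let hq : etale_poly q := minp_etale char0 hk z.
Let C := cover_poly Y hq.
Let n := (size q).-1.

Definition GS : comPzRingType := calg (cover_tens E C) chart_pt.
Definition GSl : {rmorphism ES -> GS} := ct_inl E C chart_pt.
Definition GSr : {rmorphism calg C chart_pt -> GS} := ct_inr E C chart_pt.
Definition GSgen : GS := GSr (gen_val hq chart_pt).

Lemma to_ESb_C_ex : exists h : {rmorphism calg C chart_pt -> ESb},
  (forall r, h (cstr C chart_pt r) = cstr E (sm f chart_ptb) (chart_in r)) /\
  h (gen_val hq chart_pt) = kESb z.
Proof.
apply: (@cp_lift _ _ q hq _ _ chart_pt ESb (cstr E (sm f chart_ptb) \o chart_in)).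
transitivity (kESb (pev iota q z)); last by rewrite minp_root rmorph0.
by apply/esym/pev_morph => c /=; rewrite chart_ptb_subproof.
Qed.

Lemma GS_to_ESb_ex : exists h : {rmorphism GS -> ESb},
  [/\ forall e, h (GSl e) = to_ESb e,
      forall r, h (GSr (cstr C chart_pt r)) = cstr E (sm f chart_ptb) (chart_in r) &
      h GSgen = kESb z].
Proof.
have [h [h1 h2]] := to_ESb_C_ex.
have [|t [t1 t2]] := pushout_hom (ct_po E C chart_pt) (f := to_ESb) (g := h).
  by move=> r; rewrite h1; apply: (cmap_push E chart_arrow).1.
by exists t; split=> [//|r|]; rewrite /GSgen t2.
Qed.

Definition GS_to_ESb := projT1 (cid GS_to_ESb_ex).

Lemma GS_to_ESb_l e : GS_to_ESb (GSl e) = to_ESb e.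
Proof. by rewrite /GS_to_ESb; case: cid => h []. Qed.
Lemma GS_to_ESb_r r : GS_to_ESb (GSr (cstr C chart_pt r)) =
  cstr E (sm f chart_ptb) (chart_in r).
Proof. by rewrite /GS_to_ESb; case: cid => h []. Qed.
Lemma GS_to_ESb_gen : GS_to_ESb GSgen = kESb z.
Proof. by rewrite /GS_to_ESb; case: cid => h []. Qed.

Lemma GS_powers (g : GS) : exists e : 'I_n -> ES,
  g = \sum_i GSl (e i) * GSgen ^+ i.
Proof.
have [qm q1 _] := hq.
apply: (pushout_powers qm q1 (sq_et hq)
  (pushout_paste (cp_po hq chart_pt) (ct_po E C chart_pt))).
Qed.

Lemma GS_to_ESb_inj (g g' : GS) : GS_to_ESb g = GS_to_ESb g' -> g = g'.
Proof.
move=> e; apply/eqP; rewrite -subr_eq0; apply/eqP.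
have : GS_to_ESb (g - g') = 0 by rewrite rmorphB e subrr.
have [c ->] := GS_powers (g - g').
move/(pushout_powers_free GS_to_ESb_l GS_to_ESb_gen ESb_po) => c0.
by rewrite big1 // => i _; rewrite c0 rmorph0 mul0r.
Qed.

Lemma GS_to_ESb_surj (l : seq (ES * kb)) :
  (forall p, p \in l -> exists p0, pev iota p0 z = p.2) ->
  exists g, GS_to_ESb g = \sum_(p <- l) to_ESb p.1 * kESb p.2.
Proof.
elim: l => [|p l IH] h; first by exists 0; rewrite rmorph0 big_nil.
have [|g gE] := IH; first by move=> p' pl; apply: h; rewrite inE pl orbT.
have [p0 e0] := h p (mem_head _ _).
exists (GSl p.1 * pev (GSr \o kstr C chart_pt) p0 GSgen + g).
rewrite rmorphD rmorphM gE big_cons GS_to_ESb_l; congr (_ * _ + _).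
rewrite (pev_morph (t := kESb \o iota)) => [|c].
  by rewrite GS_to_ESb_gen -e0; apply/esym/pev_morph.
by rewrite [LHS]GS_to_ESb_r chart_ptb_subproof.
Qed.

End Chart.

Section Restriction.
Variables (S T : {set 'I_(nchart X)}) (hS : S != set0) (hT : T != set0).
Variable (hST : S \subset T).

Lemma res_arrow : @arrow k Y _ _ _ _ (res hST) (chart_pt hS) (chart_pt hT).
Proof.
split=> [c|]; first exact: res_scal.
by exists hST.
Qed.

Lemma resb_ex : exists u : {rmorphism chart_kb S -> chart_kb T},
  (forall a, u (chart_in S a) = chart_in T (res hST a)) /\
  (forall a, u (kb_in S a) = kb_in T a).
Proof.
apply: (pushout_hom (chart_kb_po S) (f := chart_in T \o res hST) (g := kb_in T)).
by move=> c /=; rewrite res_scal chart_ptb_subproof.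
Qed.

Definition resb := projT1 (cid resb_ex).
Lemma resb_in a : resb (chart_in S a) = chart_in T (res hST a).
Proof. by rewrite /resb; case: cid => u []. Qed.
Lemma resb_kb a : resb (kb_in S a) = kb_in T a.
Proof. by rewrite /resb; case: cid => u []. Qed.

Lemma resb_arrow : @arrow kb Yb _ _ _ _ resb (chart_ptb hS) (chart_ptb hT).
Proof.
split=> [c|]; first exact: resb_kb.
by exists hST => a; rewrite /= resb_in.
Qed.

Variable z : kb.
Let C := cover_poly Y (minp_etale char0 hk z).

Lemma GS_res (g : GS hS z) :
  GS_to_ESb hT z (cmap (cover_tens E C) res_arrow g) =
  cmap E (sm_arrow f resb_arrow) (GS_to_ESb hS z g).
Proof.
pose h1 : {rmorphism GS hS z -> ESb hT} := GS_to_ESb hT z \o cmap (cover_tens E C) res_arrow.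
pose h2 : {rmorphism GS hS z -> ESb hT} := cmap E (sm_arrow f resb_arrow) \o GS_to_ESb hS z.
apply: (pushout_eq (ct_po E C (chart_pt hS)) (h := h1) (h' := h2)) => b /=.
  rewrite ct_mapl [LHS]GS_to_ESb_l [X in _ = cmap E _ X]GS_to_ESb_l.
  have ar : @arrow k Y _ _ _ _ (chart_in T \o res hST) (chart_pt hS) (sm f (chart_ptb hT)).
    split=> [c|] /=; first by rewrite res_scal chart_ptb_subproof.
    by exists hST.
  have /= <- := cmap_comp (e0 := E) res_arrow (chart_arrow hT) ar (frefl _) b.
  apply: (cmap_comp (e0 := E) (chart_arrow hS) (sm_arrow f resb_arrow) ar) => c.
  by rewrite /= resb_in.
apply: (cp_ext (h := h1 \o GSr hS z) (h' := h2 \o GSr hS z)) => [r|] /=.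
  rewrite [X in GS_to_ESb hT z X]ct_mapr (cmap_push C res_arrow).1.
  rewrite [LHS]GS_to_ESb_r [X in _ = cmap E _ X]GS_to_ESb_r.
  rewrite (cmap_push E (sm_arrow f resb_arrow)).1.
  by rewrite resb_in.
rewrite [X in GS_to_ESb hT z X]ct_mapr.
have -> : cmap C res_arrow (gen_val (minp_etale char0 hk z) (chart_pt hS)) =
   gen_val (minp_etale char0 hk z) (chart_pt hT) by apply: gen_nat.
rewrite [LHS]GS_to_ESb_gen [X in _ = cmap E _ X]GS_to_ESb_gen.
by rewrite /kESb /= (cmap_push E (sm_arrow f resb_arrow)).1 resb_kb.
Qed.

End Restriction.

Section Global.
Variables (v : nsection (pullback f E)) (vi : idem_section v).

(** On each of the finitely many charts v involves finitely many elements of kb, and all of them lie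
    in one k(z). *)
Lemma section_field : exists z, forall S (hS : S != set0),
  exists g : GS hS z, GS_to_ESb hS z g = nval v (chart_ptb hS).
Proof.
have gen S : exists ls : seq kb, forall hS : S != set0, exists l : seq (ES hS * kb),
    nval v (chart_ptb hS) = \sum_(p <- l) to_ESb hS p.1 * kESb hS p.2 /\
    forall p, p \in l -> p.2 \in ls.
  case: (classic (S != set0)) => [hS|h]; last by exists [::] => hS; case: (h hS).
  have [l lE] := ESb_gen (nval v (chart_ptb hS) : ESb hS).
  exists [seq p.2 | p <- l] => hS'; rewrite (bool_irrelevance hS' hS).
  by exists l; split=> // p pl; apply: map_f.
pose ls S := projT1 (cid (gen S)).
have [z hz] := primitive_seq char0 hk (flatten [seq ls V | V <- enum {set 'I_(nchart X)}]).
exists z => S hS.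
have [l [-> lP]] : exists l : seq (ES hS * kb),
    nval v (chart_ptb hS) = \sum_(p <- l) to_ESb hS p.1 * kESb hS p.2 /\
    forall p, p \in l -> p.2 \in ls S.
  by rewrite /ls; case: cid => l /= /(_ hS).
apply: GS_to_ESb_surj => p /lP pl; apply: hz.
by apply/flatten_mapP; exists S; rewrite ?mem_enum.
Qed.

Variable z : kb.
Hypothesis hz : forall S (hS : S != set0),
  exists g : GS hS z, GS_to_ESb hS z g = nval v (chart_ptb hS).
Let hq := minp_etale char0 hk z.
Let C := cover_poly Y hq.

Definition desc_chart S (hS : S != set0) : GS hS z := projT1 (cid (hz hS)).

Lemma desc_chartE S (hS : S != set0) :
  GS_to_ESb hS z (desc_chart hS) = nval v (chart_ptb hS).
Proof. by rewrite /desc_chart; case: cid. Qed.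

Lemma desc_chart_res S T (hS : S != set0) (hT : T != set0) (hST : S \subset T) :
  cmap (cover_tens E C) (res_arrow hS hT hST) (desc_chart hS) = desc_chart hT.
Proof.
apply: (GS_to_ESb_inj (z := z)); rewrite GS_res !desc_chartE.
exact: (nval_nat v (resb_arrow hS hT hST)).
Qed.

Lemma desc_chart_idem S (hS : S != set0) :
  desc_chart hS * desc_chart hS = desc_chart hS.
Proof.
apply: (GS_to_ESb_inj (z := z)); rewrite rmorphM desc_chartE.
exact: vi.
Qed.

Lemma bval_arrow (R : comPzRingType) (e : {rmorphism k -> R}) (pt : spt Y e) :
  @arrow k Y _ _ _ _ (bval pt) (chart_pt (bset_neq0 pt)) pt.
Proof.
split=> [c|]; first exact: (bvalk pt).
by exists (subxx _) => a; rewrite /= res_id.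
Qed.

(** Each point lies in a chart, so the value is transported from there. Injectivity of [GS_to_ESb]
    makes the descended elements of different charts compatible. *)
Definition desc_val (R : comPzRingType) (e : {rmorphism k -> R}) (pt : spt Y e) :
  calg (cover_tens E C) pt :=
  cmap (cover_tens E C) (bval_arrow pt) (desc_chart (bset_neq0 pt)).

Lemma desc_nat (R R' : comPzRingType) (e : {rmorphism k -> R})
    (e' : {rmorphism k -> R'}) (u : {rmorphism R -> R'}) (pt : spt Y e)
    (pt' : spt Y e') (a : arrow u pt pt') :
  cmap (cover_tens E C) a (desc_val pt) = desc_val pt'.
Proof.
have [_ [hST hu]] := a.
rewrite /desc_val -(desc_chart_res (bset_neq0 pt) (bset_neq0 pt') hST).
have ar : @arrow k Y _ _ _ _ (u \o bval pt) (chart_pt (bset_neq0 pt)) pt'.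
  split=> [c|]; first by rewrite /= (bvalk pt) a.1.
  by exists hST => c; rewrite /= hu.
have /= <- := cmap_comp (e0 := cover_tens E C) (bval_arrow pt) a ar (frefl _)
  (desc_chart (bset_neq0 pt)).
apply: (cmap_comp (e0 := cover_tens E C)
  (res_arrow (bset_neq0 pt) (bset_neq0 pt') hST) (bval_arrow pt') ar) => c.
exact: hu.
Qed.

Definition desc_section := NSection desc_nat.

Lemma desc_section_idem : idem_section desc_section.
Proof. by move=> R e pt; rewrite /= -rmorphM desc_chart_idem. Qed.

Section Point.
Variable x : bc_pt X idfun iota.
Let y : spt Y iota := x.
Let yb : spt Yb idfun := geom_pt_bar x.
Let hb := @geom_arrow k X kb iota kb kb iota idfun idfun (frefl _) x.

Let S := bset x.
Let hS : S != set0 := bset_neq0 x.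

Lemma kbpt_ex : exists u : {rmorphism chart_kb S -> kb},
  (forall a, u (chart_in S a) = bval x a) /\ (forall a, u (kb_in S a) = a).
Proof.
apply: (pushout_hom (chart_kb_po S) (f := bval x) (g := idfun)) => c.
exact: (bvalk x).
Qed.

(** Both sides are ring homomorphisms on the chart algebra [GS] applied to the same element; they
    agree on E, on the base and on the generator, which goes to z. *)
Lemma desc_section_point (t : fiber y E) :
  fiber_tens t (fiber_poly y hq (minp_root char0 hk z)) (nval desc_section y) =
  fiber_up hb t (nval v yb).
Proof.
have [u [u1 u2]] := kbpt_ex.
have ub : @arrow kb Yb _ _ _ _ u (chart_ptb hS) yb.
  split=> [c|]; first exact: u2.
  by exists (subxx _) => a; rewrite /= res_id u1.
set ps := fiber_poly _ _ _.
rewrite -(nval_nat v ub) -desc_chartE /=.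
pose h1 : {rmorphism GS hS z -> kb} := fiber_tens t ps \o cmap (cover_tens E C) (bval_arrow y).
pose h2 : {rmorphism GS hS z -> kb} := fiber_up hb t \o cmap E (sm_arrow f ub) \o GS_to_ESb hS z.
have tl b : fiber_tens t ps (ct_inl E C y b) = t b.
  by have := congr1 (fun h : fiber y E => h b) (fiber_tens_inl t ps).
have tr b : fiber_tens t ps (ct_inr E C y b) = ps b.
  by have := congr1 (fun h : fiber y C => h b) (fiber_tens_inr t ps).
have up_str r : fiber_up hb t (cstr E (sm f yb) r) = r by apply: (fibP (fiber_up hb t)).
apply: (pushout_eq (ct_po E C (chart_pt hS)) (h := h1) (h' := h2)) => b /=.
  rewrite ct_mapl tl [X in _ = fiber_up hb t (cmap E _ X)]GS_to_ESb_l.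
  rewrite -[LHS](fiber_upE hb); congr (fiber_up hb t _).
  have ar : @arrow k Y _ _ _ _ (idfun \o bval x) (chart_pt hS) (sm f yb).
    split=> [c|] /=; first exact: (bvalk x).
    by exists (subxx _) => a; rewrite /= res_id.
  have /= <- := cmap_comp (e0 := E) (bval_arrow y) hb ar (frefl _) b.
  apply: (cmap_comp (e0 := E) (chart_arrow hS) (sm_arrow f ub) ar) => c.
  by rewrite /= u1.
apply: (cp_ext (h := h1 \o GSr hS z) (h' := h2 \o GSr hS z)) => [r|] /=.
  rewrite [X in fiber_tens t ps X]ct_mapr tr (cmap_push C (bval_arrow y)).1.
  rewrite [X in _ = fiber_up hb t (cmap E _ X)]GS_to_ESb_r.
  rewrite (cmap_push E (sm_arrow f ub)).1 up_str u1.
  exact: (fibP ps).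
rewrite [X in fiber_tens t ps X]ct_mapr tr.
rewrite [X in _ = fiber_up hb t (cmap E _ X)]GS_to_ESb_gen.
have -> : cmap C (bval_arrow y) (gen_val hq (chart_pt hS)) = gen_val hq y by apply: gen_nat.
rewrite fiber_polyE /kESb /= (cmap_push E (sm_arrow f ub)).1 up_str u2.
by [].
Qed.

End Point.
End Global.

(** The idempotent descends to the product of E with the cover defined by the minimal polynomial of
    z. As g fixes z, it moves (t, z) to (g t, z), and [aut_idem] equates the two values. *)
Lemma ker_same_component (x : bc_pt X idfun iota) (g : etale_pi1 x)
    (t : fiber (x : spt Y iota) E) : pi1_proj x g = 1%tg ->
  same_component (fiber_up (@geom_arrow k X kb iota kb kb iota idfun idfun (frefl _) x) t)
    (fiber_up (@geom_arrow k X kb iota kb kb iota idfun idfun (frefl _) x) (aut_act g t)).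
Proof.
move=> g1 v vi; have [z hz] := section_field v.
rewrite -!(desc_section_point hz); set psi := fiber_poly _ _ _.
have fix_psi : aut_act g psi = psi.
  apply: fiber_poly_ext; rewrite (augval_poly char0 hk) -(pi1_galoisE char0 hk).
  by have -> : pi1_galois g = 1%tg := g1.
have := aut_idem g (fiber_tens t psi) (desc_section_idem vi hz).
by rewrite aut_tens fix_psi => ->.
Qed.

End Descent.

Lemma pi1_exact (k : fieldType) (kb : closedFieldType) (iota : {rmorphism k -> kb})
    (X : variety k) (x : bc_pt X idfun iota) (g : etale_pi1 x) :
  [pchar k] =i pred0 -> is_algebraic_closure iota -> pi1_proj x g = 1%tg ->
  exists u, pi1_bar u = g.
Proof.
move=> char0 hk g1.
have [u uE] := @lift_aut _ _ _ _ _ _ _ _ _ _ _ _ _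
  (@geom_arrow k X kb iota kb kb iota idfun idfun (frefl _) x) g
  (fun E t => ker_same_component char0 hk (t := t) g1).
by exists u.
Qed.

                                               

(** * Galois theory of the algebraic closure *)

Section GaloisClosure.
Variables (K : fieldType) (W : closedFieldType) (w : {rmorphism K -> W}).
Hypotheses (char0 : [pchar K] =i pred0) (hw : is_algebraic_closure w).
Notation minp := (minp char0 hw).
Notation Gam := (gal_group w).

Lemma minp_neq0 a : minp a != 0.
Proof. by have [_ q1 _] := minp_etale char0 hw a; rewrite -size_poly_gt0 ltnW. Qed.

Lemma minp_pev_dvd a b p : pev w (minp a) b = 0 -> pev w p a = 0 -> pev w p b = 0.
Proof. by move=> mb /(minp_dvd char0 hw) /pev_dvd; apply. Qed.

Lemma minp_roots a : exists rs : seq W, forall b, pev w (minp a) b = 0 <-> b \in rs.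
Proof.
have [rs rsE] := closed_field_poly_normal (map_poly w (minp a)).
exists rs => b; rewrite pev_horner rsE hornerZ horner_prod.
have l0 : lead_coef (map_poly w (minp a)) != 0.
  by rewrite lead_coef_eq0 map_poly_eq0 minp_neq0.
split=> [/eqP|br].
  rewrite mulf_eq0 (negPf l0) prodf_seq_eq0 => /hasP [z zr /=].
  by rewrite !hornerE subr_eq0 => /eqP ->.
by rewrite (big_rem b) //= hornerXsubC subrr mul0r mulr0.
Qed.

Lemma gal_pev (s : Gam) p a : s (pev w p a) = pev w p (s a).
Proof. by apply: pev_morph => c; apply: gfun_id. Qed.

Lemma gal_minp (s : Gam) a b : pev w (minp a) b = 0 -> pev w (minp a) (s b) = 0.
Proof. by move=> h; rewrite -gal_pev h rmorph0. Qed.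

                                                                           
                                                                                
(** Eliminating Y from minp z (Y) and X - f(Y) gives a polynomial in X over K whose roots are the
    f(z'), with z' conjugate to z. It vanishes at f(z), hence at the conjugate b. *)
Lemma conj_lift z f b : pev w (minp (pev w f z)) b = 0 ->
  exists2 z', pev w (minp z) z' = 0 & pev w f z' = b.
Proof.
(* The resultant specializes well if the leading coefficient of X - f(Y) in Y is a constant, so
   constant f is treated apart. *)
move=> ab; case: (ltnP 1 (size f)) => [f1|/size1_polyC fc]; last first.
  exists z; first exact: minp_root.
  have e : pev w f z = w f`_0 by rewrite {1}fc pevC.
  have : pev w ('X - (f`_0)%:P) b = 0.
    by apply: minp_pev_dvd ab _; rewrite pevD pevN pevX pevC e subrr.
  by rewrite e pevD pevN pevX pevC => /eqP; rewrite subr_eq0 => /eqP.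
pose M : {poly {poly K}} := map_poly polyC (minp z).
pose Q : {poly {poly K}} := 'X%:P - map_poly polyC f.
have ev c : exists h : {rmorphism {poly K} -> W}, forall p, h p = pev w p c.
  have [||h hE] := @rmorphism_of _ _ (fun p => pev w p c); last by exists h.
    by move=> p q; rewrite pevD pevN.
  by split=> [|p q]; rewrite ?pev1 ?pevM.
have [m_monic _ _] := minp_etale char0 hw z.
have lQ : lead_coef Q = - (lead_coef f)%:P.
  rewrite /Q lead_coefDr ?lead_coefN ?lead_coef_map_inj //; first exact: polyC_inj.
  rewrite size_polyN size_map_inj_poly //; last exact: polyC_inj.
  exact: leq_ltn_trans (size_polyC_leq1 _) f1.
have resE c : pev w (resultant M Q) c = 0 <->
    exists2 z', pev w (minp z) z' = 0 & pev w f z' = c.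
  have [h hE] := ev c; rewrite -hE map_resultant; last first.
  - rewrite lQ rmorphN hE pevC oppr_eq0 fmorph_eq0 lead_coef_eq0.
    by apply/eqP => f0; rewrite f0 size_poly0 in f1.
  - rewrite lead_coef_map_inj // ?(monicP m_monic) ?hE ?pevC ?rmorph1 ?oner_eq0 //.
    exact: polyC_inj.
  have hM : map_poly h M = map_poly w (minp z).
    by apply/polyP => i; rewrite !coef_map /= hE pevC.
  have hQ : map_poly h Q = c%:P - map_poly w f.
    rewrite rmorphB /= map_polyC /= hE pevX; congr (_ - _).
    by apply/polyP => i; rewrite !coef_map /= hE pevC.
  rewrite hM hQ; split=> [/eqP|[z' mz fz]].
    rewrite resultant_eq0 => g1.
    have /closed_rootP [z' zr] :
        size (gcdp (map_poly w (minp z)) (c%:P - map_poly w f)) != 1%N.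
      by rewrite neq_ltn g1 orbT.
    move: zr; rewrite root_gcd !rootE !hornerE -!pev_horner subr_eq0.
    by move=> /andP [/eqP h1 /eqP h2]; exists z'.
  apply/eqP; rewrite resultant_eq0 ltnNge; apply/negP => /size1_polyC gc.
  have : root (gcdp (map_poly w (minp z)) (c%:P - map_poly w f)) z'.
    by rewrite root_gcd !rootE !hornerE -!pev_horner mz fz subrr eqxx.
  rewrite gc rootC -polyC_eq0 -gc gcdp_eq0 map_poly_eq0.
  by rewrite (negPf (minp_neq0 z)).
apply/resE; apply: minp_pev_dvd ab _; apply/resE; exists z => //.
exact: minp_root.
Qed.

Lemma gal_roots_ultra (T : Type) (F : (T -> Prop) -> Prop) (s : T -> W) a :
  ultrafilter F -> F (fun t => pev w (minp a) (s t) = 0) ->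
  exists v, F (fun t => s t = v).
Proof.
move=> uF h; have [rs hrs] := minp_roots a.
apply: (ultra_fin uF (e := fun i : 'I_(size rs) => rs`_i)).
apply: (ultraS uF _ h) => t /hrs /(nthP 0) [i lt_i e].
by exists (Ordinal lt_i).
Qed.

(** An endomorphism over K permutes the finite set of roots of each minimal polynomial, so it is
    surjective. *)
Lemma gal_of_endo (s : {rmorphism W -> W}) : (forall c, s (w c) = w c) ->
  exists g : Gam, g =1 s.
Proof.
move=> sw; have inj : injective s by apply: fmorph_inj.
have surj a : exists b, s b = a.
  have [rs hrs] := minp_roots a.
  pose T := {b : W | pev w (minp a) b = 0}.
  have lT : listed T.
    apply: (listed_inj (F := 'I_(size rs).+1) (g := fun b : T => inord (index (sval b) rs))).
    move=> [b hb] [b' hb'] /= /(congr1 val) /=; rewrite !inordK ?ltnS ?index_size //.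
    move=> e; have eb : b = b'.
      by rewrite -(nth_index 0 ((hrs b).1 hb)) e nth_index //; apply/hrs.
    by subst b'; congr exist; apply: Prop_irrelevance.
  have st (b : T) : pev w (minp a) (s (sval b)) = 0.
    by case: b => b hb /=; rewrite -(pev_morph (s := w) (g := s)) // hb rmorph0.
  have [|b] := @listed_surj T (fun b => exist _ (s (sval b)) (st b)) lT _
    (exist _ a (minp_root char0 hw a)).
    by move=> [b hb] [b' hb'] [/inj e]; subst b'; congr exist; apply: Prop_irrelevance.
  by case=> e; exists (sval b).
pose s' a := projT1 (cid (surj a)).
have s'K : cancel s' s by move=> a; rewrite /s'; case: cid.
have sK : cancel s s' by move=> a; apply: inj; rewrite s'K.
have [||t tE] := @rmorphism_of _ _ s'.
- by move=> a b; apply: inj; rewrite rmorphB !s'K.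
- by split=> [|a b]; apply: inj; rewrite ?rmorphM !s'K ?rmorph1.
have sK' : cancel s t by move=> a; rewrite tE sK.
have tK' : cancel t s by move=> a; rewrite tE s'K.
by exists (GaloisAut sK' tK' sw).
Qed.

(** For each z with a in K(z), [conj_lift] gives an embedding of K(z) that sends a to b. The
    automorphism is the limit of these along an ultrafilter of elements z for which K(z) eventually
    contains any given element. *)
Lemma gal_transitive a b : pev w (minp a) b = 0 -> exists g : Gam, g a = b.
Proof.
move=> ab; pose B c z := exists f, pev w f z = c.
have Bup c z z' : B c z -> B z z' -> B c z'.
  by move=> [f <-] [g <-]; exists (f \Po g); rewrite pev_comp.
have [|F uF bF] := @ultra_exists W (fun A => exists c, A = B c).
  move=> A mA; suff [z hz] : exists z, forall z', B z z' -> A z'.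
    by exists z; apply: hz; exists 'X; rewrite pevX.
  elim: mA => [|C D [c ->] _ [z hz]]; first by exists 0.
  have [z' [f [g [fc gz]]]] := primitive2 char0 hw c z.
  exists z' => z'' h; split; first by apply: Bup h; exists f.
  by apply: hz; apply: Bup h; exists g.
have FB c : F (B c) by apply: bF; exists c.
have conj z : B a z -> exists z', pev w (minp z) z' = 0 /\
    forall f, pev w f z = a -> pev w f z' = b.
  move=> [f fa]; have [|z' mz fz] := @conj_lift z f b; first by rewrite fa.
  exists z'; split=> // g ga; rewrite -fz; apply/eqP; rewrite -subr_eq0.
  rewrite -pevN -pevD; apply/eqP; apply: minp_pev_dvd mz _.
  by rewrite pevD pevN ga fa subrr.
pose cz z := epsilon (inhabits 0) (fun z' => pev w (minp z) z' = 0 /\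
    forall f, pev w f z = a -> pev w f z' = b).
have czP z : B a z -> pev w (minp z) (cz z) = 0 /\
    forall f, pev w f z = a -> pev w f (cz z) = b.
  by move=> /conj; apply: epsilon_spec.
pose val z c := epsilon (inhabits 0) (fun v => exists f,
  pev w f z = c /\ pev w f (cz z) = v).
have valE z f : B a z -> val z (pev w f z) = pev w f (cz z).
  move=> /czP [mz _]; rewrite /val.
  have [|g [e <-]] := epsilon_spec (inhabits 0) (fun v => exists g,
    pev w g z = pev w f z /\ pev w g (cz z) = v).
    by exists (pev w f (cz z)), f.
  apply/eqP; rewrite -subr_eq0 -pevN -pevD; apply/eqP; apply: minp_pev_dvd mz _.
  by rewrite pevD pevN e subrr.
have lim c : exists v, F (fun z => val z c = v).
  apply: (gal_roots_ultra (a := c) uF).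
  apply: (ultraS uF _ (ultraI uF (FB c) (FB a))) => z [[f <-] Ba].
  rewrite valE // -pev_comp; apply: minp_pev_dvd (czP z Ba).1 _.
  by rewrite pev_comp minp_root.
pose s c := projT1 (cid (lim c)).
have sP c : F (fun z => val z c = s c) by rewrite /s; case: cid.
have at2 c d e : exists z f g, [/\ B a z, pev w f z = c, pev w g z = d,
    val z e = s e & val z c = s c /\ val z d = s d].
  have [z [[[Ba [f fc]] [[g gd] se]] [sc sd]]] := ultra_ex uF (ultraI uF
    (ultraI uF (ultraI uF (FB a) (FB c)) (ultraI uF (FB d) (sP e)))
    (ultraI uF (sP c) (sP d))).
  by exists z, f, g.
have [||t tE] := @rmorphism_of _ _ s.
- move=> c d; have [z [f [g [Ba fc gd <- [<- <-]]]]] := at2 c d (c - d).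
  by rewrite -fc -gd -pevN -pevD !valE // pevD pevN.
- split=> [|c d].
    have [z [f [g [Ba _ _ <- _]]]] := at2 0 0 1.
    by rewrite -(pev1 w z) valE // !pev1.
  have [z [f [g [Ba fc gd <- [<- <-]]]]] := at2 c d (c * d).
  by rewrite -fc -gd -pevM !valE // pevM.
have [|g gE] := @gal_of_endo t.
  move=> c; rewrite tE; have [z [f [g [Ba _ _ <- _]]]] := at2 0 0 (w c).
  by rewrite -(pevC w c z) valE // !pevC.
exists g; rewrite gE tE; have [z [f [h [Ba fa _ _ [<- _]]]]] := at2 a a a.
by rewrite -{1}fa valE //; apply: (czP z Ba).2.
Qed.

(** By transitivity a is the only root of its separable minimal polynomial, which is therefore
    linear. *)
Lemma gal_fixed a : (forall g : Gam, g a = a) -> exists c, w c = a.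
Proof.
move=> fa; have [qm q1 qs] := minp_etale char0 hw a.
have [rs rsE] := closed_field_poly_normal (map_poly w (minp a)).
have [mrs lc] : (forall b, b \in rs -> b = a) /\ lead_coef (map_poly w (minp a)) = 1.
  split; last by rewrite lead_coef_map (monicP qm) rmorph1.
  move=> b br; have [|g <-] := @gal_transitive a b; last exact: fa.
  rewrite pev_horner rsE hornerZ horner_prod (big_rem b) //= hornerXsubC subrr.
  by rewrite mul0r mulr0.
rewrite lc scale1r in rsE.
have sz : size (map_poly w (minp a)) = (size rs).+1.
  by rewrite rsE size_prod_XsubC.
have rs1 : uniq rs.
  rewrite -separable_prod_XsubC -rsE separable_map.
  by rewrite unlock.
have : (size rs <= 1)%N.
  case: rs mrs rs1 {rsE sz} => [|b [|c rs]] //= mrs.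
  by rewrite (mrs b) ?mem_head // (mrs c) ?inE ?eqxx ?orbT // in_cons eqxx.
rewrite -ltnS -sz size_map_poly => sq2.
have qE : minp a = ((minp a)`_0)%:P + 'X.
  apply/polyP => i; rewrite coefD coefC coefX.
  case: i => [|[|i]] /=; rewrite ?addr0 ?add0r //.
    have := monicP qm; rewrite /lead_coef.
    by have -> : size (minp a) = 2%N by apply/eqP; rewrite eqn_leq sq2 q1.
  by rewrite nth_default // (leq_trans sq2).
exists (- (minp a)`_0); have := minp_root char0 hw a.
rewrite {1}qE pevD pevC pevX addrC => /eqP; rewrite addr_eq0 => /eqP e.
by rewrite rmorphN -e.
Qed.

Lemma gal_profinite : profinite Gam.
Proof.
have openE (s : seq W) : exists2 V : normal_subgroup Gam, topen V &
    forall g, V g -> {in s, forall a, g a = a}.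
  (* All conjugates of the elements of s are fixed, which makes V normal. *)
  pose V (g : Gam) := forall a b, a \in s -> pev w (minp a) b = 0 -> g b = b.
  have sV : is_subgroup V.
    split=> [a b //|g h Vg Vh a b sa ab|g Vg a b sa ab] /=.
      by rewrite (Vh a) // (Vg a).
    by rewrite -{1}(Vg a b sa ab) gfunK.
  have nV g h : V g -> V (h * g * h^-1)%tg.
    move=> Vg a b sa ab /=; rewrite (Vg a) ?gfunVK //.
    exact: (gal_minp (h^-1)%tg ab).
  exists (NormalSubgroup sV nV); last first.
    by move=> g Vg a sa; apply: (Vg a) => //; apply: minp_root.
  move=> g Vg; exists (flatten [seq projT1 (cid (minp_roots a)) | a <- s]).
  move=> h e a b sa ab; rewrite e; first exact: (Vg a).
  apply/flatten_mapP; exists a => //; case: cid => rs /= hrs; exact/hrs.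
split.
- move=> F uF.
  have lim a : exists v, F (fun g : Gam => g a = v).
    apply: (gal_roots_ultra (a := a) uF); apply: (ultraS uF _ (ultraT uF)) => g _.
    exact: gal_minp (minp_root char0 hw a).
  pose s a := projT1 (cid (lim a)).
  have sP a : F (fun g : Gam => g a = s a) by rewrite /s; case: cid.
  have at3 a b c : exists g : Gam, [/\ g a = s a, g b = s b & g c = s c].
    have [g [ea [eb ec]]] := ultra_ex uF (ultraI uF (sP a) (ultraI uF (sP b) (sP c))).
    by exists g.
  have [||t tE] := @rmorphism_of _ _ s.
  + by move=> a b; have [g [<- <- <-]] := at3 a b (a - b); rewrite rmorphB.
  + split=> [|a b]; first by have [g [<- _ _]] := at3 1 1 1; rewrite rmorph1.
    by have [g [<- <- <-]] := at3 a b (a * b); rewrite rmorphM.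
  have [|g gE] := @gal_of_endo t.
    by move=> c; rewrite tE; have [g [<- _ _]] := at3 (w c) 0 0; rewrite gfun_id.
  exists g => A oA /oA [l hl].
  apply: (ultraS uF _ (ultra_all uF (fun i : 'I_(size l) => sP l`_i))) => h hh.
  apply: hl => a /(nthP 0) [i lt_i <-]; rewrite gE tE; exact: (hh (Ordinal lt_i)).
- move=> A g oA /oA [l hl]; have [V oV hV] := openE l.
  exists V => // v /hV e; apply: hl => a la.
  by rewrite -{2}(e a la) /= gfunVK.
- move=> V g oV v /oV [l hl]; exists l => v' e; apply: hl => a la /=.
  by rewrite e.
move=> g h e; apply: galois_ext => a; have [V oV hV] := openE [:: a].
by have := hV _ (e V oV) a (mem_head _ _) => /= {1}<-; rewrite gfunVK.
Qed.

End GaloisClosure.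

                                                       

(** * Finite group schemes from finite groups with Galois action *)

Lemma etale_separates (K : fieldType) (W : closedFieldType) (w : {rmorphism K -> W})
    (A : comPzRingType) (s : {rmorphism K -> A}) : finite_etale s ->
  forall a, (forall h : {rmorphism A -> W}, (forall c, h (s c) = w c) -> h a = 0) ->
  a = 0.
Proof.
move=> et a ha; have [n [y [z [tr F]]]] := (finite_etale_frame s).1 et.
have po := tens_pushout w (frame_locally_projective F).
have [tr' F' e] := frame_pushout po F.
have va0 : tinB w s a = 0.
  apply/eqP; apply: contraT => /(nonzero_point (finite_etale_pushout po et)) [h hs].
  have /= -> := ha (h \o tinB w s); first by rewrite eqxx.
  by move=> c; rewrite /= po.1 hs.
apply: (frame_nondeg F) => c; apply: (fmorph_inj w).
rewrite -e rmorphM va0 mul0r rmorph0; have [htr' _ _] := F'.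
exact: lform0 htr'.
Qed.

Lemma poly_avoid (K : fieldType) (W : fieldType) (w : {rmorphism K -> W})
    (D : {poly W}) : [pchar K] =i pred0 -> D != 0 -> exists u : K, D.[w u] != 0.
Proof.
move=> /pcharf0P c0 D0; apply: NNPP => no.
have r0 i : root D (w i%:R).
  by rewrite rootE; apply: contraT => h; case: no; exists i%:R.
have inj : injective (fun i : nat => w i%:R : W).
  move=> i j /fmorph_inj; wlog le_ij : i j / (i <= j)%N.
    by move=> H; case/orP: (leq_total i j) => le e; [|apply: esym]; apply: H.
  move=> /esym/eqP; rewrite -subr_eq0 -natrB // c0 subn_eq0 => le_ji.
  by apply/eqP; rewrite eqn_leq le_ij.
have := max_poly_roots (rs := [seq w i%:R | i <- iota 0 (size D)]) D0.
rewrite map_inj_uniq // iota_uniq size_map size_iota ltnn.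
have -> : all (root D) [seq w i%:R | i <- iota 0 (size D)].
  by apply/allP => _ /mapP [i _ ->]; apply: r0.
by move=> /(_ isT isT).
Qed.

Section GammaGroup.
Variables (k : fieldType) (kb : closedFieldType) (iota : {rmorphism k -> kb}).
Hypotheses (char0 : [pchar k] =i pred0) (hk : is_algebraic_closure iota).
Notation Gam := (gal_group iota).
Variables (M : finGroupType) (act : Gam -> M -> M).
Hypothesis act_comp : forall g h m, act (g * h)%tg m = act g (act h m).
Hypothesis act_mul : forall g m n, act g (m * n)%g = (act g m * act g n)%g.
Hypothesis act_cont : exists s : seq kb, forall g : Gam, {in s, forall a, g a = a} ->
  forall m, act g m = m.

Lemma act_gal_id m : act 1%tg m = m.
Proof. by have [s hs] := act_cont; apply: hs. Qed.

Lemma act_galK g : cancel (act g) (act (g^-1)%tg).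
Proof. by move=> m; rewrite -act_comp tmulVl act_gal_id. Qed.

Lemma act_gal_inj g : injective (act g).
Proof. exact: can_inj (act_galK g). Qed.

Lemma act_gal1 g : act g 1%g = 1%g.
Proof. by apply: (mulgI (act g 1%g)); rewrite -act_mul !mulg1. Qed.

                                                                              
                                                                             
                                                                               
                             
(** Choose z such that fixing z implies acting trivially on M, and for each conjugate r of z a c_r
    with c_r z = r. Let P_m be the product of the (X - r)^N, with N the index of c_r^-1 m in a list
    of M. Then m |-> P_m is equivariant, and injective because the multiplicity at z is the index of
    m. Evaluating at a u in k where no difference P_m - P_n vanishes gives psi. *)
Lemma embedding_ex : exists psi : M -> kb, injective psi /\
  forall (g : Gam) m, g (psi m) = psi (act g m).
Proof.
have [s hs] := act_cont; have [z hz] := primitive_seq char0 hk s.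
have fixz (g : Gam) : g z = z -> forall m, act g m = m.
  by move=> gz; apply: hs => a /hz [f <-]; rewrite gal_pev gz.
have [rs0 hrs0] := minp_roots char0 hk z; pose rs := undup rs0.
have hrs b : pev iota (minp char0 hk z) b = 0 <-> b \in rs by rewrite mem_undup.
pose c r : Gam := epsilon (inhabits 1%tg) (fun g : Gam => g z = r).
have cP r : r \in rs -> c r z = r.
  by move=> /hrs /gal_transitive; apply: epsilon_spec.
pose N r m : nat := index (act ((c r)^-1)%tg m) (enum M).
pose P m : {poly kb} := \prod_(r <- rs) ('X - r%:P) ^+ N r m.
have zrs : z \in rs by apply/hrs; apply: minp_root.
have Nz m : N z m = index m (enum M).
  rewrite /N fixz //; apply: (fmorph_inj (gfun (c z))).
  by rewrite [LHS](gfunVK (c z)) cP.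
have PE m : P m = ('X - z%:P) ^+ N z m * \prod_(r <- rem z rs) ('X - r%:P) ^+ N r m.
  by rewrite /P (big_rem z).
have Q0 m : (\prod_(r <- rem z rs) ('X - r%:P) ^+ N r m).[z] != 0.
  rewrite horner_prod prodf_seq_neq0; apply/allP => r rr /=.
  rewrite horner_exp hornerXsubC expf_neq0 // subr_eq0.
  apply: contraTneq rr => <-; rewrite mem_rem_uniq ?undup_uniq //.
  by rewrite !inE eqxx.
have Pinj : injective P.
  move=> m n e; have key (a b : nat) (A B : {poly kb}) : A.[z] != 0 -> B.[z] != 0 ->
      ('X - z%:P) ^+ a * A = ('X - z%:P) ^+ b * B -> (a <= b)%N.
    move=> A0 B0 eAB; rewrite leqNgt; apply/negP => lt_ba.
    move: eAB; rewrite -(subnKC (ltnW lt_ba)) exprD -mulrA.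
    move/(mulfI (expf_neq0 _ (negbT (polyXsubC_eq0 z)))) => eB.
    move: B0; rewrite -eB hornerM horner_exp hornerXsubC subrr expr0n.
    by rewrite subn_eq0 leqNgt lt_ba mul0r eqxx.
  move: e; rewrite !PE => e.
  have : N z m = N z n.
    by apply/eqP; rewrite eqn_leq (key _ _ _ _ (Q0 m) (Q0 n) e)
      (key _ _ _ _ (Q0 n) (Q0 m) (esym e)).
  by rewrite !Nz => /(congr1 (nth 1%g (enum M))); rewrite !nth_index ?mem_enum.
pose D : {poly kb} := \prod_(p : M * M | p.1 != p.2) (P p.1 - P p.2).
have D0 : D != 0.
  apply/prodf_neq0 => p np; rewrite subr_eq0; apply: contra np => /eqP /Pinj ->.
  exact: eqxx.
have [u Du] := poly_avoid iota char0 D0.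
exists (fun m => (P m).[iota u]); split=> [m n /eqP e|g m].
  apply/eqP; apply: contraT => nmn; move: Du; rewrite /D horner_prod.
  by rewrite (bigD1 (m, n)) //= hornerD hornerN (eqP e) subrr mul0r eqxx.
rewrite /P !horner_prod rmorph_prod.
under eq_bigr => r _ do rewrite horner_exp hornerXsubC rmorphXn rmorphB gfun_id.
under [RHS]eq_bigr => r _ do rewrite horner_exp hornerXsubC.
have pm : perm_eq [seq g r | r <- rs] rs.
  apply: uniq_perm; rewrite ?undup_uniq ?map_inj_uniq ?undup_uniq //.
    exact: fmorph_inj.
  move=> r; apply/mapP/idP => [[r' /hrs h ->]|rr].
    by apply/hrs; apply: gal_minp.
  exists ((g^-1)%tg r); last by rewrite /= gfunVK.
  apply/hrs; apply: (gal_minp (g^-1)%tg); exact/hrs.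
rewrite -[RHS](perm_big _ pm) big_map big_seq [RHS]big_seq; apply: eq_bigr => r rr.
congr (_ ^+ index _ _).
have grs : g r \in rs by rewrite -(perm_mem pm) map_f.
(* This element fixes z, hence acts trivially on M, so the exponent of g r in the polynomial of g m
   is that of r in the polynomial of m. *)
pose v : Gam := ((c (g r))^-1 * g * c r)%tg.
have -> : act ((c (g r))^-1)%tg (act g m) = act v (act ((c r)^-1)%tg m).
  by rewrite -!act_comp /v !tgE.
rewrite (fixz v) //; apply: (fmorph_inj (gfun (c (g r)))).
by rewrite [LHS](gfunVK (c (g r))) /= (cP _ rr) (cP _ grs).
Qed.

End GammaGroup.

Section Lagrange.
Variables (F : fieldType) (M : finType) (psi : M -> F).
Hypothesis psi_inj : injective psi.

Definition lag (m : M) : {poly F} :=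
  \prod_(n | n != m) ((psi m - psi n)^-1 *: ('X - (psi n)%:P)).

Lemma lag_val m n : (lag m).[psi n] = (m == n)%:R.
Proof.
rewrite /lag horner_prod; have [<-|ne] := eqVneq m n.
  rewrite big1 // => i ne; rewrite hornerZ hornerXsubC mulVf // subr_eq0.
  by apply: contra ne => /eqP /psi_inj ->.
by rewrite (bigD1 n) 1?eq_sym //= hornerZ hornerXsubC subrr mulr0 mul0r.
Qed.

Lemma lag_map (f : {rmorphism F -> F}) (s : M -> M) : injective s ->
  (forall m, f (psi m) = psi (s m)) -> forall m, map_poly f (lag m) = lag (s m).
Proof.
move=> s_inj fs m; rewrite /lag rmorph_prod [RHS](reindex_inj s_inj) /=.
apply: eq_big => [n|n _]; first by rewrite (inj_eq s_inj).
by rewrite map_polyZ rmorphB /= map_polyX map_polyC /= fmorphV rmorphB !fs.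
Qed.

End Lagrange.

Section PolyPoints.
Variables (k : fieldType) (q : {poly k}).
Hypotheses (qm : q \is monic) (q1 : (1 < size q)%N).

Notation B := {poly %/ q}.
Notation s := (qpolyC q : {rmorphism k -> B}).

Section Point.
Variables (R : comPzRingType) (e : {rmorphism k -> R}).
Notation pts := (@points k B s R e).

Definition crd (x : pts) : R := x (in_qpoly q 'X).

Lemma crd_root x : pev e q (crd x) = 0.
Proof.
by rewrite /crd -(pev_morph _ _ (ptP x)) (pev_qpolyX qm q1) rmorph0.
Qed.

Lemma crdE (x : pts) (b : B) : x b = pev e b (crd x).
Proof.
rewrite -{1}(in_qpoly_val b) -(pev_in_qpoly qm q1).
by rewrite (pev_morph _ _ (ptP x)).
Qed.

Lemma crd_inj : injective crd.
Proof.
move=> x y exy; have : pt x = pt y.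
  by apply: rmorphism_ext => b; rewrite !crdE exy.
case: x y {exy} => [x px] [y py] /= exy; subst y.
by congr Pts; apply: proof_irrelevance.
Qed.

Lemma crd_ex a : pev e q a = 0 -> exists x : pts, crd x = a.
Proof.
by move=> /(qpoly_lift qm q1) [h [hs ha]]; exists (Pts hs).
Qed.

Definition mkpt a (h : pev e q a = 0) : pts := projT1 (cid (crd_ex h)).

Lemma mkptE a (h : pev e q a = 0) : crd (mkpt h) = a.
Proof. by rewrite /mkpt; case: cid. Qed.

End Point.

Lemma crd_map (R R' : comPzRingType) (e : {rmorphism k -> R})
    (e' : {rmorphism k -> R'}) (u : {rmorphism R -> R'}) (hu : u \o e =1 e') x :
  crd (pts_map hu x) = u (crd x) :> R'.
Proof. by []. Qed.

Definition natural (f : forall R : comPzRingType, {rmorphism k -> R} -> R -> R -> R -> R) :=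
  forall (R R' : comPzRingType) (e : {rmorphism k -> R})
    (e' : {rmorphism k -> R'}) (u : {rmorphism R -> R'}), u \o e =1 e' ->
  forall a b c, u (f R e a b c) = f R' e' (u a) (u b) (u c).

Hypothesis q_sep : coprimep q q^`().
Variables (W : closedFieldType) (w : {rmorphism k -> W}).

(** Adjoins a generic root of q: S' is the base change of k[X]/q to S. *)
Lemma add_root (S : comPzRingType) (t : {rmorphism k -> S}) : finite_etale t ->
  exists (S' : comPzRingType) (t' : {rmorphism k -> S'}) (u : {rmorphism S -> S'}) (X : S'),
  [/\ finite_etale t', forall c, u (t c) = t' c, pev t' q X = 0
    & forall (R : comPzRingType) (e : {rmorphism k -> R}) (v : {rmorphism S -> R}) a,
      (forall c, v (t c) = e c) -> pev e q a = 0 ->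
      exists h : {rmorphism S' -> R},
        [/\ forall c, h (t' c) = e c, forall b, h (u b) = v b & h X = a]].
Proof.
move=> et; have es : finite_etale s := qpoly_etale qm q1 q_sep.
have po := tens_pushout t (etale_locally_projective es).
have e2 := finite_etale_pushout po es.
exists (tens t s), (tinA t s \o t), (tinA t s), (tinB t s (in_qpoly q 'X)).
split=> // [||R e v a hv /(qpoly_lift qm q1) [h [hs ha]]].
- exact: frame_comp.
- rewrite -(pev_morph (s := s) (g := tinB t s)) ?(pev_qpolyX qm q1) ?rmorph0 // => c.
  by rewrite po.1.
have [|g [gA gB]] := @pushout_hom _ _ _ _ _ _ _ _ po _ v h; first by move=> r; rewrite hv hs.
exists g; split=> [c|b|]; first by rewrite /= gA hv.
  exact: gA.
by rewrite gB.
Qed.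

                                                                           
                                
(** Any three roots in R are specializations of three generic roots in a finite etale k-algebra,
    where elements are separated by points with values in W. *)
Lemma root_identity f f' : natural f -> natural f' ->
  (forall a b c, pev w q a = 0 -> pev w q b = 0 -> pev w q c = 0 ->
    f W w a b c = f' W w a b c) ->
  forall (R : comPzRingType) (e : {rmorphism k -> R}) a b c,
  pev e q a = 0 -> pev e q b = 0 -> pev e q c = 0 -> f R e a b c = f' R e a b c.
Proof.
move=> nf nf' hw R e a b c ha hb hc.
have [S1 [t1 [u1 [X [e1 ut1 rX hX]]]]] := add_root (idfun_etale k).
have [S2 [t2 [u2 [Y [e2 ut2 rY hY]]]]] := add_root e1.
have [S3 [t3 [u3 [Z [e3 ut3 rZ hZ]]]]] := add_root e2.
have [h1 [h1t _ h1X]] := hX R e e a (fun=> erefl) ha.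
have [h2 [h2t h2u h2Y]] := hY R e h1 b h1t hb.
have [h3 [h3t h3u h3Z]] := hZ R e h2 c h2t hc.
have hu : h3 \o t3 =1 e by [].
have up (S S' : comPzRingType) (t : {rmorphism k -> S}) (t' : {rmorphism k -> S'})
    (u : {rmorphism S -> S'}) x :
    (forall c, u (t c) = t' c) -> pev t q x = 0 -> pev t' q (u x) = 0.
  by move=> ut r; rewrite -(pev_morph (s := t) (g := u)) // r rmorph0.
have <- : h3 (u3 (u2 X)) = a by rewrite h3u h2u.
have <- : h3 (u3 Y) = b by rewrite h3u.
rewrite -h3Z -(nf _ _ _ _ _ hu) -(nf' _ _ _ _ _ hu); congr (h3 _).
apply/eqP; rewrite -subr_eq0; apply/eqP; apply: (etale_separates (w := w) e3) => h ht.
rewrite rmorphB (nf _ _ _ _ _ ht) (nf' _ _ _ _ _ ht) hw ?subrr //.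
- by apply: (up _ _ t3) => //; apply: (up _ _ t2) => //; apply: (up _ _ t1).
- by apply: (up _ _ t3) => //; apply: (up _ _ t2).
exact: (up _ _ t3).
Qed.

End PolyPoints.

Section GroupScheme.
Variables (k : fieldType) (kb : closedFieldType) (iota : {rmorphism k -> kb}).
Hypotheses (char0 : [pchar k] =i pred0) (hk : is_algebraic_closure iota).
Notation Gam := (gal_group iota).

Lemma poly_descend (q : {poly kb}) : (forall g : Gam, map_poly g q = q) ->
  exists p, map_poly iota p = q.
Proof.
move=> fq; have fix_ i : exists c, iota c = q`_i.
  by apply: (gal_fixed char0 hk) => g; rewrite -{2}(fq g) coef_map.
pose c i := projT1 (cid (fix_ i)).
exists (\poly_(i < size q) c i); apply/polyP => i; rewrite coef_map coef_poly /=.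
case: ltnP => h; last by rewrite rmorph0 nth_default.
by rewrite /c; case: cid.
Qed.

Variables (M : finGroupType) (act : Gam -> M -> M).
Hypothesis act_comp : forall g h m, act (g * h)%tg m = act g (act h m).
Hypothesis act_mul : forall g m n, act g (m * n)%g = (act g m * act g n)%g.
Hypothesis act_cont : exists s : seq kb, forall g : Gam, {in s, forall a, g a = a} ->
  forall m, act g m = m.
Variable psi : M -> kb.
Hypothesis psi_inj : injective psi.
Hypothesis psi_act : forall (g : Gam) m, g (psi m) = psi (act g m).

Let act_inj := act_gal_inj act_comp act_cont.
Let lag_act (g : Gam) m : map_poly g (lag psi m) = lag psi (act g m).
Proof. by apply: lag_map => //; apply: act_inj. Qed.

Let N := \max_m size (lag psi m).
(** The coefficient of x^i y^j in the Lagrange interpolation of the operation F on psi(M). For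
    equivariant F, Galois permutes the summands, so it lies in k. *)
Let sumC (F : M -> M -> M) i j : kb :=
  \sum_(p : M * M) psi (F p.1 p.2) * (lag psi p.1)`_i * (lag psi p.2)`_j.

Lemma sumC_descend (F : M -> M -> M) :
  (forall (g : Gam) m n, act g (F m n) = F (act g m) (act g n)) ->
  exists c : nat -> nat -> k, forall i j, iota (c i j) = sumC F i j.
Proof.
move=> hF; have fx i j : exists c, iota c = sumC F i j.
  apply: (gal_fixed char0 hk) => g; rewrite rmorph_sum.
  have inj : injective (fun p : M * M => (act g p.1, act g p.2)).
    by move=> [m n] [m' n'] [/act_inj -> /act_inj ->].
  rewrite [RHS](reindex_inj inj); apply: eq_bigr => p _.
  by rewrite !rmorphM psi_act hF -!lag_act !coef_map.
exists (fun i j => projT1 (cid (fx i j))) => i j; by case: cid.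
Qed.

Definition bilin (c : nat -> nat -> k) (R : comPzRingType) (e : {rmorphism k -> R})
    (a b : R) : R := \sum_(i < N) \sum_(j < N) e (c i j) * a ^+ i * b ^+ j.

Lemma bilin_nat c (R R' : comPzRingType) (e : {rmorphism k -> R})
    (e' : {rmorphism k -> R'}) (u : {rmorphism R -> R'}) : u \o e =1 e' ->
  forall a b, u (bilin c e a b) = bilin c e' (u a) (u b).
Proof.
move=> hu a b; rewrite rmorph_sum; apply: eq_bigr => i _.
rewrite rmorph_sum; apply: eq_bigr => j _.
by rewrite !rmorphM !rmorphXn -hu.
Qed.

Lemma bilin_psi F c : (forall i j, iota (c i j) = sumC F i j) ->
  forall m n, bilin c iota (psi m) (psi n) = psi (F m n).
Proof.
move=> hc m n; have wide l x : (lag psi l).[x] = \sum_(i < N) (lag psi l)`_i * x ^+ i.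
  by apply: horner_coef_wide; apply: (leq_bigmax l).
transitivity (\sum_(p : M * M)
    psi (F p.1 p.2) * ((lag psi p.1).[psi m] * (lag psi p.2).[psi n])).
  under [RHS]eq_bigr => p _ do rewrite !wide big_distrlr /= mulr_sumr.
  rewrite exchange_big; apply: eq_bigr => i _.
  under [RHS]eq_bigr => p _ do rewrite mulr_sumr.
  rewrite exchange_big; apply: eq_bigr => j _.
  rewrite hc /sumC !mulr_suml; apply: eq_bigr => p _; ring.
rewrite (bigD1 (m, n)) //= !lag_val // !eqxx !mulr1 big1 ?addr0 // => -[m' n'] ne.
rewrite !lag_val //; move: ne; rewrite -pair_eqE /=.
by case: (m' == m); case: (n' == n); rewrite ?mul0r ?mulr0.
Qed.

Lemma equation_ex : exists q : {poly k},
  [/\ q \is monic, (1 < size q)%N, coprimep q q^`()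
    & forall a, pev iota q a = 0 <-> exists m, a = psi m].
Proof.
pose Q : {poly kb} := \prod_m ('X - (psi m)%:P).
have [g|q qQ] := @poly_descend Q.
  rewrite rmorph_prod [RHS](reindex_inj (act_inj (g := g))); apply: eq_bigr => m _.
  by rewrite rmorphB /= map_polyX map_polyC /= psi_act.
have QE : Q = \prod_(a <- [seq psi m | m <- enum M]) ('X - a%:P).
  by rewrite big_map big_enum.
exists q; split.
- by rewrite -(map_monic iota) qQ QE monic_prod_XsubC.
- rewrite -(size_map_poly iota) qQ QE size_prod_XsubC size_map -cardE.
  by rewrite ltnS; apply/card_gt0P; exists 1%g.
- have : separable_poly q.
    rewrite -(separable_map iota) qQ QE separable_prod_XsubC.
    by rewrite map_inj_uniq ?enum_uniq.
  by rewrite unlock.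
move=> a; rewrite pev_horner qQ; split=> [/eqP|[m ->]].
  rewrite horner_prod prodf_seq_eq0 => /hasP [m _ /=].
  by rewrite hornerXsubC subr_eq0 => /eqP ->; exists m.
by rewrite horner_prod (bigD1 m) //= hornerXsubC subrr mul0r.
Qed.

(** G is the spectrum of k[X]/q, where q has root set psi(M); its R-points are the roots of q in R.
    The group law is interpolated on psi(M), and its axioms follow from those of M by
    [root_identity]. If Gam acts trivially then psi(M) lies in k, and evaluation at its elements
    makes G constant. *)
Lemma group_scheme_ex : exists (G : group_scheme k) (pts : M -> points (gstr G) iota),
  [/\ bijective pts, forall m n, pts (m * n)%g = gmul (pts m) (pts n),
      forall (g : Gam) m, galois_act g (pts m) = pts (act g m)
    & (forall (g : Gam) m, act g m = m) -> is_constant G].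
Proof.
have [q [qm q1 q_sep qr]] := equation_ex.
have rpsi m : pev iota q (psi m) = 0 by apply/qr; exists m.
have [mc mcE] := @sumC_descend (fun m n => (m * n)%g) act_mul.
have mul_psi := bilin_psi mcE.
(* The inverse is interpolated in two variables as well, with a dummy second one. *)
have [|vc vcE] := @sumC_descend (fun m _ => (m^-1)%g).
  by move=> g m _; apply: (mulgI (act g m)); rewrite -act_mul !mulgV (act_gal1 act_mul).
have inv_psi := bilin_psi vcE.
have [u u1] : exists u, iota u = psi 1%g.
  by apply: (gal_fixed char0 hk) => g; rewrite psi_act (act_gal1 act_mul).
pose s := qpolyC q : {rmorphism k -> {poly %/ q}}.
have id3 := root_identity qm q1 q_sep (w := iota).
have ru (R : comPzRingType) (e : {rmorphism k -> R}) : pev e q (e u) = 0.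
  have : pev idfun q u = 0.
    by apply: (fmorph_inj iota); rewrite (pev_morph (t := iota)) // u1 rpsi rmorph0.
  by move=> /(congr1 e); rewrite (pev_morph (t := e)) // rmorph0.
have rmul (R : comPzRingType) (e : {rmorphism k -> R}) a b :
    pev e q a = 0 -> pev e q b = 0 -> pev e q (bilin mc e a b) = 0.
  move=> ha hb; apply: (id3 (fun R e a b c => pev e q (bilin mc e a b))
    (fun R e a b c => 0) _ _ _ R e a b b ha hb hb).
  - move=> R1 R2 e1 e2 v hv a1 b1 _; rewrite (pev_morph (t := e2)) //.
    by rewrite (bilin_nat _ hv).
  - by move=> R1 R2 e1 e2 v hv *; rewrite rmorph0.
  by move=> _ _ _ /qr [m ->] /qr [n ->] _; rewrite mul_psi.
have rinv (R : comPzRingType) (e : {rmorphism k -> R}) a :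
    pev e q a = 0 -> pev e q (bilin vc e a a) = 0.
  move=> ha; apply: (id3 (fun R e a b c => pev e q (bilin vc e a a))
    (fun R e a b c => 0) _ _ _ R e a a a ha ha ha).
  - move=> R1 R2 e1 e2 v hv a1 b1 _; rewrite (pev_morph (t := e2)) //.
    by rewrite (bilin_nat _ hv).
  - by move=> R1 R2 e1 e2 v hv *; rewrite rmorph0.
  by move=> _ _ _ /qr [m ->] _ _; rewrite inv_psi.
pose rt := fun R e x => @crd_root _ _ qm q1 R e x.
pose mk := fun (R : comPzRingType) (e : {rmorphism k -> R}) a h =>
  @mkpt _ _ qm q1 R e a h.
pose mul (R : comPzRingType) (e : {rmorphism k -> R}) (x y : points s e) : points s e :=
  mk R e _ (rmul R e _ _ (rt R e x) (rt R e y)).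
pose one (R : comPzRingType) (e : {rmorphism k -> R}) : points s e := mk R e _ (ru R e).
pose inv (R : comPzRingType) (e : {rmorphism k -> R}) (x : points s e) : points s e :=
  mk R e _ (rinv R e _ (rt R e x)).
have inj := fun R e => @crd_inj _ _ qm q1 R e.
have fin : module_finite s.
  have /finite_etale_frame [n [y [z [tr [_ hy _]]]]] := qpoly_etale qm q1 q_sep.
  by exists n, y => b; eexists; apply: hy.
have mulA R e : associative (mul R e).
  move=> x y z; apply: inj; rewrite /mul /mk !mkptE.
  apply: (id3 (fun R e a b c => bilin mc e a (bilin mc e b c))
    (fun R e a b c => bilin mc e (bilin mc e a b) c)); try exact: rt.
  - by move=> R1 R2 e1 e2 v hv a b c; rewrite !(bilin_nat _ hv).
  - by move=> R1 R2 e1 e2 v hv a b c; rewrite !(bilin_nat _ hv).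
  by move=> _ _ _ /qr [m ->] /qr [n ->] /qr [l ->]; rewrite !mul_psi mulgA.
have mul1 R e : left_id (one R e) (mul R e).
  move=> x; apply: inj; rewrite /mul /one /mk !mkptE.
  apply: (id3 (fun R e a b c => bilin mc e (e u) a) (fun R e a b c => a)
    _ _ _ R e _ _ _ (rt R e x) (rt R e x) (rt R e x)) => //.
  - by move=> R1 R2 e1 e2 v hv a b c; rewrite (bilin_nat _ hv) -hv.
  by move=> _ _ _ /qr [m ->] _ _; rewrite u1 mul_psi mul1g.
have mulV R e : left_inverse (one R e) (inv R e) (mul R e).
  move=> x; apply: inj; rewrite /mul /one /inv /mk !mkptE.
  apply: (id3 (fun R e a b c => bilin mc e (bilin vc e a a) a) (fun R e a b c => e u)
    _ _ _ R e _ _ _ (rt R e x) (rt R e x) (rt R e x)) => //.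
  - by move=> R1 R2 e1 e2 v hv a b c; rewrite !(bilin_nat _ hv).
  - by move=> R1 R2 e1 e2 v hv a b c; rewrite -hv.
  by move=> _ _ _ /qr [m ->] _ _; rewrite inv_psi mul_psi mulVg u1.
have nat (R R' : comPzRingType) (e : {rmorphism k -> R}) (e' : {rmorphism k -> R'})
    (v : {rmorphism R -> R'}) (hv : v \o e =1 e') (x y : points s e) :
    pts_map hv (mul R e x y) = mul R' e' (pts_map hv x) (pts_map hv y).
  by apply: inj; rewrite crd_map /mul /mk !mkptE !crd_map (bilin_nat _ hv).
pose G := GroupScheme fin mulA mul1 mulV nat.
pose pts m : points (gstr G) iota := mk kb iota _ (rpsi m).
have cpts m : crd (pts m : points s iota) = psi m by rewrite /pts /mk mkptE.
have pts_surj (x : points s iota) : exists m, pts m = x.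
  by have /qr [m e] := rt _ _ x; exists m; apply: inj; rewrite cpts.
exists G, pts; split.
- exists (fun x => projT1 (cid (pts_surj x))) => [m|x]; case: cid => // n e.
  by apply: psi_inj; rewrite -!cpts e.
- by move=> m n; apply: inj; rewrite /= /mul /mk mkptE !cpts mul_psi.
- by move=> g m; apply: inj; rewrite cpts -psi_act -(cpts m).
move=> triv; have dc m : exists c, iota c = psi m.
  by apply: (gal_fixed char0 hk) => g; rewrite psi_act triv.
pose c m := projT1 (cid (dc m)).
have cE m : iota (c m) = psi m by rewrite /c; case: cid.
have rc m : pev idfun q (c m) = 0.
  by apply: (fmorph_inj iota); rewrite (pev_morph (t := iota)) // cE rpsi rmorph0.
pose ev m : points (gstr G) idfun := mk k idfun _ (rc m).
have cev m : crd (ev m : points s idfun) = c m by rewrite /ev /mk mkptE.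
exists M, ev; split=> [m n|].
  apply: inj; rewrite /= /mul /mk mkptE !cev; apply: (fmorph_inj iota).
  by rewrite (@bilin_nat mc k kb idfun iota iota (fun=> erefl)) // !cE mul_psi.
have c_inj : injective c by move=> m n e; apply: psi_inj; rewrite -!cE e.
have evE m (b : {poly %/ q}) : ev m b = (b : {poly k}).[c m].
  by rewrite (crdE qm q1) cev pev_horner map_poly_id.
have evs m a : ev m (s a) = a := ptP (ev m) a.
pose back (f : {ffun M -> k}) := \sum_m s (f m) * in_qpoly q (lag c m).
have backE f m : ev m (back f) = f m.
  have lagE n : ev m (in_qpoly q (lag c n)) = (n == m)%:R.
    rewrite -(pev_in_qpoly qm q1) (@pev_morph _ _ _ s idfun (ev m) _ _ (evs m)) -[ev m _]/(crd (ev m)) cev.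
    by rewrite pev_horner map_poly_id // lag_val.
  rewrite rmorph_sum (bigD1 m) //= rmorphM evs lagE eqxx mulr1 big1 ?addr0 // => n ne.
  by rewrite rmorphM lagE (negPf ne) mulr0.
exists back => [b|f]; last by apply/ffunP => m; rewrite ffunE backE.
apply/eqP; rewrite -subr_eq0; apply/eqP.
apply: (etale_separates (w := iota) (qpoly_etale qm q1 q_sep)) => h hs.
pose x : points s iota := Pts hs.
have [m mx] := pts_surj x.
have hE a : h a = iota (ev m a).
  rewrite -[h a]/(x a) -mx (crdE qm q1) cpts evE -cE -horner_map -pev_horner.
  by [].
rewrite rmorphB !hE.
have -> : ev m (back [ffun n => ev n b]) = ev m b by rewrite backE ffunE.
by rewrite subrr.
Qed.

End GroupScheme.

                            

(** * Cocycles, and solutions modulo an open subgroup *)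

Section PointsGroup.
Variables (k : fieldType) (G : group_scheme k).

(** G(R) as a discrete group, so that the calculus of [tgroup] applies to cocycle values. *)
Definition gpts (R : comPzRingType) (e : {rmorphism k -> R}) : tgroup := {|
  tsort := points (gstr G) e;
  tmulA := @gmulA k G R e; tmul1l := @gmul1 k G R e; tmulVl := @gmulV k G R e;
  topen := fun=> True; topenT := I; topenI := fun _ _ _ _ => I;
  topenU := fun _ _ => I |}.

Variables (kb : fieldType) (iota : {rmorphism k -> kb}).
Notation Gam := (gal_group iota).
Implicit Type m : gpts iota.

Definition gact (g : Gam) m : gpts iota := galois_act g m.

Lemma points_ext (R : comPzRingType) (e : {rmorphism k -> R})
    (x y : points (gstr G) e) : x =1 y -> x = y.
Proof.
case: x y => [x px] [y py] /= /rmorphism_ext e'; subst y.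
by congr Pts; apply: proof_irrelevance.
Qed.

Lemma gactM g m n : gact g (m * n)%tg = (gact g m * gact g n)%tg.
Proof. exact: gnat. Qed.

Lemma gact_id m : gact 1%tg m = m.
Proof. exact: points_ext. Qed.

Variables (P : tgroup) (q : P -> Gam) (c : P -> gpts iota).
Hypotheses (hq : is_hom q) (hc : cocycle q c).

Lemma cocycleM g h : c (g * h)%tg = (c g * gact (q g) (c h))%tg.
Proof. exact: hc.2. Qed.

Lemma cocycle1 : c 1%tg = 1%tg.
Proof.
have := cocycleM 1%tg 1%tg; rewrite tmul1l (hom1 hq) gact_id.
by rewrite -{1}[c 1%tg]tmul1r => /tmul_injl.
Qed.

End PointsGroup.

Section Descent.
Variables (k : fieldType) (kb : closedFieldType) (iota : {rmorphism k -> kb}).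
Hypotheses (char0 : [pchar k] =i pred0) (hk : is_algebraic_closure iota).
Notation Gam := (gal_group iota).
Variables (P : tgroup) (p : P -> Gam).
Hypotheses (pP : profinite P) (hp : is_hom p) (cp : tcontinuous p).
Variables (I : Type) (D : I -> tgroup) (theta : forall i, D i -> Gam).
Variable s : forall i, D i -> P.
Hypothesis ps : forall i h, p (@s i h) = theta h.

Definition descends_along_s (G : group_scheme k)
    (c : P -> points (gstr G) iota) :=
  exists2 d : Gam -> points (gstr G) iota, cocycle id d &
    forall i, cohomologous (@theta i) (fun g => d (theta g)) (fun g => c (@s i g)).

(** The descended cocycle is c o t. Gam acts trivially through z, which is in the kernel of p, so
    conjugation by z is the coboundary of c(z^-1). *)
Lemma descends_of_section (t : Gam -> P) : is_hom t -> tcontinuous t ->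
  (forall g, p (t g) = g) ->
  (forall i, exists2 z : P, p z = 1%tg &
    forall h, @s i h = (z * t (theta h) * z^-1)%tg) ->
  forall (G : group_scheme k) (c : P -> points (gstr G) iota),
  cocycle p c -> descends_along_s c.
Proof.
move=> ht ct pt hs G c hc; exists (fun g => c (t g)).
  split=> [m|g h]; first exact: (ct _ (hc.1 m)).
  by rewrite ht hc.2 pt.
move=> i; have [z pz hz] := hs i; exists (c (z^-1)%tg) => h.
have cz : ginv (c (z^-1)%tg) = c z.
  apply: (@tmul_injl (gpts G iota) (c (z^-1)%tg)).
  rewrite [LHS](@tmulVr (gpts G iota)) -(cocycle1 hp hc) -(tmulVl z).
  by rewrite (cocycleM hc) (homV _ hp) pz tinv1 gact_id.
rewrite cz hz !(cocycleM hc) hp pz tmul1l pt gact_id.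
by [].
Qed.

Section Approximation.
Variable V : normal_subgroup P.
Hypothesis oV : topen V.
Variables (A : normal_subgroup P) (t0 : Gam -> P).
Hypotheses (ht0 : is_hom t0) (ct0 : tcontinuous t0).
Hypothesis hA : forall g, A (g * (t0 (p g))^-1)%tg.
Hypothesis tA : forall g, A g -> t0 (p g) = 1%tg.

                                                                            
                                                     
(** Meant for two cases: A = P with t0 trivial, where G is constant, and A = ker p with t0 a
    section. The finite group is A/(A cap V) with Gam acting by conjugation through t0, and the
    cocycle is g |-> g t0(p g)^-1. If d descends it and x lifts d to A, then x t0 is a solution
    modulo V. *)
Lemma interpolates_of_descends :
  (forall (G : group_scheme k) (c : P -> points (gstr G) iota), cocycle p c ->
    (forall m, exists2 u, A u & c u = m) ->
    ((forall g, t0 g = 1%tg) -> is_constant G) ->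
    descends_along_s c) ->
  exists t, interpolates theta s V t.
Proof.
move=> hyp; have [H [f [rep [repA frep fM fE]]]] :=
  finite_quotient pP oV (nset_subgroup A).
have AM x y : A x -> A y -> A (x * y)%tg := @nsetM P A x y.
have f_rep a : A a -> eqm V (rep (f a)) a.
  by move=> Aa; apply/(fE _ _ (repA _) Aa); rewrite frep.
pose act (g : Gam) (m : H) : H := f (t0 g * rep m * (t0 g)^-1)%tg.
have actA g a : A a -> A (t0 g * a * (t0 g)^-1)%tg by apply: nset_normal.
have actE g a : A a -> act g (f a) = f (t0 g * a * (t0 g)^-1)%tg.
  move=> Aa; apply/(fE _ _ (actA _ _ (repA _)) (actA _ _ Aa)).
  exact: eqmM (eqmM (eqm_refl _ _) (f_rep _ Aa)) (eqm_refl _ _).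
have act_comp g h m : act (g * h)%tg m = act g (act h m).
  rewrite -[m]frep (actE (g * h)%tg) // (actE h) // actE; last exact: actA.
  by rewrite ht0 !tgE.
have act_mul g m n : act g (m * n)%g = (act g m * act g n)%g.
  rewrite -[m]frep -[n]frep -fM // actE; last exact: AM.
  rewrite !actE // -fM; [|exact: actA|exact: actA].
  by rewrite !tgE.
have act_cont : exists l : seq kb, forall g : Gam, {in l, forall a, g a = a} ->
    forall m, act g m = m.
  (* Elements g with t0 g in V act trivially on H; they include all g fixing a suitable finite list
     in kb. *)
  have oW : topen (fun g => V (t0 g)) by apply: (ct0 oV).
  have [|l hl] := oW (1%tg : Gam); first by rewrite (hom1 ht0); apply: nset1.
  exists l => g e m; have {e} Vg : V (t0 g) by apply: hl.
  rewrite -{2}[m]frep; apply/(fE _ _ (actA _ _ (repA _)) (repA _)).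
  apply: eqm_sym; rewrite /eqm.
  have -> : ((rep m)^-1 * (t0 g * rep m * (t0 g)^-1) =
     ((rep m)^-1 * t0 g * rep m) * (t0 g)^-1)%tg by rewrite !tgE.
  by apply: nsetM; [apply: nsetJ|apply: nsetV].
have [psi [psi_inj psi_act]] := embedding_ex char0 hk act_comp act_cont.
have [G [pts [[ptsV ptsK ptsVK] ptsM ptsG ptsC]]] :=
  group_scheme_ex char0 hk act_comp act_mul act_cont psi_inj psi_act.
pose y g : P := (g * (t0 (p g))^-1)%tg.
have yA g : A (y g) by exact: hA.
pose c g : points (gstr G) iota := pts (f (y g)).
have cP g h : eqm V g h -> eqm V (t0 (p g)) (t0 (p h)) -> c g = c h.
  by move=> e e'; congr pts; apply/fE => //; apply: eqmM e (eqmV e').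
have htp : is_hom (fun g => t0 (p g)) by move=> g h; rewrite hp ht0.
have hc : cocycle p c.
  split=> [m|g h].
    have e g h := eq_ind _ (eqm V _) (eqm_refl V (t0 (p (g * h)%tg))) _ (htp g h).
    have oW : topen (preimN e).
      by apply: open_preimN => // B oB; apply: (cp (ct0 oB)).
    apply: (topen_coset (V := nsetI V (preimN e)) pP); first exact: topenI.
    move=> g v [Vgv /= e'] <-; apply: esym; apply: cP => //.
    by move: e'; rewrite htp (homV _ htp).
  rewrite /c -[gmul _ _]/(gmul _ (galois_act _ _)) ptsG -ptsM actE //.
  rewrite -fM; [|exact: yA|exact: actA].
  by rewrite /y hp ht0 !tgE.
have desc : descends_along_s c.
  apply: hyp => // [m|t1].
    exists (rep (ptsV m)) => //; rewrite /c -[RHS]ptsVK; congr pts.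
    by rewrite /y tA // !tgE frep.
  by apply: ptsC => g m; rewrite -[m]frep actE // t1 !tgE.
have [d [od dM] hd] := desc.
pose x g := rep (ptsV (d g)).
have xA g : A (x g) by exact: repA.
have dx g : d g = pts (f (x g)) by rewrite frep ptsVK.
pose t g : P := (x g * t0 g)%tg.
(* The cocycle identity for d is multiplicativity of x t0 modulo V. *)
have hom g h : eqm V (t (g * h)%tg) (t g * t h)%tg.
  have e : eqm V (x (g * h)%tg) (x g * (t0 g * x h * (t0 g)^-1))%tg.
    apply/fE => //; first by apply: AM => //; apply: actA.
    apply: (can_inj ptsK); rewrite -dx dM !dx ptsG -ptsM actE //.
    by rewrite (fM (x g)) //; apply: actA.
  have := eqmM e (eqm_refl V (t0 (g * h)%tg)).
  by rewrite /t ht0 !tgE.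
exists t; exists hom.
  apply: (topen_cosets (gal_profinite char0 hk)) => g /= Vg.
  have [||W oW hW] := pf_basis (gal_profinite char0 hk) (g := g)
      (A := fun h => d h = d g /\ eqm V (t0 g) (t0 h)).
  - by apply: topenI; [apply: od|apply: (ct0 (pf_coset pP _ oV))].
  - by split=> //; apply: eqm_refl.
  exists W => // h /hW [e e']; apply/(eqm_mem (x := t h) (y := t g)) => //.
  by rewrite /t /x e; apply: eqmM (eqm_refl _ _) (eqm_sym e').
move=> i; have [m hm] := hd i; pose z := rep (ptsV m).
have mz : m = pts (f z) by rewrite frep ptsVK.
exists (z^-1)%tg => h.
have ptsV1 : ginv (pts (f z)) = pts (f (z^-1)%tg).
  have zA : A (z^-1)%tg by apply: nsetV; apply: repA.
  have one : pts (f 1%tg) = 1%tg :> gpts G iota.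
    apply: (tmul_injl (x := pts (f 1%tg) : gpts G iota)).
    by rewrite tmul1r -[LHS]ptsM -(fM _ _ (nset1 A) (nset1 A)) tmul1l.
  apply/esym; apply: (@tinv_uniq (gpts G iota)).
  by rewrite -[LHS]ptsM -(fM _ _ (repA _) zA) tmulVr.
have zA : A (z^-1)%tg by apply: nsetV; apply: repA.
have := hm h; rewrite mz ptsV1 dx ptsG -!ptsM (actE _ _ (repA _)) /c => /(can_inj ptsK).
rewrite -(fM _ _ zA (xA _)) -(fM _ _ (AM _ _ zA (xA _)) (actA _ _ (repA _))).
move=> /(fE _ _ (yA _) (AM _ _ (AM _ _ zA (xA _)) (actA _ _ (repA _)))) e.
(* Multiplied on the right by t0(theta h), the coboundary relation becomes conjugation by z^-1. *)
have := eqmM e (eqm_refl V (t0 (theta h))).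
by rewrite /y ps /t !tgE.
Qed.

End Approximation.
End Descent.

                                              

(** * The group pi1^U(X), and the equivalences *)

Lemma quo_piM (P : tgroup) (N : normal_subgroup P) : is_hom (quo_pi N).
Proof. by move=> x y; apply/esym/quo_mul_pi. Qed.

Lemma pchar0_morph (K L : fieldType) (f : {rmorphism K -> L}) :
  [pchar K] =i pred0 -> [pchar L] =i pred0.
Proof. by move=> h p; rewrite (fmorph_pchar f) h. Qed.

Lemma idfun_algebraic (K : closedFieldType) :
  is_algebraic_closure (idfun : {rmorphism K -> K}).
Proof.
move=> a; exists ('X - a%:P); first by rewrite polyXsubC_eq0.
by rewrite map_poly_id // root_XsubC.
Qed.

Section QuotientGroup.
Variables (k : fieldType) (char0 : [pchar k] =i pred0).
Variables (kb : closedFieldType) (iota : {rmorphism k -> kb}).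
Hypothesis hk : is_algebraic_closure iota.
Variables (X : variety k) (x : bc_pt X idfun iota).
Notation Gam := (gal_group iota).

Lemma pi1_proj_hom : is_hom (pi1_proj x).
Proof. exact: pi1_galois_hom. Qed.

Lemma pi1_proj_bar (u : etale_pi1 (geom_pt_bar x)) : pi1_proj x (pi1_bar u) = 1%tg.
Proof.
apply: galois_ext => a.
have h := pi1_galois_map (geom_arrow (frefl _) x) char0 hk
  (pchar0_morph iota char0) (@idfun_algebraic kb) u a.
rewrite [LHS]h; exact: (gfun_id (pi1_galois u) a).
Qed.

(** By [pi1_galois_map] the left side meets the property defining [galois_res], which determines an
    automorphism since b is injective. *)
Lemma pi1_proj_bc (K : fieldType) (j : {rmorphism k -> K}) (W : closedFieldType)
    (w : {rmorphism K -> W}) (hw : is_algebraic_closure w) (b : {rmorphism kb -> W})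
    (hb : b \o iota =1 w \o j) (g : etale_pi1 (geom_pt hb x)) :
  pi1_proj x (pi1_bc g) = galois_res iota b (pi1_proj (geom_pt hb x) g).
Proof.
have h := pi1_galois_map (geom_arrow hb x) char0 hk (pchar0_morph j char0) hw g.
have e := epsilon_spec (inhabits (1%tg : Gam)) (fun s : Gam =>
  forall a, b (s a) = pi1_proj (geom_pt hb x) g (b a)) (ex_intro _ _ h).
by apply: galois_ext => a; apply: (fmorph_inj b); rewrite [LHS]h [RHS]e.
Qed.

Variables (U : etale_pi1 (geom_pt_bar x) -> Prop) (N : normal_subgroup (etale_pi1 x)).
Hypothesis hUc : tclosed U.
Hypothesis hN : forall g, N g <-> exists2 u, U u & g = pi1_bar u.

Lemma quo_profinite : profinite (quo N).
Proof.
apply: profinite_quo; first exact: pi1_profinite.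
have -> : N = (fun g => exists2 u, U u & g = pi1_bar u) :> (_ -> Prop).
  by apply: funext => g; apply: propext; apply: hN.
apply: closed_image => //; first exact: (pf_compact (pi1_profinite _)).
  exact: pi1_profinite.
exact: pi1_map_cont.
Qed.

Lemma quo_proj_pi g : quo_proj (quo_pi N g) = pi1_proj x g.
Proof.
have /hN [u _ e] := quo_reprP N g.
have -> : quo_proj (quo_pi N g) = pi1_proj x (quo_repr (quo_cls N g)) by [].
rewrite -(tmulKV g (quo_repr _)) e pi1_proj_hom.
by rewrite pi1_proj_bar tmul1r.
Qed.

Lemma quo_pi_repr (C : quo N) : quo_pi N (quo_repr C) = C.
Proof. exact: quo_reprK. Qed.

Lemma quo_proj_hom : is_hom (@quo_proj _ _ _ _ x N).
Proof.
move=> C D; rewrite -(quo_pi_repr C) -(quo_pi_repr D) -quo_piM !quo_proj_pi.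
exact: pi1_proj_hom.
Qed.

Lemma quo_proj_cont : tcontinuous (@quo_proj _ _ _ _ x N).
Proof.
move=> A oA; have e : (fun g => A (quo_proj (quo_cls N g))) = (fun g => A (pi1_proj x g)).
  by apply: funext => g; rewrite -[quo_cls N g]/(quo_pi N g) quo_proj_pi.
rewrite /= /quo_open e; exact: (pi1_galois_cont char0 hk oA).
Qed.

Lemma quo_proj_ker (C : quo N) : quo_proj C = 1%tg -> exists u, C = quo_pi N (pi1_bar u).
Proof.
by move=> /(pi1_exact char0 hk) [u e]; exists u; rewrite e quo_pi_repr.
Qed.

Section Descends.
Variables (I : Type) (D : I -> tgroup) (theta : forall i, D i -> Gam).
Variable s : forall i, D i -> quo N.
Variable G : group_scheme k.
Implicit Type c : etale_pi1 x -> points (gstr G) iota.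

Lemma cocycle_quo (c : quo N -> points (gstr G) iota) :
  cocycle (@quo_proj _ _ _ _ x N) c -> cocycle (pi1_proj x) (fun g => c (quo_pi N g)) /\
  trivial_on U (fun g => c (quo_pi N g)).
Proof.
move=> hc; split; first split=> [m|g h]; first exact: (hc.1 m).
  by rewrite quo_piM hc.2 quo_proj_pi.
move=> u Uu; have -> : quo_pi N (pi1_bar u) = 1%tg.
  by apply/esym/quo_clsP; rewrite tinv1 tmul1l; apply/hN; exists u.
exact: (cocycle1 quo_proj_hom hc).
Qed.

Lemma cohomologous_refl (c : etale_pi1 x -> points (gstr G) iota) :
  cohomologous (pi1_proj x) c c.
Proof.
have act1 g : galois_act g (gone G iota) = gone G iota.
  apply: (@tmul_injl (gpts G iota) (galois_act g (gone G iota))).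
  by rewrite tmul1r -[LHS]gactM tmul1l.
exists (gone G iota) => g; rewrite act1.
by rewrite -[RHS]/(((1 : gpts G iota)^-1 * c g * 1)%tg) tinv1 tmul1l tmul1r.
Qed.

Lemma descends_quo (c : quo N -> points (gstr G) iota) :
  cocycle (@quo_proj _ _ _ _ x N) c ->
  descends theta s (fun g => c (quo_pi N g)) -> descends_along_s theta s c.
Proof. by move=> hc; apply; last exact: cohomologous_refl. Qed.

End Descends.
End QuotientGroup.

Lemma ker_subgroup (P Q : tgroup) (f : P -> Q) : is_hom f ->
  is_subgroup (fun g => f g = 1%tg).
Proof.
move=> hf; split=> [|g h eg eh|g eg]; first exact: hom1.
  by rewrite hf eg eh tmul1l.
by rewrite homV // eg tinv1.
Qed.

Lemma ker_normal (P Q : tgroup) (f : P -> Q) : is_hom f ->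
  forall x y, f x = 1%tg -> f (y * x * y^-1)%tg = 1%tg.
Proof. by move=> hf x y e; rewrite !hf e homV // tmul1r tmulVr. Qed.

Theorem corollary1p7
  (k : fieldType) (char0 : [pchar k] =i pred0)
  (kb : closedFieldType) (iota : {rmorphism k -> kb})
  (hiota : is_algebraic_closure iota)
  (X : variety k) (hX : connected (base_change X iota))
  (x : bc_pt X idfun iota)
  (U : etale_pi1 (geom_pt_bar x) -> Prop)
  (hU : is_subgroup U) (hUc : tclosed U)
  (N : normal_subgroup (etale_pi1 x))
  (hN : forall g, N g <-> exists2 u, U u & g = pi1_bar u)
  (I : Type) (ki : I -> fieldType) (j : forall i, {rmorphism k -> ki i})
  (kbi : I -> closedFieldType) (iotai : forall i, {rmorphism ki i -> kbi i})
  (hiotai : forall i, is_algebraic_closure (iotai i))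
  (beta : forall i, {rmorphism kb -> kbi i})
  (hb : forall i, beta i \o iota =1 iotai i \o j i)
  (sigma : forall i, gal_group (iotai i) -> etale_pi1 (geom_pt (hb i) x))
  (hsigma : forall i,
    [/\ is_hom (sigma i), tcontinuous (sigma i)
      & forall g, pi1_proj (geom_pt (hb i) x) (sigma i g) = g]) :
  let theta i (g : gal_group (iotai i)) : gal_group iota :=
    galois_res iota (beta i) g in
  let s i (g : gal_group (iotai i)) : quo N := quo_pi N (pi1_bc (sigma i g)) in
  tdense (fun g : gal_group iota =>
    exists i h z, g = (z * theta i h * z^-1)%tg) ->
  let a := forall (G : group_scheme k)
      (c : etale_pi1 x -> points (gstr G) iota),
    cocycle (pi1_proj x) c -> trivial_on U c ->
    descends theta s c in
  let a' := forall (G : group_scheme k), is_constant G ->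
    forall c : etale_pi1 x -> points (gstr G) iota,
    cocycle (pi1_proj x) c -> trivial_on U c ->
    descends theta s c in
  let a'' := forall (G : group_scheme k)
      (c : etale_pi1 x -> points (gstr G) iota),
    cocycle (pi1_proj x) c -> trivial_on U c ->
    geom_surjective c -> descends theta s c in
  let b := exists t : gal_group iota -> quo N,
    [/\ is_hom t, tcontinuous t & forall i, exists z : quo N,
        forall g, s i g = (z * t (theta i g) * z^-1)%tg] in
  let c := exists2 t : gal_group iota -> quo N, is_section t &
    forall i, exists z : etale_pi1 (geom_pt_bar x),
      forall g, s i g = (quo_pi N (pi1_bar z) * t (theta i g)
                         * (quo_pi N (pi1_bar z))^-1)%tg in
  let d := (exists t : gal_group iota -> quo N, is_section t) /\ a'' in
  [/\ a <-> a', a <-> b, a <-> c & a <-> d].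

Proof.
move=> theta s dens a a' a'' b c d.
have pG : profinite (gal_group iota) := gal_profinite char0 hiota.
have pQ : profinite (quo N) := quo_profinite hUc hN.
have hp := quo_proj_hom char0 hiota hN.
have cp := quo_proj_cont char0 hiota hN.
have ps i h : quo_proj (s i h) = theta i h.
  rewrite /s (quo_proj_pi char0 hiota hN) (pi1_proj_bc char0 hiota (hiotai i)).
  by have [_ _ ->] := hsigma i.
(* Inflation to pi1(X): the hypotheses speak of cocycles there that are trivial on U, whereas the
   approximation argument produces cocycles on the quotient. *)
have lcf (G : group_scheme k) (e : quo N -> points (gstr G) iota) :
    cocycle (@quo_proj _ _ _ _ x N) e ->
    (trivial_on U (fun g => e (quo_pi N g)) ->
      cocycle (pi1_proj x) (fun g => e (quo_pi N g)) ->
      descends theta s (fun g => e (quo_pi N g))) ->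
    descends_along_s theta s e.
  move=> he he'; have [h1 h2] := cocycle_quo char0 hiota hN he.
  by apply: descends_quo => //; apply: he'.
have aa' : a -> a' by move=> h G _; apply: h.
have a'b : a' -> b.
  move=> h; apply: (interpolation pG pQ dens) => V oV.
  (* With t0 trivial the action on the finite quotient is trivial, so the coefficients are
     constant. *)
  apply: (interpolates_of_descends char0 hiota pQ hp cp ps oV (A := nsetT (quo N))
    (t0 := fun=> 1%tg)) => //.
  - by move=> g g'; rewrite tmul1l.
  - move=> B oB; case: (EM (B 1%tg)) => B1.
      have -> : (fun=> B 1%tg) = (fun=> True) :> (gal_group iota -> Prop).
        by apply: funext => g; apply: propext.
      exact: topenT.
    by move=> g /B1.
  move=> G e he _ /(_ (fun=> erefl)) cG; apply: lcf => // h1 h2; exact: h.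
have bc : b -> c.
  move=> [t [ht ct conj]].
  have [t' [ht' ct' pt' conj']] := section_of_interpolation pG dens hp cp ps ht ct conj.
  exists t' => // i; have [z pz hz] := conj' i.
  by have [u e] := quo_proj_ker char0 hiota pz; exists u; rewrite -e.
have ca : c -> a.
  move=> [t [ht ct pt] conj] G e0 _ _ e he _.
  apply: (descends_of_section hp ht ct pt) => // i; have [z hz] := conj i.
  exists (quo_pi N (pi1_bar z)) => //.
  by rewrite (quo_proj_pi char0 hiota hN) pi1_proj_bar.
have db : d -> b.
  move=> [[t0 [ht0 ct0 pt0]] h]; apply: (interpolation pG pQ dens) => V oV.
  (* The cocycle built from t0 is surjective on this kernel, which by [quo_proj_ker] comes from the
     geometric fundamental group; that is the surjectivity in (a''). *)
  pose A := NormalSubgroup (ker_subgroup hp) (ker_normal hp).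
  apply: (interpolates_of_descends char0 hiota pQ hp cp ps oV (A := A) ht0 ct0).
  - by move=> g; rewrite /A /= hp (homV _ hp) pt0 tmulVr.
  - by move=> g e; rewrite (e : quo_proj g = 1%tg); apply: (hom1 ht0).
  move=> G e he surj _; apply: lcf => // h1 h2; apply: h => // m.
  have [v Av <-] := surj m; have [u ->] := quo_proj_ker char0 hiota Av.
  by exists u.
split; split.
- exact: aa'.
- by move=> /a'b /bc /ca.
- by move=> /aa' /a'b.
- by move=> /bc /ca.
- by move=> /aa' /a'b /bc.
- exact: ca.
- by move=> ha; split; [have [t] := bc (a'b (aa' ha)); exists t|move=> G e h1 h2 _; apply: ha].
- by move=> /db /bc /ca.
Qed.
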